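(* Let $\mathcal{D}$ be the Dirichlet space on the open unit disk $\mathbb{D}$. Let $T:\mathcal{D}\to\mathrm{Hol}(\mathbb{D})$ be a linear map (not assumed continuous) that maps nowhere-vanishing functions to nowhere-vanishing functions. Then there exist holomorphic functions $\phi:\mathbb{D}\to\mathbb{D}$ and $\psi:\mathbb{D}\to\mathbb{C}\setminus\{0\}$ such that $$Tf=\psi\cdot(f\circ\phi)\qquad\text{for all } f\in\mathcal{D}.$$
   Context: $\mathbb{D}=\{z\in\mathbb{C}:|z|<1\}$, and $\mathrm{Hol}(\mathbb{D})$ is the set of holomorphic functions $\mathbb{D}\to\mathbb{C}$. For $f\in\mathrm{Hol}(\mathbb{D})$ the Dirichlet integral is $\mathcal{D}(f):=\frac{1}{\pi}\int_{\mathbb{D}}|f'(z)|^2\,dA(z)$, where $dA$ is area (planar Lebesgue) measure. The Dirichlet space is the complex vector space $\mathcal{D}:=\{f\in\mathrm{Hol}(\mathbb{D}):\mathcal{D}(f)<\infty\}$. A function $g$ is nowhere-vanishing if $g(z)\neq 0$ for all $z\in\mathbb{D}$. Linear means complex-linear. *)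

(* Defs.v *)
From HB Require Import structures.
From mathcomp Require Import all_boot all_order all_algebra.
From mathcomp Require Import all_classical all_reals all_analysis.
From mathcomp Require Import measurable_realfun complex lra.

Set Implicit Arguments.
Unset Strict Implicit.
Unset Printing Implicit Defensive.

Import Order.TTheory GRing.Theory Num.Theory.
Import numFieldNormedType.Exports.

Local Open Scope classical_set_scope.
Local Open Scope ring_scope.
Local Open Scope complex_scope.

Local Notation normc := ComplexField.Normc.normc.

Definition disc (R : realType) := {z : R[i] | `|z| < 1}.

(* Only germs at points of the disc matter, so the value 0 outside is
   irrelevant. *)
Definition zero_ext (R : realType) (f : disc R -> R[i]^o) (z : R[i]^o) :
    R[i]^o :=
  if insub z is Some u then f u else 0.

(* [derivable] is taken over the field R[i]: this is complex
   differentiability. *)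
Definition holomorphic (R : realType) (f : disc R -> R[i]^o) : Prop :=
  forall z : disc R, derivable (zero_ext f) (val z : R[i]^o) 1.

Definition point_of (R : realType) (p : R * R) : R[i]^o := p.1 +i* p.2.

Definition plane_disc (R : realType) : set (R * R) :=
  [set p | `|point_of p| < 1].

Definition dirichlet_integral (R : realType) (f : disc R -> R[i]^o) : \bar R :=
  ((pi^-1)%:E *
   \int[(lebesgue_measure \x lebesgue_measure)%E]_(p in @plane_disc R)
     (normc ('D_1 (zero_ext f) (point_of p)) ^+ 2)%:E)%E.

Definition nowhere_vanishing (R : realType) (f : disc R -> R[i]^o) : Prop :=
  forall z, f z != 0.

(* Closure of the Dirichlet space under linear combinations needs f' to be
   measurable on the disc; no regularity of f' is available, so it is obtained
   as a limit of difference quotients of the continuous function f. *)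
Lemma open_prod_measurable (R : realType) (A : set (R * R)) :
  open A -> measurable A.
Proof.
move=> oA.
pose box (k : rat * rat * rat) : set (R * R) :=
  `]ratr k.1.1 - ratr k.2, ratr k.1.1 + ratr k.2[%classic `*`
  `]ratr k.1.2 - ratr k.2, ratr k.1.2 + ratr k.2[%classic.
rewrite (_ : A = \bigcup_(k in [set k | box k `<=` A]) box k); last first.
  apply/seteqP; split=> [[x y] Axy|p [k /= kA kp]]; last exact: kA.
  have /nbhs_ballP[e /= e0 eA] := open_nbhs_nbhs (conj oA Axy).
  have [r /[!inE] /itvP r_e] : exists r, ratr r \in `]0, (e / 2)[%R.
    by apply: rat_in_itvoo; rewrite divr_gt0.
  have rat_near (t : R) : exists q, `|t - ratr q| < ratr r.
    have [|q /[!inE] /itvP qt] := @rat_in_itvoo R (t - ratr r) (t + ratr r).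
      by rewrite ltrD2l gt0_cp// r_e.
    by exists q; rewrite distrC ltr_distl !qt.
  have [q qx] := rat_near x; have [q' qy] := rat_near y.
  have r2e : ratr r + ratr r <= e :> R.
    by rewrite [leRHS]splitr lerD// ltW// r_e.
  exists (q, q', r) => /=; last first.
    by split; rewrite /= in_itv/= -ltr_distl.
  move=> [a b] [/=]; rewrite !in_itv/= -!ltr_distl => qa qb.
  apply: eA; split; rewrite /= /ball/=; apply: lt_le_trans r2e.
    by rewrite -[x](subrK (ratr q)) -addrA (le_lt_trans (ler_normD _ _))//
      ltrD// distrC.
  by rewrite -[y](subrK (ratr q')) -addrA (le_lt_trans (ler_normD _ _))//
      ltrD// distrC.
rewrite bigcup_mkcond; apply: countable_bigcupT_measurable => [|k].
  exact: countableP.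
case: ifP => // _; apply: measurableX; exact: measurable_itv.
Qed.

Lemma open_continuous_prod_measurable (R : realType) (D : set (R * R))
    (g : R * R -> R) : open D -> (forall p, D p -> {for p, continuous g}) ->
  measurable_fun D g.
Proof.
move=> oD cg; apply: (measurability _ (RGenOInfty.measurableE R)).
move=> _ [_ [a ->] <-]; apply: open_prod_measurable.
rewrite openE => p [Dp /=]; rewrite in_itv/= andbT => agp.
rewrite /interior/=; apply: filterI; first exact: open_nbhs_nbhs.
apply: (cg p Dp); apply: open_nbhs_nbhs; split; first exact: rray_open.
by rewrite /= in_itv/= andbT.
Qed.

Lemma ltc_normc (R : realType) (z : R[i]) (e : R) :
  (`|z| < e%:C) = (normc z < e).
Proof. by case: z => x y; rewrite normc_def ltcR. Qed.

Lemma normc_ReIm (R : realType) (z : R[i]) :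
  normc z ^+ 2 = complex.Re z ^+ 2 + complex.Im z ^+ 2.
Proof. by case: z => x y /=; rewrite sqr_sqrtr// addr_ge0// sqr_ge0. Qed.

Lemma ge_absRe (R : realType) (z : R[i]) : `|complex.Re z| <= normc z.
Proof. by case: z => a b /=; rewrite -sqrtr_sqr ler_wsqrtr// lerDl sqr_ge0. Qed.

Lemma ge_absIm (R : realType) (z : R[i]) : `|complex.Im z| <= normc z.
Proof. by case: z => a b /=; rewrite -sqrtr_sqr ler_wsqrtr// lerDr sqr_ge0. Qed.

Lemma part_continuous (R : realType) (g : R[i]^o -> R) :
  {morph g : x y / x - y} -> (forall z, `|g z| <= normc z) ->
  continuous g.
Proof.
move=> gB gle z; apply/(@cvgrPdist_lt _ R^o _ (nbhs z)) => e e0.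
have e0' : 0 < e%:C :> R[i] by rewrite ltcR.
near=> w; rewrite -gB; apply: (le_lt_trans (gle _)).
rewrite -ltc_normc; near: w.
by exists e%:C.
Unshelve. all: by end_near. Qed.

Lemma point_of_continuous (R : realType) : continuous (@point_of R).
Proof.
move=> p; apply/cvgrPdist_lt => -[e i] /[!ltcE]/= /andP[/eqP -> e0].
have e20 : 0 < e / 2 by rewrite divr_gt0.
near=> q.
rewrite -[e +i* 0]/(e%:C) ltc_normc.
have -> : point_of p - point_of q = (p.1 - q.1)%:C + (0 +i* (p.2 - q.2)).
  by rewrite /point_of; simpc.
apply: (le_lt_trans (le_normcD _ _)).
rewrite /= expr0n/= addr0 add0r !sqrtr_sqr [ltRHS]splitr ltrD//.
  near: q; apply: (@cvgr_dist_lt _ R^o _ _ _ fst p.1 _ _ e20).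
  exact: cvg_fst.
near: q; apply: (@cvgr_dist_lt _ R^o _ _ _ snd p.2 _ _ e20).
exact: cvg_snd.
Unshelve. all: by end_near. Qed.

Lemma open_plane_disc (R : realType) : open (@plane_disc R).
Proof.
rewrite openE => p pD; rewrite /interior/=.
have /cvgrPdist_lt cp := @point_of_continuous R p.
have : 0 < 1 - `|point_of p| by rewrite subr_gt0.
move/cp => near_p; near=> q.
rewrite /plane_disc/= -[point_of q](subrK (point_of p)).
apply: (le_lt_trans (ler_normD _ _)); rewrite -ltrBrDr distrC.
by near: q.
Unshelve. all: by end_near. Qed.

Lemma holomorphic_derivable (R : realType) (f : disc R -> R[i]^o) z :
  holomorphic f -> `|z : R[i]| < 1 -> derivable (zero_ext f) z 1.
Proof. by move=> hf z1; exact: hf (exist _ z z1). Qed.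

Lemma measurable_part_zero_ext (R : realType) (g : R[i]^o -> R)
    (f : disc R -> R[i]^o) :
  {morph g : x y / x - y} -> (forall z, `|g z| <= normc z) ->
  holomorphic f ->
  measurable_fun setT (fun p : R * R => g (zero_ext f (point_of p))).
Proof.
move=> gB gle hf.
have mD := open_prod_measurable (@open_plane_disc R).
pose h p := g (zero_ext f (point_of p)).
have g0 : g 0 = 0 by rewrite -(subrr 0) gB subrr.
rewrite -[X in measurable_fun _ X]/h.
have -> : h = h \_ (@plane_disc R).
  apply/funext => p; rewrite patchE; case: ifPn => //.
  rewrite notin_setE => /= Dp; rewrite /h /zero_ext insubF//.
  exact/negP.
apply/(measurable_restrictT _ mD).
apply: open_continuous_prod_measurable => [|p Dp]; first exact: open_plane_disc.
apply: (@continuous_comp _ _ _ (zero_ext f \o @point_of R) g).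
  apply: continuous_comp; first exact: point_of_continuous.
  have /derivable1_diffP := holomorphic_derivable hf Dp.
  exact: differentiable_continuous.
exact: part_continuous.
Qed.

Lemma measurable_part_derive (R : realType) (g : R[i]^o -> R)
    (f : disc R -> R[i]^o) :
  {morph g : x y / x - y} -> (forall z, `|g z| <= normc z) ->
  (forall (k : R) z, g (k%:C * z) = k * g z) ->
  holomorphic f ->
  measurable_fun (@plane_disc R)
    (fun p : R * R => g ('D_1 (zero_ext f) (point_of p))).
Proof.
move=> gB gle gZ hf.
pose F p := g (zero_ext f (point_of p)).
pose q (n : nat) (p : R * R) : R :=
  n.+1%:R * (F (p.1 + n.+1%:R^-1, p.2) - F p).
apply: (@measurable_fun_cvg _ _ _ _ q) => [n|p Dp].
  apply: measurable_funTS; apply: measurable_funM => //.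
  have mF := measurable_part_zero_ext gB gle hf.
  apply: measurable_funB => //.
  apply: (measurableT_comp mF); apply/measurable_fun_pair => //=.
  exact: measurable_funD.
have /cvg_ex[l lP] := holomorphic_derivable hf Dp.
rewrite /derive (cvg_lim _ lP)//.
pose u (n : nat) : R[i]^o := (n.+1%:R^-1 : R)%:C.
have u0 : u @ \oo --> 0^'.
  move=> A [[e i]] /= /[!ltcE]/= /andP[/eqP -> e0] eA.
  suff : \forall n \near \oo, A (u n) by [].
  near=> n; apply: eA; last first.
    by rewrite /u fmorph_eq0 invr_eq0 pnatr_eq0.
  rewrite /= sub0r normrN -[e +i* 0]/(e%:C) ltc_normc /= expr0n/= addr0.
  rewrite sqrtr_sqr ger0_norm//; near: n.
  exact: (near_infty_natSinv_lt (PosNum e0)).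
pose s n := (u n)^-1 *:
  ((zero_ext f \o shift (point_of p)) (u n)%:A - zero_ext f (point_of p)).
have sl : s @ \oo --> l by apply: cvg_comp u0 lP.
have gsl : (g \o s) @ \oo --> g l.
  by apply: continuous_cvg sl; exact: part_continuous.
rewrite (_ : q ^~ p = g \o s)//; apply/funext => n /=.
rewrite /q /F -gB -gZ; congr (g _); rewrite /s.
rewrite -fmorphV invrK /=.
have -> // : point_of (p.1 + n.+1%:R^-1, p.2) = (u n)%:A + point_of p.
by rewrite [(u n)%:A]mulr1 /point_of /u; simpc; rewrite addrC.
Unshelve. all: by end_near. Qed.

Lemma measurable_dirichlet_integrand (R : realType) (f : disc R -> R[i]^o) :
  holomorphic f -> measurable_fun (@plane_disc R) (fun p =>
    (normc ('D_1 (zero_ext f) (point_of p)) ^+ 2)%:E).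
Proof.
move=> hf; apply/measurable_EFinP.
under eq_fun do rewrite normc_ReIm.
apply: measurable_funD; apply: measurable_funX.
  apply: measurable_part_derive hf; [|exact: ge_absRe|].
    by move=> [a b] [c d].
  by move=> k [a b]; simpc.
apply: measurable_part_derive hf; [|exact: ge_absIm|].
  by move=> [a b] [c d].
by move=> k [a b]; simpc.
Qed.

Lemma zero_extD (R : realType) (a : R[i]) (f g : disc R -> R[i]^o) :
  zero_ext (a *: f + g) = a *: zero_ext f + zero_ext g.
Proof.
apply/funext => z; rewrite [RHS]/(a *: zero_ext f z + zero_ext g z) /zero_ext.
case: insub => [u|]; first by [].
by apply/esym; exact: (etrans (addr0 (a *: 0 : R[i]^o)) (scaler0 R[i]^o a)).
Qed.

Lemma zero_ext0 (R : realType) : zero_ext (0 : disc R -> R[i]^o) = cst 0.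
Proof. by apply/funext => z; rewrite /zero_ext; case: insub. Qed.

Lemma derive_zero_extD (R : realType) (a : R[i]) (f g : disc R -> R[i]^o)
    (z : R[i]^o) : holomorphic f -> holomorphic g -> `|z : R[i]| < 1 ->
  'D_1 (zero_ext (a *: f + g)) z =
  (a * 'D_1 (zero_ext f) z + 'D_1 (zero_ext g) z : R[i]).
Proof.
move=> hf hg z1; have dg := holomorphic_derivable hg z1.
have df := holomorphic_derivable hf z1; have dZ := derivableZ df (k := a).
have -> : zero_ext (a *: f + g) = (a \*: zero_ext f) + zero_ext g.
  exact: zero_extD.
rewrite (deriveD dZ dg).
exact: (congr1 (fun w : R[i]^o => w + 'D_1 (zero_ext g) z) (deriveZ a df)).
Qed.

Definition holomorphic_pred (R : realType) : {pred disc R -> R[i]^o} :=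
  fun f => `[< holomorphic f >].

Lemma holomorphic_submod_closed (R : realType) :
  submod_closed (@holomorphic_pred R).
Proof.
split=> [|a f g /asboolP hf /asboolP hg]; apply/asboolP => z.
  by rewrite zero_ext0; exact: derivable_cst.
rewrite zero_extD; apply: derivableD (hg z).
exact: derivableZ (hf z).
Qed.

HB.instance Definition _ (R : realType) :=
  GRing.isSubmodClosed.Build R[i] (disc R -> R[i]^o) (@holomorphic_pred R)
    (@holomorphic_submod_closed R).

Record hol (R : realType) := Hol {
  hol_fun :> disc R -> R[i]^o;
  hol_funP : hol_fun \in @holomorphic_pred R }.

HB.instance Definition _ (R : realType) := [isSub for @hol_fun R].
HB.instance Definition _ (R : realType) := [Choice of hol R by <:].
HB.instance Definition _ (R : realType) :=
  [SubChoice_isSubLmodule of hol R by <:].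

Definition dirichlet_pred (R : realType) : {pred hol R} :=
  fun f => (dirichlet_integral f < +oo)%E.

Lemma dirichlet_predE (R : realType) (f : hol R) :
  (f \in @dirichlet_pred R) =
  (\int[(lebesgue_measure \x lebesgue_measure)%E]_(p in @plane_disc R)
     (normc ('D_1 (zero_ext f) (point_of p)) ^+ 2)%:E
   < +oo)%E.
Proof.
rewrite unfold_in /dirichlet_pred /dirichlet_integral.
set I := (\int[_]_(_ in _) _)%E.
have I0 : (0 <= I)%E by apply: integral_ge0 => p _; rewrite lee_fin sqr_ge0.
have pi0 := pi_gt0 R.
apply/idP/idP => [piI|Ioo].
  rewrite -[I]mul1e -(divff (lt0r_neq0 pi0)) EFinM -muleA.
  by rewrite lte_mul_pinfty// lee_fin ltW.
by rewrite lte_mul_pinfty// lee_fin invr_ge0 ltW.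
Qed.

Lemma integral_lt_pinfty_lin d (T : measurableType d) (R : realType)
    (mu : {measure set T -> \bar R}) (D : set T) (h u v : T -> \bar R)
    (a b : R) :
  measurable D -> measurable_fun D h -> measurable_fun D u ->
  measurable_fun D v -> (forall x, 0 <= h x)%E -> (forall x, 0 <= u x)%E ->
  (forall x, 0 <= v x)%E -> 0 <= a -> 0 <= b ->
  (forall x, D x -> h x <= a%:E * u x + b%:E * v x)%E ->
  (\int[mu]_(x in D) u x < +oo)%E -> (\int[mu]_(x in D) v x < +oo)%E ->
  (\int[mu]_(x in D) h x < +oo)%E.
Proof.
move=> mD mh mu' mv h0 u0 v0 a0 b0 huv uoo voo.
have au0 x : (0 <= a%:E * u x)%E by rewrite mule_ge0.
have bv0 x : (0 <= b%:E * v x)%E by rewrite mule_ge0.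
apply: (@le_lt_trans _ _ (\int[mu]_(x in D) (a%:E * u x + b%:E * v x))%E).
  apply: ge0_le_integral => //.
  exact: (emeasurable_funD (measurable_funeM _ mu') (measurable_funeM _ mv)).
rewrite ge0_integralD//; [|exact: measurable_funeM..].
by rewrite !ge0_integralZl// lte_add_pinfty// lte_mul_pinfty.
Qed.

Lemma dirichlet_submod_closed (R : realType) :
  submod_closed (@dirichlet_pred R).
Proof.
have mD := open_prod_measurable (@open_plane_disc R).
split=> [|a f g].
  rewrite dirichlet_predE zero_ext0 integral0_eq ?ltry// => p _.
  by rewrite derive_cst ComplexField.Normc.normc0 expr0n.
rewrite !dirichlet_predE => If Ig.
have hf := asboolW (hol_funP f); have hg := asboolW (hol_funP g).
have hh := asboolW (hol_funP (a *: f + g)).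
set Na := normc a.
pose df p := (normc ('D_1 (zero_ext f) (point_of p)) ^+ 2)%:E.
pose dg p := (normc ('D_1 (zero_ext g) (point_of p)) ^+ 2)%:E.
have df0 p : (0 <= df p)%E by rewrite lee_fin sqr_ge0.
have dg0 p : (0 <= dg p)%E by rewrite lee_fin sqr_ge0.
have dgf p : plane_disc p ->
    (normc ('D_1 (zero_ext (a *: f + g)) (point_of p)) ^+ 2
     <= 2 * Na ^+ 2 * fine (df p) + 2 * fine (dg p)).
  move=> Dp.
  rewrite (derive_zero_extD a hf hg Dp) /df /dg /=.
  move: ('D_1 (zero_ext f) (point_of p)) ('D_1 (zero_ext g) (point_of p)) => u v.
  have := le_normcD (a * u) v; rewrite ComplexField.Normc.normcM -/Na.
  have : 0 <= normc (a * u + v).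
    by case: (a * u + v) => ? ?; exact: sqrtr_ge0.
  move: (normc (a * u + v)) => n.
  move: (normc u) (normc v) => x y n0 nxy.
  have nn : n ^+ 2 <= (Na * x + y) ^+ 2.
    by rewrite lerXn2r// nnegrE (le_trans n0).
  apply: (le_trans nn).
  have := sqr_ge0 (Na * x - y); rewrite !expr2; lra.
have c2 : 0 <= 2 :> R by [].
have ck : 0 <= 2 * Na ^+ 2 by rewrite mulr_ge0// sqr_ge0.
apply: (@integral_lt_pinfty_lin _ (measurableTypeR R * measurableTypeR R)%type
  R _ (@plane_disc R) _ df dg _ _ mD _ _ _ _ df0 dg0 ck c2 _ If Ig).
- exact: (measurable_dirichlet_integrand hh).
- exact: (measurable_dirichlet_integrand hf).
- exact: (measurable_dirichlet_integrand hg).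
- by move=> p; rewrite lee_fin sqr_ge0.
- by move=> p Dp; have := dgf p Dp; rewrite -lee_fin.
Qed.

HB.instance Definition _ (R : realType) :=
  GRing.isSubmodClosed.Build R[i] (hol R) (@dirichlet_pred R)
    (@dirichlet_submod_closed R).

Record dirichlet (R : realType) := Dirichlet {
  dirichlet_hol :> hol R;
  dirichlet_holP : dirichlet_hol \in @dirichlet_pred R }.

HB.instance Definition _ (R : realType) := [isSub for @dirichlet_hol R].
HB.instance Definition _ (R : realType) := [Choice of dirichlet R by <:].
HB.instance Definition _ (R : realType) :=
  [SubChoice_isSubLmodule of dirichlet R by <:].

(* Main.v *)
(** For fixed [z] the functional [L f = (T f)(z)] does not vanish on
    nowhere-vanishing functions, and it suffices to show that [L] is a multiple
    of the evaluation at some [w] in the disc.  Normalize [L 1 = 1].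

    On polynomials: if [|p| <= B] on the disc, then [a |-> L ((1 - a p / n)^n)]
    is a polynomial of degree at most [n] without zeros in [|a| < n / B], so the
    sum of the squares of its inverse zeros is at most [B^2 / n].  Newton's
    identity turns this into [L (p^2) = (L p)^2] as [n] tends to infinity.  Hence
    [L] is multiplicative on polynomials, [L p = p(w)] with [w = L X], and
    [|w| < 1] because [X - a] is nowhere vanishing for [|a| >= 1].

    On the whole space: suppose [c = f(w) - L f <> 0].  For [s < 1] close to [1]
    take a polynomial [p] that is [C^1]-close to [f(s .)] and put
    [H = f - p + p(w) - L f], so that [L (H - t (X - w)) = 0] for every [t].  Then
    [H(w) = c], and [f - p] is small in Dirichlet norm, so the set
    [E = {|H| < |c| / 2}] has small measure, stays away from [w], and its image
    under [H / (z - w)] has small area.  So this image misses some small [t],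
    for which [H - t (X - w)] is nowhere vanishing: a contradiction.

    The facts needed about holomorphic functions (continuity of [f'] and
    [C^1] approximation by polynomials on smaller discs) are derived from
    Goursat's bisection argument applied to Riemann sums instead of integrals. *)

Require Import Defs.
From HB Require Import structures.
From mathcomp Require Import all_boot all_order all_algebra.
From mathcomp Require Import all_classical all_reals all_analysis.
From mathcomp Require Import measurable_realfun complex ring lra.

Set Implicit Arguments.
Unset Strict Implicit.
Unset Printing Implicit Defensive.

Import Order.TTheory GRing.Theory Num.Theory.
Import numFieldNormedType.Exports.

Local Open Scope classical_set_scope.
Local Open Scope ring_scope.
Local Open Scope complex_scope.

(** [L] carries no continuity, so density of the polynomials cannot transfer [L p = p(w)] to the
    whole space: each [f] needs its own nowhere-vanishing competitor, and the parameter [t] supplies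
    many candidates, of which one must succeed. The polynomial is matched to a dilate because
    [f(s .)] is differentiable beyond the closed disc, whereas [f] need not even be bounded. Small
    energy alone does not control the image of [E]: the derivative of [H / (z - w)] also contains
    [H / (z - w)^2], which is merely bounded on [E], so the area of [E] has to be small too. It is,
    because [|f - f(s .)| >= |c| / 4] on [E], while [f(s .)] tends to [f] pointwise. Both kinds of
    smallness come from one use of Fatou's lemma, since dilation does not increase the energy. The
    area of the image is bounded without a change of variables: a thickened graph is integrated in
    both orders, which costs a constant factor 64. The loss is harmless, as the remaining integral
    can be made as small as desired. *)

Section complex_modulus.
Variable R : realType.
Implicit Types (x y z : R[i]) (r : R) (n : nat).

Definition cmod z : R := ComplexField.Normc.normc z.

Lemma cmod_ge0 z : 0 <= cmod z.
Proof. by case: z => a b; exact: sqrtr_ge0. Qed.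

Lemma cmodD x y : cmod (x + y) <= cmod x + cmod y.
Proof. exact: le_normcD. Qed.

Lemma cmodN x : cmod (- x) = cmod x.
Proof. exact: normcN. Qed.

Lemma cmodB x y : cmod (x - y) <= cmod x + cmod y.
Proof. by rewrite (le_trans (cmodD _ _))// cmodN. Qed.

Lemma cmod_distC x y : cmod (x - y) = cmod (y - x).
Proof. by rewrite -cmodN opprB. Qed.

Lemma cmodM x y : cmod (x * y) = cmod x * cmod y.
Proof. exact: ComplexField.Normc.normcM. Qed.

Lemma cmodV x : cmod x^-1 = (cmod x)^-1.
Proof. exact: ComplexField.Normc.normcV. Qed.

Lemma cmod0 : cmod 0 = 0.
Proof. exact: ComplexField.Normc.normc0. Qed.

Lemma cmod1 : cmod 1 = 1.
Proof. exact: ComplexField.Normc.normc1. Qed.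

Lemma cmodX x n : cmod (x ^+ n) = cmod x ^+ n.
Proof. by elim: n => [|n IH]; rewrite ?expr0 ?cmod1// !exprS cmodM IH. Qed.

Lemma cmod_real r : cmod r%:C = `|r|.
Proof. by rewrite /cmod /= expr0n addr0 sqrtr_sqr. Qed.

Lemma cmod_nat n : cmod n%:R = n%:R.
Proof.
have -> : n%:R = (n%:R : R)%:C :> R[i] by rewrite rmorph_nat.
by rewrite cmod_real ger0_norm.
Qed.

Lemma cmod_eq0 z : (cmod z == 0) = (z == 0).
Proof.
apply/eqP/eqP => [|->]; last exact: cmod0.
exact: ComplexField.Normc.eq0_normc.
Qed.

Lemma cmod_gt0 z : (0 < cmod z) = (z != 0).
Proof. by rewrite lt_neqAle cmod_ge0 andbT eq_sym cmod_eq0. Qed.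

Lemma cmodE z : `|z| = (cmod z)%:C.
Proof. by rewrite normc_def /cmod; case: z. Qed.

Lemma normc_lt1 z : (`|z| < 1) = (cmod z < 1).
Proof. by rewrite cmodE -[1]/(1%:C) ltcR. Qed.

Lemma cmod_sum (I : Type) (s : seq I) (P : pred I) (F : I -> R[i]) :
  cmod (\sum_(i <- s | P i) F i) <= \sum_(i <- s | P i) cmod (F i).
Proof.
elim/big_rec2: _ => [|i a b _ h]; first by rewrite cmod0.
by rewrite (le_trans (cmodD _ _))// lerD2l.
Qed.

Lemma cmod_leReIm z : cmod z <= `|complex.Re z| + `|complex.Im z|.
Proof.
rewrite {1}[z]complexE (le_trans (cmodD _ _))// cmodM !cmod_real.
by rewrite {1}/cmod /= expr0n add0r expr1n sqrtr1 mul1r.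
Qed.

Lemma Re_le_cmod z : `|complex.Re z| <= cmod z.
Proof. exact: ge_absRe. Qed.

Lemma Im_le_cmod z : `|complex.Im z| <= cmod z.
Proof. exact: ge_absIm. Qed.

Lemma sqr_cmod z : cmod z ^+ 2 = complex.Re z ^+ 2 + complex.Im z ^+ 2.
Proof. exact: normc_ReIm. Qed.

End complex_modulus.

(** * Functionals on polynomials *)

Section polynomial_functionals.
Variable R : realType.
Implicit Types (p q : {poly R[i]}) (s : seq R[i]).

(** The coefficients 1 and 2 of [Q] are [- e1] and [e2], the elementary symmetric functions of [s]
    up to sign, so this is Newton's identity for the second power sum. *)
Lemma newton2_prod s (Q := \prod_(b <- s) (1 - b *: 'X : {poly R[i]})) :
  Q`_0 = 1 /\ Q`_1 ^+ 2 - Q`_2 *+ 2 = \sum_(b <- s) b ^+ 2.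
Proof.
rewrite {}/Q; elim: s => [|b s [Q0 Q12]].
  by rewrite !big_nil !coef1 /=; split => //; ring.
rewrite !big_cons; set Q := \prod_(_ <- _) _ in Q0 Q12 *.
rewrite mulrBl mul1r -scalerAl !coefB !coefZ !coefXM/= Q0 -Q12.
by split; ring.
Qed.

(** The constant term 1 normalizes [p] to the product of the factors [1 - X / z] over its zeros [z].
    There are at most [n] of them, each contributing at most [1 / r ^ 2] to the power sum. *)
Lemma newton2_bound p (n : nat) (r : R) : p`_0 = 1 -> (size p <= n.+1)%N ->
  0 < r -> (forall z, cmod z < r -> p.[z] != 0) ->
  cmod (p`_1 ^+ 2 - p`_2 *+ 2) <= n%:R / r ^+ 2.
Proof.
move=> p0 sp r0 pz.
have [s ps] := closed_field_poly_normal p.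
have pn0 : p != 0 by apply: contra_eq_neq p0 => ->; rewrite coef0 eq_sym oner_neq0.
have lc0 : lead_coef p != 0 by rewrite lead_coef_eq0.
have rs z : z \in s -> r <= cmod z.
  move=> zs; rewrite leNgt; apply/negP => /pz.
  rewrite ps hornerZ mulf_eq0 (negPf lc0)/= -/(root _ _).
  by rewrite root_prod_XsubC zs.
have s0 z : z \in s -> z != 0.
  by move=> /rs; rewrite -cmod_gt0; exact: lt_le_trans.
have ss : (size s <= n)%N.
  by rewrite -ltnS (leq_trans _ sp)// ps size_scale// size_prod_XsubC.
have pE : p = \prod_(b <- [seq z^-1 | z <- s]) (1 - b *: 'X).
  pose c := lead_coef p * \prod_(z <- s) (- z).
  suff pc : p = c *: \prod_(b <- [seq z^-1 | z <- s]) (1 - b *: 'X).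
    have c1 : c = 1.
      by move: p0; rewrite pc coefZ (newton2_prod _).1 mulr1.
    by rewrite {1}pc c1 scale1r.
  rewrite /c -scalerA {1}ps; congr (_ *: _).
  rewrite big_map -scaler_prod big_seq [RHS]big_seq.
  apply: eq_bigr => z /s0 z0.
  by rewrite scalerBr scalerA mulNr divff// scaleN1r opprK scaleNr alg_polyC addrC.
have := (newton2_prod [seq z^-1 | z <- s]).2; rewrite -pE => ->.
rewrite big_map (le_trans (cmod_sum _ _ _))//.
apply: (@le_trans _ _ (\sum_(z <- s) r ^- 2)).
  rewrite big_seq [leRHS]big_seq; apply: ler_sum => z /rs rz.
  rewrite cmodX cmodV exprVn lef_pV2 ?posrE ?exprn_gt0 ?(lt_le_trans r0)//.
  by rewrite lerXn2r// ?nnegrE ?cmod_ge0 ?ltW.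
rewrite big_const_seq count_predT iter_addr addr0 -[leLHS]mulr_natl.
by rewrite ler_wpM2r ?ler_nat// invr_ge0 exprn_ge0// ltW.
Qed.

Lemma poly_disc_bounded p :
  exists2 B : R, 0 < B & forall z, cmod z < 1 -> cmod p.[z] <= B.
Proof.
exists (1 + \sum_(i < size p) cmod p`_i) => [|z z1].
  by rewrite ltr_pwDl// sumr_ge0// => i _; exact: cmod_ge0.
rewrite horner_coef (le_trans (cmod_sum _ _ _))//.
rewrite -[leLHS]add0r lerD// ler_sum// => i _.
by rewrite cmodM cmodX ler_piMr ?cmod_ge0// exprn_ile1 ?cmod_ge0// ltW.
Qed.

Variable Lam : {linear {poly R[i]} -> R[i]^o}.
Hypothesis Lam_neq0 :
  forall p, (forall z, cmod z < 1 -> p.[z] != 0) -> Lam p != 0.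

Lemma functional_sqr p : Lam 1 = 1 -> Lam (p ^+ 2) = Lam p ^+ 2.
Proof.
move=> Lam1; have [B B0 pB] := poly_disc_bounded p.
pose m k := Lam (p ^+ k).
(* [Q n] is the polynomial [a |-> Lam ((1 - (a / n) p) ^ n)]: it has degree at
   most [n] and no zero of modulus less than [n / B]. *)
pose Q n : {poly R[i]} :=
  \poly_(k < n.+1) ('C(n, k)%:R * (- n%:R^-1) ^+ k * m k).
have QE n a : (Q n).[a] = Lam ((1 - (a / n%:R) *: p) ^+ n).
  rewrite /Q horner_poly -scaleNr exprDn raddf_sum/=; apply: eq_bigr => k _.
  rewrite expr1n mul1r exprZn raddfMn/= linearZ/= -/(m k) -[RHS]mulr_natl.
  rewrite (_ : - (a / n%:R) = a * - n%:R^-1); last by rewrite mulrN.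
  rewrite exprMn (_ : _ *: _ = a ^+ k * (- n%:R^-1) ^+ k * m k :> R[i])//; ring.
have Q0 n : (Q n)`_0 = 1.
  by rewrite coef_poly/= bin0 !expr0 /m expr0 Lam1 !mulr1.
(* [newton2_bound] in degree [n + 2] with [r = (n + 2) / B]. Twice the second coefficient carries
   the factor [(n + 2) (n + 1) / (n + 2) ^ 2 = 1 - 1 / (n + 2)]. *)
have bound n : cmod (m 1%N ^+ 2 - (1 - n.+2%:R^-1) * m 2) <= B ^+ 2 / n.+2%:R.
  have nB0 : 0 < n.+2%:R / B by rewrite divr_gt0.
  have := newton2_bound (Q0 n.+2) (size_poly _ _) nB0.
  have -> : (Q n.+2)`_1 = - m 1%N.
    by rewrite coef_poly/= bin1 expr1 mulrN divff ?mulN1r// pnatr_eq0.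
  have -> : (Q n.+2)`_2 *+ 2 = (1 - n.+2%:R^-1) * m 2.
    rewrite coef_poly/= -[LHS]mulr_natl !mulrA -natrM mulnC.
    have -> : ('C(n.+2, 2) * 2)%N = (n.+2 * n.+1)%N.
      by have := bin_ffact n.+2 2; rewrite ffactnS ffactn1.
    rewrite natrM -[n.+1%:R](addrK 1) natr1.
    by move: (pnatr_eq0 R[i] n.+2) => /negbT; move: n.+2%:R => u u0; field.
  rewrite sqrrN => /(_ _)/le_trans; apply.
    (* A zero [u] of [1 - (z / n) p] in the disc, with [n] short for [n.+2], would give
       [n = |z| |p(u)| <= |z| B], against [|z| < n / B]. *)
    move=> z zn; rewrite QE; apply: Lam_neq0 => u u1.
    rewrite horner_exp expf_neq0// hornerD hornerN hornerZ hornerC subr_eq0.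
    apply: contraTneq zn => zu1; rewrite -leNgt ler_pdivrMr//.
    have := congr1 (@cmod R) zu1; rewrite cmod1 !cmodM cmodV cmod_nat => E.
    have -> : n.+2%:R = cmod z * cmod p.[u].
      have n0 : (n.+2%:R : R)^-1 != 0 by rewrite invr_eq0 pnatr_eq0.
      by apply: (mulIf n0); rewrite divff ?pnatr_eq0// [LHS]E mulrAC.
    by rewrite ler_wpM2l ?cmod_ge0// pB.
  rewrite expr_div_n invf_div mulrCA ler_wpM2l ?sqr_ge0// expr2 invfM mulrA.
  by rewrite divff// mul1r.
apply/eqP; rewrite -[Lam (p ^+ 2)]/(m 2) -subr_eq0 -cmod_eq0 -[p]expr1 -/(m 1%N).
rewrite eq_le cmod_ge0 andbT; apply/ler_addgt0Pr => e e0; rewrite add0r.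
(* Two errors of order [1 / n]: [B ^ 2] from the zeros, and [cmod (m 2)] from replacing the factor
   [1 - 1 / n] by 1. *)
pose K := B ^+ 2 + cmod (m 2).
have K0 : 0 <= K by rewrite addr_ge0 ?sqr_ge0 ?cmod_ge0.
have [n nK] : exists n, K / e < n.+2%:R.
  exists (Num.bound (K / e)).
  rewrite (lt_le_trans (archi_boundP _)) ?divr_ge0 ?(ltW e0)//.
  by rewrite ler_nat -addn2 leq_addr.
apply: (@le_trans _ _ (K / n.+2%:R)); last first.
  by rewrite ler_pdivrMr// mulrC -ler_pdivrMr// ltW.
have -> : m 2 - m 1%N ^+ 2 =
   n.+2%:R^-1 * m 2 - (m 1%N ^+ 2 - (1 - n.+2%:R^-1) * m 2) by ring.
rewrite (le_trans (cmodB _ _))// /K [leLHS]addrC [leRHS]mulrDl lerD ?bound//.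
by rewrite cmodM cmodV cmod_nat mulrC.
Qed.

(** Polarization of [functional_sqr]. *)
Lemma functional_mul p q : Lam 1 = 1 -> Lam (p * q) = Lam p * Lam q.
Proof.
move=> Lam1.
have polar (F : numFieldType) (a b x : F) :
    a ^+ 2 + x *+ 2 + b ^+ 2 = (a + b) ^+ 2 -> x = a * b.
  rewrite sqrrD => /addIr/addrI; rewrite -[LHS]mulr_natl -[RHS]mulr_natl.
  by apply: mulfI; rewrite pnatr_eq0.
apply: (@polar R[i]); rewrite -(functional_sqr p Lam1) -(functional_sqr q Lam1).
rewrite -[RHS]/((Lam p + Lam q : R[i]^o) ^+ 2) -(raddfD Lam p q)/=.
rewrite -(functional_sqr (p + q) Lam1).
rewrite sqrrD (raddfD Lam (_ + _)) (raddfD Lam (p ^+ 2)) (raddfMn Lam 2)/=.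
by [].
Qed.

End polynomial_functionals.

(** Dividing by [Lam 1] makes the functional unital, hence multiplicative. Horner's scheme then
    determines it by its value at ['X]. *)
Lemma functional_poly_eval (R : realType) (Lam : {linear {poly R[i]} -> R[i]^o}) :
  (forall p, (forall z, cmod z < 1 -> p.[z] != 0) -> Lam p != 0) ->
  exists2 w, cmod w < 1 & forall p, Lam p = Lam 1 * p.[w].
Proof.
move=> Lam_neq0.
have Lam1 : Lam 1 != 0 by apply: Lam_neq0 => z _; rewrite hornerE oner_neq0.
pose L p : R[i]^o := (Lam 1)^-1 * Lam p.
have linL : linear L.
  by move=> a p q; rewrite /L linearP/= mulrDr; congr (_ + _); exact: mulrCA.
have [LL LE] : exists LL : {linear {poly R[i]} -> R[i]^o}, LL =1 L.
  pose LL : {linear {poly R[i]} -> R[i]^o} :=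
    HB.pack L (GRing.isLinear.Build _ _ _ _ L linL).
  by exists LL.
have LL1 : LL 1 = 1 by rewrite LE /L mulVf.
have LL0 p : (forall z, cmod z < 1 -> p.[z] != 0) -> LL p != 0.
  by move=> /Lam_neq0 Lp; rewrite LE /L mulf_neq0// invr_eq0.
have LLE p : LL p = p.[LL 'X].
  elim/poly_ind: p => [|p c IH]; first by rewrite raddf0 horner0.
  rewrite raddfD/= (functional_mul LL0)// IH !hornerE; congr (_ + _).
  rewrite -[c%:P]mulr1 mul_polyC linearZ/= LL1.
  exact: (mulr1 (c : R[i])).
exists (LL 'X) => [|p].
  rewrite ltNge; apply/negP => w1.
  have := LLE ('X - (LL 'X)%:P); rewrite !hornerE subrr => /eqP.
  apply/negP/LL0 => z z1; rewrite !hornerE subr_eq0.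
  by apply: contraTneq z1 => ->; rewrite -leNgt.
by rewrite -LLE LE /L mulVKf.
Qed.

(** * Compactness of closed discs and epsilon-delta calculus *)

Section complex_compactness.
Variable R : realType.
Implicit Types (u : nat -> R[i]) (f g : R[i] -> R[i]) (r e d : R).

(** Bolzano-Weierstrass for the real and imaginary parts in a compact square. Saying that the
    sequence returns near [l] beyond every [N] spares the extraction of a subsequence. *)
Lemma complex_cluster u r : (forall n, cmod (u n) <= r) ->
  exists2 l, cmod l <= r &
    forall e N, 0 < e -> exists2 n, (N <= n)%N & cmod (u n - l) < e.
Proof.
move=> ur.
pose v n : R * R := (complex.Re (u n), complex.Im (u n)).
pose A : set (R * R) := `[- r, r]%classic `*` `[- r, r]%classic.
have cA : compact A by apply: compact_setX; exact: segment_compact.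
have vA n : A (v n).
  split; rewrite /= in_itv/= -ler_norml.
    exact: le_trans (Re_le_cmod _) (ur n).
  exact: le_trans (Im_le_cmod _) (ur n).
have FvA : (v @ \oo) A by exists 0%N => // n _; exact: vA.
have [[x y] [_ xy]] := cA (v @ \oo) _ FvA.
have uxy e N : 0 < e -> exists2 n, (N <= n)%N & cmod (u n - (x +i* y)) < e.
  move=> e0; have e20 : 0 < e / 2 by rewrite divr_gt0.
  have tail : (v @ \oo) (v @` [set n | (N <= n)%N]).
    by exists N => // n Nn; exists n.
  have [_ [[n Nn <-] [/= xn yn]]] := xy _ _ tail (nbhsx_ballx (x, y) _ e20).
  exists n => //; rewrite (le_lt_trans (cmod_leReIm _))// [ltRHS]splitr.
  rewrite raddfB/= (raddfB (@complex.Im R)) ltrD//= distrC.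
    exact: xn.
  exact: yn.
exists (x +i* y) => //; apply/ler_addgt0Pr => e e0.
have [n _ un] := uxy e 0%N e0.
rewrite -[x +i* y](subrKC (u n)) (le_trans (cmodD _ _))// lerD//.
by rewrite cmod_distC ltW.
Qed.

Lemma complex_cauchy u :
  (forall e, 0 < e -> exists N, forall m n, (N <= m)%N -> (N <= n)%N ->
     cmod (u m - u n) <= e) ->
  exists l, forall e, 0 < e -> exists N, forall n, (N <= n)%N ->
    cmod (u n - l) <= e.
Proof.
move=> cu; have [N0 uN0] := cu 1 ltr01.
have [|l _ ul] := @complex_cluster (fun n => u (N0 + n)%N) (1 + cmod (u N0)).
  move=> n; rewrite -[u _](subrK (u N0)) (le_trans (cmodD _ _))// lerD2r.
  by rewrite uN0// leq_addr.
exists l => e e0; have e20 : 0 < e / 2 by rewrite divr_gt0.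
have [N uN] := cu _ e20; exists N => n Nn.
have [m Nm um] := ul _ N e20.
rewrite -[u n](subrK (u (N0 + m)%N)) -addrA [leRHS]splitr.
rewrite (le_trans (cmodD _ _))// lerD//; last exact: ltW.
by rewrite uN// (leq_trans Nm)// leq_addl.
Qed.

Definition ccont_at f z := forall e, 0 < e -> exists2 d, 0 < d &
  forall u : R[i], cmod (u - z) < d -> cmod (f u - f z) <= e.

(** The denominator is cleared, so [u = z] needs no separate case and the inequality is literally
    the local affine approximation that Goursat's argument uses. *)
Definition cderiv_at f z (a : R[i]) := forall e, 0 < e -> exists2 d, 0 < d &
  forall u : R[i], cmod (u - z) < d ->
    cmod (f u - f z - a * (u - z)) <= e * cmod (u - z).

Lemma cderiv_cont f z a : cderiv_at f z a -> ccont_at f z.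
Proof.
move=> fz e e0; have [d d0 fd] := fz 1 ltr01.
have a1 : 0 < 1 + cmod a by rewrite ltr_pwDl// cmod_ge0.
exists (Num.min d (e / (1 + cmod a))); first by rewrite lt_min d0 divr_gt0.
move=> u; rewrite lt_min => /andP[/fd h ue].
rewrite -[f u - f z](subrK (a * (u - z))) (le_trans (cmodD _ _))//.
rewrite (@le_trans _ _ ((1 + cmod a) * cmod (u - z)))//.
  by rewrite mulrDl lerD// cmodM.
by rewrite mulrC -ler_pdivlMr// ltW.
Qed.

Lemma ccont_bounded f r : (forall z, cmod z <= r -> ccont_at f z) ->
  exists2 M, 0 < M & forall z, cmod z <= r -> cmod (f z) <= M.
Proof.
move=> fr; apply: contrapT => nb.
have /choice[u ub] (n : nat) : exists z, cmod z <= r /\ n.+1%:R < cmod (f z).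
  apply: contrapT => nz; apply: nb; exists n.+1%:R => // z zr.
  by rewrite leNgt; apply/negP => nfz; apply: nz; exists z.
have [l lr ul] := complex_cluster (fun n => (ub n).1).
have [d d0 fd] := fr l lr 1 ltr01.
pose N := Num.bound (cmod (f l) + 1).
have [n Nn /fd] := ul d N d0; apply/negP; rewrite -ltNge.
rewrite -[ltLHS](addrK (cmod (f l))) ltrBlDr.
rewrite (@lt_le_trans _ _ (cmod (f (u n))))//; last first.
  by rewrite -{1}[f (u n)](subrK (f l)) cmodD.
rewrite addrC (lt_trans _ (ub n).2)// (lt_le_trans (archi_boundP _))//.
  by rewrite addr_ge0 ?cmod_ge0.
by rewrite ler_nat (leq_trans Nn).
Qed.

(** Heine-Cantor: pairs violating uniformity at scale [1 / (n + 1)] would accumulate at one point of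
    the closed disc, where [f] is continuous. *)
Lemma ccont_uniform f r e : 0 < e -> (forall z, cmod z <= r -> ccont_at f z) ->
  exists2 d, 0 < d & forall x y, cmod x <= r -> cmod y <= r ->
    cmod (x - y) < d -> cmod (f x - f y) <= e.
Proof.
move=> e0 fr; apply: contrapT => nb.
have /choice[u ub] (n : nat) : exists z : R[i] * R[i],
    [/\ cmod z.1 <= r, cmod z.2 <= r, cmod (z.1 - z.2) < n.+1%:R^-1 &
        e < cmod (f z.1 - f z.2)].
  apply: contrapT => nz; apply: nb; exists n.+1%:R^-1 => // x y xr yr xy.
  by rewrite leNgt; apply/negP => nfz; apply: nz; exists (x, y).
have u1 n : cmod (u n).1 <= r by case: (ub n).
have [l lr ul] := complex_cluster u1.
have e20 : 0 < e / 2 by rewrite divr_gt0.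
have [d d0 fd] := fr l lr _ e20.
have d20 : 0 < d / 2 by rewrite divr_gt0.
pose N := Num.bound (d / 2)^-1.
have [n Nn un] := ul _ N d20.
have [_ _ u12 uf] := ub n.
have u12' : cmod ((u n).1 - (u n).2) < d / 2.
  rewrite (lt_le_trans u12)// -[leRHS]invrK lef_pV2 ?posrE ?invr_gt0//.
  rewrite ltW// (lt_le_trans (archi_boundP _)) ?invr_ge0 ?(ltW d20)//.
  by rewrite ler_nat (leq_trans Nn).
have f1 : cmod (f (u n).1 - f l) <= e / 2.
  by apply: fd; rewrite (lt_le_trans un)// ler_pdivrMr// ler_peMr ?ler1n// ltW.
have f2 : cmod (f (u n).2 - f l) <= e / 2.
  apply: fd; rewrite -[_ - l](subrKA (u n).1) (le_lt_trans (cmodD _ _))//.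
  by rewrite [ltRHS]splitr ltrD// cmod_distC.
move: uf; apply/negP; rewrite -leNgt -[_ - f (u n).2](subrKA (f l)).
by rewrite (le_trans (cmodD _ _))// [leRHS]splitr lerD// cmod_distC.
Qed.

End complex_compactness.

(** * Goursat's theorem *)

Section goursat.
Variable R : realType.
Implicit Types (a b c z : R[i]) (g : R[i] -> R[i]) (n k : nat).

Definition midpoint a b : R[i] := (a + b) / 2.

(** Stands in for convexity: bisection only ever creates midpoints. *)
Definition midpoint_closed (K : R[i] -> Prop) :=
  forall a b, K a -> K b -> K (midpoint a b).

Lemma midpointC a b : midpoint a b = midpoint b a.
Proof. by rewrite /midpoint addrC. Qed.

Lemma midpointBl a b : midpoint a b - a = (b - a) / 2.
Proof. by rewrite /midpoint; field. Qed.

Lemma midpointBr a b : b - midpoint a b = (b - a) / 2.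
Proof. by rewrite /midpoint; field. Qed.

Lemma midpointB a b c : midpoint a b - midpoint a c = (b - c) / 2.
Proof. by rewrite /midpoint; field. Qed.

Lemma cmod_half a : cmod (a / 2) = cmod a / 2.
Proof. by rewrite cmodM cmodV cmod_nat. Qed.

Lemma midpoint_closed_ball z r : midpoint_closed (fun a => cmod (a - z) <= r).
Proof.
move=> a b az bz; have -> : midpoint a b - z = (a - z) / 2 + (b - z) / 2.
  by rewrite /midpoint; field.
by rewrite (le_trans (cmodD _ _))// [leRHS]splitr !cmod_half lerD// ler_pM2r.
Qed.

(* The composite midpoint rule with [2 ^ n] pieces stands in for the integral
   of [g] along the segment from [a] to [b]: it is additive under bisection and
   odd under reversal on the nose, so no integral is ever formed. *)
Fixpoint midsum g n a b : R[i] :=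
  if n is n'.+1 then midsum g n' a (midpoint a b) + midsum g n' (midpoint a b) b
  else g (midpoint a b) * (b - a).

Lemma midsumN g n a b : midsum g n b a = - midsum g n a b.
Proof.
elim: n a b => [|n IH] a b /=; first by rewrite midpointC -mulrN opprB.
by rewrite (midpointC b a) IH (IH a) -opprD addrC.
Qed.

(** The midpoint rule is exact for affine functions at every level, so only the distance of [g] from
    the affine function, times the length, enters the error. *)
Lemma midsum_affine g (K : R[i] -> Prop) p q z (e : R) n a b :
  midpoint_closed K -> (forall u, K u -> cmod (g u - p - q * (u - z)) <= e) ->
  K a -> K b ->
  cmod (midsum g n a b - (p + q * (midpoint a b - z)) * (b - a)) <=
    e * cmod (b - a).
Proof.
move=> mK Kg; elim: n a b => [|n IH] a b Ka Kb /=.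
  by rewrite -mulrBl cmodM opprD addrA ler_wpM2r ?cmod_ge0// Kg//; exact: mK.
set m := midpoint a b; have Km : K m by exact: mK.
have -> : (p + q * (m - z)) * (b - a) =
    (p + q * (midpoint a m - z)) * (m - a) + (p + q * (midpoint m b - z)) * (b - m).
  by rewrite /m /midpoint; field.
rewrite opprD addrACA (le_trans (cmodD _ _))//.
rewrite (le_trans (lerD (IH _ _ Ka Km) (IH _ _ Km Kb)))//.
by rewrite midpointBl midpointBr cmod_half -mulrDr -splitr.
Qed.

Lemma midsum_const g (K : R[i] -> Prop) p (e : R) n a b : midpoint_closed K ->
  (forall u, K u -> cmod (g u - p) <= e) -> K a -> K b ->
  cmod (midsum g n a b - p * (b - a)) <= e * cmod (b - a).
Proof.
move=> mK Kg Ka Kb; have := @midsum_affine g K p 0 0 e n a b mK _ Ka Kb.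
by rewrite mul0r addr0; apply=> u /Kg; rewrite mul0r subr0.
Qed.

Definition trisum g n a b c := midsum g n a b + midsum g n b c + midsum g n c a.

(** Each side of the middle triangle is also run through, in the opposite direction, by one corner
    triangle. By [midsumN] these terms cancel exactly. *)
Lemma trisumS g n a b c (ab := midpoint a b) (bc := midpoint b c)
    (ca := midpoint c a) : trisum g n.+1 a b c =
  trisum g n a ab ca + trisum g n ab b bc + trisum g n ca bc c +
  trisum g n ab bc ca.
Proof.
rewrite /trisum/= -/ab -/bc -/ca (midsumN g n ca ab) (midsumN g n ab bc).
by rewrite (midsumN g n bc ca); ring.
Qed.

(** A bound on the upper limit. It suffices for the estimates, so convergence of the midpoint sums
    never has to be established. *)
Definition eventually_small (F : nat -> R[i]) (e : R) :=
  exists N, forall n, (N <= n)%N -> cmod (F n) <= e.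

Lemma eventually_trisumS g a b c (e1 e2 e3 e4 : R) (ab := midpoint a b)
    (bc := midpoint b c) (ca := midpoint c a) :
  eventually_small (fun n => trisum g n a ab ca) e1 ->
  eventually_small (fun n => trisum g n ab b bc) e2 ->
  eventually_small (fun n => trisum g n ca bc c) e3 ->
  eventually_small (fun n => trisum g n ab bc ca) e4 ->
  eventually_small (fun n => trisum g n a b c) (e1 + e2 + e3 + e4).
Proof.
move=> [N1 h1] [N2 h2] [N3 h3] [N4 h4].
exists (maxn (maxn N1 N2) (maxn N3 N4)).+1 => -[//|n].
rewrite ltnS !geq_max => /andP[/andP[n1 n2] /andP[n3 n4]].
rewrite trisumS (le_trans (cmodD _ _))// lerD ?h4//.
rewrite (le_trans (cmodD _ _))// lerD ?h3//.
by rewrite (le_trans (cmodD _ _))// lerD ?h1 ?h2.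
Qed.

(** The increments from index [k] on add up to at most [s / 2 ^ k * (1 + 1/2 + 1/4 + ...)]. *)
Lemma geometric_limit (u : nat -> R[i]) (s : R) : 0 <= s ->
  (forall k, cmod (u k.+1 - u k) <= s / 2 ^+ k) ->
  exists l, forall k, cmod (u k - l) <= s *+ 2 / 2 ^+ k.
Proof.
move=> s0 us.
have step k m : cmod (u (k + m)%N - u k) <= s *+ 2 / 2 ^+ k * (1 - 2 ^- m).
  elim: m => [|m IH].
    by rewrite addn0 subrr cmod0 expr0 invr1 subrr mulr0.
  rewrite addnS -[u _](subrK (u (k + m)%N)) -addrA (le_trans (cmodD _ _))//.
  rewrite (le_trans (lerD (us _) IH))// exprD exprS.
  have p0 j : (2 : R) ^+ j != 0 by rewrite expf_neq0.
  rewrite le_eqVlt; apply/orP; left; apply/eqP.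
  by field; rewrite !p0.
have s2 k : 0 <= s *+ 2 / 2 ^+ k by rewrite divr_ge0 ?exprn_ge0// mulrn_wge0.
have stepw k m : (k <= m)%N -> cmod (u m - u k) <= s *+ 2 / 2 ^+ k.
  move=> km; rewrite -(subnKC km) (le_trans (step _ _))// ler_piMr//.
have small e : 0 < e -> exists k, s *+ 2 / 2 ^+ k <= e.
  move=> e0; exists (Num.bound (s *+ 2 / e)).
  rewrite ler_pdivrMr ?exprn_gt0// mulrC -ler_pdivrMr//.
  rewrite (le_trans (ltW (archi_boundP _))) ?divr_ge0 ?mulrn_wge0 ?(ltW e0)//.
  by rewrite -natrX ler_nat ltnW// ltn_expl.
have [|l ul] := @complex_cauchy R u.
  move=> e e0; have e20 : 0 < e / 2 by rewrite divr_gt0.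
  have [k ke] := small _ e20; exists k => m n km kn.
  rewrite -[u m - u n](subrKA (u k)) (le_trans (cmodD _ _))// [leRHS]splitr.
  have h j kj : cmod (u j - u k) <= e / 2 := le_trans (stepw _ _ kj) ke.
  by rewrite lerD ?h// cmod_distC h.
exists l => k; apply/ler_addgt0Pr => e /ul[N uN].
rewrite -[u k - l](subrKA (u (maxn k N))) (le_trans (cmodD _ _))// lerD//.
  by rewrite cmod_distC stepw// leq_maxl.
by rewrite uN// leq_maxr.
Qed.

Definition seq_closed (K : R[i] -> Prop) := forall z,
  (forall e : R, 0 < e -> exists2 a, K a & cmod (a - z) <= e) -> K z.

Local Notation triangle := (R[i] * R[i] * R[i])%type.

(** If the triangle is not good for [e], some quarter is not good for [e / 4]. Iterating yields
    nested bad triangles shrinking to a point [l]. There [g] is affine up to a small multiple of the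
    distance, the affine part sums to zero around a triangle, and the rest is of the order of the
    squared diameter, which also shrinks like [1 / 4 ^ k]. *)
Lemma goursat_triangle g (K : R[i] -> Prop) a b c : midpoint_closed K ->
  seq_closed K -> (forall z, K z -> exists d, cderiv_at g z d) ->
  K a -> K b -> K c ->
  forall e : R, 0 < e -> eventually_small (fun n => trisum g n a b c) e.
Proof.
move=> mK cK dK Ka Kb Kc e e0; apply: contrapT => bad0.
pose good (e : R) (D : triangle) :=
  eventually_small (fun n => trisum g n D.1.1 D.1.2 D.2) e.
pose inK (D : triangle) := [/\ K D.1.1, K D.1.2 & K D.2].
pose sides (D : triangle) (s : R) := [/\ cmod (D.1.2 - D.1.1) <= s,
  cmod (D.2 - D.1.2) <= s & cmod (D.1.1 - D.2) <= s].
(* The conditions on the current triangle are premises under the existential, so that [choice]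
   returns a total function to iterate. *)
have next (De : triangle * R) : exists D' : triangle,
    inK De.1 -> ~ good De.2 De.1 ->
    [/\ inK D', (forall s, sides De.1 s -> sides D' (s / 2)),
        (forall s, sides De.1 s -> cmod (D'.1.1 - De.1.1.1) <= s) &
        ~ good (De.2 / 4) D'].
  case: De => -[[x y] z] d; apply: contrapT => nex.
  have [[Kx Ky Kz] bad] : inK (x, y, z) /\ ~ good d (x, y, z).
    by apply: contrapT => nD; apply: nex; exists (x, y, z) => /= KD bD; case: nD.
  apply: bad; rewrite /good/=.
  have -> : d = d / 4 + d / 4 + d / 4 + d / 4 by field.
  set xy := midpoint x y; set yz := midpoint y z; set zx := midpoint z x.
  have Kxy : K xy by exact: mK.
  have Kyz : K yz by exact: mK.
  have Kzx : K zx by exact: mK.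
  have sub (D' : triangle) : inK D' ->
      (forall s, sides (x, y, z) s -> sides D' (s / 2)) ->
      (forall s, sides (x, y, z) s -> cmod (D'.1.1 - x) <= s) ->
      good (d / 4) D'.
    by move=> KD' sD' nD'; apply: contrapT => bD'; apply: nex; exists D'.
  have s0 s : sides (x, y, z) s -> 0 <= s.
    by case=> + _ _; apply: le_trans; exact: cmod_ge0.
  have s2 s : sides (x, y, z) s -> s / 2 <= s.
    by move=> /s0 ?; rewrite ler_pdivrMr// ler_peMr// ler1n.
  have near_xy s : sides (x, y, z) s -> cmod (xy - x) <= s.
    move=> sD; rewrite /xy midpointBl cmod_half (le_trans _ (s2 _ sD))//.
    by case: sD => /= + _ _; rewrite ler_pM2r.
  have near_zx s : sides (x, y, z) s -> cmod (zx - x) <= s.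
    move=> sD; rewrite cmod_distC /zx midpointBr cmod_half (le_trans _ (s2 _ sD))//.
    by case: sD => /= _ _; rewrite ler_pM2r.
  apply: eventually_trisumS.
  - apply: (sub (x, xy, zx)) => //= s sD; last by rewrite subrr cmod0 s0.
    case: sD; rewrite /sides/= /xy /zx => s1 s2' s3.
    by rewrite midpointBl midpointBr (midpointC z x) midpointB
      !cmod_half !ler_pM2r// (cmod_distC z y).
  - apply: (sub (xy, y, yz)) => //= s.
    case; rewrite /sides/= /xy /yz => s1 s2' s3.
    by rewrite midpointBl midpointBr (midpointC x y) midpointB
      !cmod_half !ler_pM2r// (cmod_distC x z).
  - apply: (sub (zx, yz, z)) => //= s.
    case; rewrite /sides/= /yz /zx => s1 s2' s3.
    split; rewrite ?midpointBr ?midpointBl 1?(midpointC y z) ?midpointB;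
      by rewrite cmod_half ler_pM2r// cmod_distC.
  - apply: (sub (xy, yz, zx)) => //= s.
    case; rewrite /sides/= /xy /yz /zx => s1 s2' s3.
    split; [rewrite (midpointC x y)|rewrite (midpointC y z)|rewrite (midpointC z x)];
      by rewrite midpointB cmod_half ler_pM2r// cmod_distC.
have [nxt nxtP] := choice next.
pose D := fix D k : triangle :=
  if k is k'.+1 then nxt (D k', e / 4 ^+ k') else (a, b, c).
(* The summand 1 keeps [s] positive for a degenerate triangle. *)
pose s := cmod (b - a) + cmod (c - b) + cmod (a - c) + 1.
have s0 : 0 < s by rewrite ltr_wpDl// !addr_ge0// cmod_ge0.
have Dinv k : [/\ inK (D k), sides (D k) (s / 2 ^+ k) & ~ good (e / 4 ^+ k) (D k)].
  elim: k => [|k [KD sD bD]].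
    rewrite /= !expr0 !divr1; split => //.
    have [] : [/\ 0 <= cmod (b - a), 0 <= cmod (c - b) & 0 <= cmod (a - c)].
      by split; exact: cmod_ge0.
    by rewrite /s; split => /=; lra.
  have [|KD' sD' _ bD'] := nxtP (D k, e / 4 ^+ k) KD; first by [].
  rewrite !exprSr !invfM !mulrA; split => //.
  by have := sD' _ sD.
have [l Dl] : exists l, forall k, cmod ((D k).1.1 - l) <= s *+ 2 / 2 ^+ k.
  apply: geometric_limit => [|k]; first exact: ltW.
  have [KD sD bD] := Dinv k.
  by have [|_ _ + _] := nxtP (D k, e / 4 ^+ k) KD; [by []|apply].
have small r : 0 < r -> exists k, s / 2 ^+ k < r.
  move=> r0; exists (Num.bound (s / r)).
  rewrite ltr_pdivrMr ?exprn_gt0// mulrC -ltr_pdivrMr//.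
  rewrite (lt_le_trans (archi_boundP _)) ?divr_ge0 ?(ltW s0) ?(ltW r0)//.
  by rewrite -natrX ler_nat ltnW// ltn_expl.
have Kl : K l.
  apply: cK => r r0; have [|k kr] := small (r / 2); first by rewrite divr_gt0.
  exists (D k).1.1; first by case: (Dinv k) => -[].
  by rewrite (le_trans (Dl k))// mulrnAl -mulr_natr -ler_pdivlMr// ltW.
have [d gd] := dK l Kl.
(* With [t = s / 2 ^ k] each of the three sides has error at most [eps * (3 t) * t]. The total
   [9 * eps * t ^ 2] is exactly [e / 4 ^ k]. *)
pose eps := e / (9 * s ^+ 2).
have eps0 : 0 < eps by rewrite divr_gt0// mulr_gt0// exprn_gt0.
have [del del0 gdel] := gd eps eps0.
have [|k kdel] := small (del / 3); first by rewrite divr_gt0.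
have [[Kx Ky Kz] [sx sy sz] bad] := Dinv k; apply: bad.
set t := s / 2 ^+ k in kdel sx sy sz.
have t0 : 0 <= t by rewrite divr_ge0 ?exprn_ge0// ltW.
(* The first vertex is within [2 t] of [l], and the other two are within [t] of the first. The
   choice of [k] gives [3 t < del]. *)
pose B u := cmod (u - l) <= 3 * t.
have mB : midpoint_closed B by exact: midpoint_closed_ball.
have xl : cmod ((D k).1.1 - l) <= 2 * t.
  by rewrite mulrA mulr_natl (le_trans (Dl k)).
have Bx : B (D k).1.1 by rewrite /B (le_trans xl)// ler_wpM2r// ler_nat.
have three : 3 * t = t + 2 * t by ring.
have By : B (D k).1.2.
  by rewrite /B -[_ - l](subrKA (D k).1.1) (le_trans (cmodD _ _))// three lerD.
have Bz : B (D k).2.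
  rewrite /B -[_ - l](subrKA (D k).1.1) (le_trans (cmodD _ _))// three lerD//.
  by rewrite cmod_distC.
have Bg u : B u -> cmod (g u - g l - d * (u - l)) <= eps * (3 * t).
  move=> Bu; rewrite (le_trans (gdel u _))//.
    by rewrite (le_lt_trans Bu)// mulrC -ltr_pdivlMr.
  by rewrite ler_wpM2l// ltW.
have side u v n : B u -> B v -> cmod (v - u) <= t ->
    cmod (midsum g n u v - (g l + d * (midpoint u v - l)) * (v - u)) <=
    eps * (3 * t) * t.
  move=> Bu Bv uv; rewrite (le_trans (midsum_affine _ mB Bg Bu Bv))//.
  by apply: ler_wpM2l => //; apply: mulr_ge0; [exact: ltW|exact: mulr_ge0].
exists 0%N => n _.
move: (side _ _ n Bx By sx) (side _ _ n By Bz sy) (side _ _ n Bz Bx sz).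
rewrite /trisum; case: (D k) => -[x y] z /= {}sx {}sy {}sz.
have affine0 : (g l + d * (midpoint x y - l)) * (y - x) +
    (g l + d * (midpoint y z - l)) * (z - y) +
    (g l + d * (midpoint z x - l)) * (x - z) = 0 by rewrite /midpoint; field.
rewrite -[X in cmod X]subr0 -affine0.
set A := (_ * (y - x)) in sx *; set B' := (_ * (z - y)) in sy *.
set C := (_ * (x - z)) in sz *.
rewrite [X in cmod X](_ : _ = (midsum g n x y - A) + (midsum g n y z - B') +
  (midsum g n z x - C)); last by ring.
rewrite (le_trans (cmodD _ _))// (le_trans (lerD (cmodD _ _) (lexx _)))//.
rewrite (le_trans (lerD (lerD sx sy) sz))//.
rewrite /eps /t le_eqVlt; apply/orP; left; apply/eqP.
have -> : (4 : R) ^+ k = 2 ^+ k * 2 ^+ k by rewrite -exprMn -natrM.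
by field; rewrite expf_neq0//= gt_eqF.
Qed.

Lemma Re_half a : complex.Re (a / 2) = complex.Re a / 2.
Proof.
have -> : (2 : R[i])^-1 = (2^-1 : R)%:C by rewrite fmorphV rmorph_nat.
by case: a => x y; simpc.
Qed.

(** The region keeps away from [z]: the real part is the inner product of [u - z] with the conjugate
    of [v], so for [h > 0] the half-plane misses [z]. *)
Lemma midpoint_closed_halfplane z v r (h : R) : midpoint_closed
  (fun u => cmod u <= r /\ h <= complex.Re ((u - z) * v)).
Proof.
move=> a b [ar ah] [br bh]; split.
  by have := @midpoint_closed_ball 0 r a b; rewrite !subr0; apply.
have -> : (midpoint a b - z) * v = ((a - z) * v) / 2 + ((b - z) * v) / 2.
  by rewrite /midpoint; field.
by rewrite raddfD/= !Re_half [leLHS]splitr lerD// ler_pM2r.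
Qed.

Lemma seq_closed_halfplane z v r (h : R) : seq_closed
  (fun u => cmod u <= r /\ h <= complex.Re ((u - z) * v)).
Proof.
move=> u uP; split.
  apply/ler_addgt0Pr => e /uP[a [ar _] au].
  by rewrite -[u](subrKC a) (le_trans (cmodD _ _))// lerD// cmod_distC.
apply/ler_addgt0Pr => e e0; have v0 : 0 < cmod v + 1 by rewrite ltr_wpDl ?cmod_ge0.
have [|a [_ ah] au] := uP (e / (cmod v + 1)); first by rewrite divr_gt0.
rewrite (le_trans ah)// -lerBlDl -raddfB/= -mulrBl.
rewrite (le_trans (ler_norm _))// (le_trans (Re_le_cmod _))// opprB addrA subrK.
rewrite cmodM; move: au; rewrite ler_pdivlMr//; apply: le_trans.
by rewrite ler_wpM2l ?cmod_ge0// lerDl.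
Qed.

(* The apex [z] may be a point where [g] is merely bounded nearby: bisecting
   [k] times pushes it into a corner whose perimeter has shrunk by [2 ^ k]. *)
Lemma goursat_apex g z v a b r (M : R) : cmod z <= r ->
  (forall u, cmod u <= r -> cmod (g u) <= M) ->
  (forall u, cmod u <= r -> u != z -> exists d, cderiv_at g u d) ->
  cmod a <= r -> cmod b <= r ->
  0 < complex.Re ((a - z) * v) -> 0 < complex.Re ((b - z) * v) ->
  forall e : R, 0 < e -> eventually_small (fun n => trisum g n z a b) e.
Proof.
move=> zr gM dg.
pose P (a b : R[i]) := cmod (a - z) + cmod (b - a) + cmod (z - b).
have M0 : 0 <= M by rewrite (le_trans _ (gM z zr))// cmod_ge0.
have mid_r x y : cmod x <= r -> cmod y <= r -> cmod (midpoint x y) <= r.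
  by have := @midpoint_closed_ball 0 r x y; rewrite !subr0; apply.
suff main k : forall a b, cmod a <= r -> cmod b <= r ->
    0 < complex.Re ((a - z) * v) -> 0 < complex.Re ((b - z) * v) ->
    forall e : R, 0 < e ->
    eventually_small (fun n => trisum g n z a b) (M * P a b / 2 ^+ k + e).
  move=> ar br av bv e e0; have e20 : 0 < e / 2 by rewrite divr_gt0.
  have P0 : 0 <= P a b by rewrite !addr_ge0// cmod_ge0.
  pose k := Num.bound (M * P a b / (e / 2)).
  have [N HN] := main k a b ar br av bv _ e20.
  exists N => n /HN/le_trans; apply; rewrite [leRHS]splitr lerD2r.
  rewrite ler_pdivrMr ?exprn_gt0// [leRHS]mulrC -ler_pdivrMr//.
  have q0 : 0 <= M * P a b / (e / 2) by apply: divr_ge0; [exact: mulr_ge0|exact: ltW].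
  rewrite (le_trans (ltW (archi_boundP q0)))//.
  by rewrite -natrX ler_nat ltnW// ltn_expl.
elim: k => [|k IH] {}a {}b ar br av bv e e0.
  exists 0%N => n _; rewrite expr0 divr1.
  pose B (u : R[i]) := cmod (u - 0) <= r.
  have mB : midpoint_closed B by exact: midpoint_closed_ball.
  have side x y : cmod x <= r -> cmod y <= r ->
      cmod (midsum g n x y) <= M * cmod (y - x).
    move=> xr yr; have := @midsum_const g B 0 M n x y mB.
    rewrite mul0r subr0; apply; rewrite /B ?subr0// => u.
    by rewrite !subr0; exact: gM.
  rewrite /trisum (le_trans (cmodD _ _))// (le_trans (lerD (cmodD _ _) (lexx _)))//.
  rewrite (le_trans (lerD (lerD (side _ _ _ _) (side _ _ _ _)) (side _ _ _ _)))//.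
  by rewrite /P !mulrDr lerDl ltW.
have e40 : 0 < e / 4 by rewrite divr_gt0.
(* Midpoints towards the apex [z] have half the height of [a] or [b]. With this [h] they still lie
   in [K], as do [a] and [b], so three of the four quarters lie in [K], away from [z], and only the
   corner at [z] is left to the induction. *)
pose h := Num.min (complex.Re ((a - z) * v)) (complex.Re ((b - z) * v)) / 2.
have h0 : 0 < h by rewrite divr_gt0// lt_min av.
pose K u := cmod u <= r /\ h <= complex.Re ((u - z) * v).
have Kd u : K u -> exists d, cderiv_at g u d.
  move=> [ur uh]; apply: dg => //; apply: contraTneq uh => ->.
  by rewrite subrr mul0r -ltNge.
have K_side : (h * 2 <= complex.Re ((a - z) * v)) /\
    (h * 2 <= complex.Re ((b - z) * v)).
  by rewrite /h divfK//; split; rewrite ge_min lexx ?orbT.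
have hh2 : h <= h * 2 by rewrite ler_peMr ?ler1n// ltW.
have Ka : K a by split=> //; apply: le_trans hh2 _; case: K_side.
have Kb : K b by split=> //; apply: le_trans hh2 _; case: K_side.
have mK : midpoint_closed K by exact: midpoint_closed_halfplane.
have Kh u : cmod u <= r -> h * 2 <= complex.Re ((u - z) * v) -> K (midpoint z u).
  move=> ur uh; split; first exact: mid_r.
  by rewrite midpointBl mulrAC Re_half ler_pdivlMr.
have Kza : K (midpoint z a) by apply: Kh => //; case: K_side.
have Kbz : K (midpoint b z) by rewrite midpointC; apply: Kh => //; case: K_side.
have Kab : K (midpoint a b) by exact: mK.
have tri := goursat_triangle mK (@seq_closed_halfplane _ _ _ _) Kd.
have -> : M * P a b / 2 ^+ k.+1 + e =
    (M * P (midpoint z a) (midpoint b z) / 2 ^+ k + e / 4) + e / 4 + e / 4 + e / 4.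
  have -> : P (midpoint z a) (midpoint b z) = P a b / 2.
    rewrite /P midpointBl midpointBr (midpointC b z) midpointB !cmod_half.
    by rewrite -!mulrDl.
  by rewrite exprS; field; rewrite expf_neq0.
apply: eventually_trisumS; [apply: IH|apply: tri..] => //.
- exact: mid_r.
- exact: mid_r.
- by rewrite midpointBl mulrAC Re_half divr_gt0.
- by rewrite midpointC midpointBl mulrAC Re_half divr_gt0.
Qed.

End goursat.

(** * Approximation by polynomials *)

Section polynomial_approximation.
Variable R : realType.
Implicit Types (z u w : R[i]) (f g : R[i] -> R[i]) (p : {poly R[i]}) (r e : R).

Lemma sqrt_halfplane z : exists w, w ^+ 2 = z /\ 0 <= complex.Re w.
Proof.
have [h|h] := leP 0 (complex.Re (sqrtc z)).
  by exists (sqrtc z); rewrite sqr_sqrtc.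
by exists (- sqrtc z); rewrite sqrrN sqr_sqrtc raddfN/= oppr_ge0 ltW.
Qed.

(** Iterated square roots of -1, always with real part [>= 0]. As
    [om m - 1 = (om m.+1 - 1) (om m.+1 + 1)] and the last factor has squared modulus at least 2, the
    squared distance to 1 at least halves each time. The order divides [2 ^ m.+1] but not [2 ^ m],
    because [om m ^+ (2 ^ m) = -1]. *)
Lemma dyadic_roots : exists om : nat -> R[i],
  (forall m, (2 ^ m.+1).-primitive_root (om m)) /\
  forall e, 0 < e -> exists m0, forall m, (m0 <= m)%N -> cmod (om m - 1) < e.
Proof.
have [sq sqP] := choice sqrt_halfplane.
pose om m := iter m sq (-1).
have omX m : om m ^+ (2 ^ m) = -1.
  by elim: m => [|m IH]; rewrite ?expr1// expnS exprM /= (sqP _).1.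
have om1 m : cmod (om m) = 1.
  elim: m => [|m IH]; first by rewrite cmodN cmod1.
  apply/eqP; rewrite -(@eqrXn2 _ 2)// ?cmod_ge0// expr1n -cmodX.
  by rewrite /= (sqP _).1 IH.
have om_sq m : cmod (om m - 1) ^+ 2 <= 4 / 2 ^+ m.
  elim: m => [|m IH].
    rewrite expr0 divr1 -[om 0%N]/(-1) -opprD cmodN -[1 + 1]/(2%:R) cmod_nat.
    by rewrite -natrX ler_nat.
  rewrite [2 ^+ m.+1]exprSr invfM mulrA ler_pdivlMr// (le_trans _ IH)//.
  have [sE sR] := sqP (om m); have : om m - 1 = (om m.+1 - 1) * (om m.+1 + 1).
    by rewrite -subr_sqr expr1n /= sE.
  move=> ->; rewrite cmodM exprMn ler_wpM2l ?sqr_ge0//.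
  have : cmod (om m.+1) ^+ 2 = 1 by rewrite om1 expr1n.
  rewrite !sqr_cmod; move: sR; rewrite -[sq (om m)]/(om m.+1).
  by case: (om m.+1) => x y /=; nra.
exists om; split=> [m|e e0].
  have N0 : (0 < 2 ^ m.+1)%N by rewrite expn_gt0.
  have omN : om m ^+ (2 ^ m.+1) = 1 by rewrite expnSr exprM omX sqrrN expr1n.
  have [d dP dm] := prim_order_exists N0 omN.
  have /(dvdn_pfactor _ _ (isT : prime 2))[k km dE] := dm.
  suff -> : m.+1 = k by rewrite -dE.
  apply/eqP; rewrite eqn_leq km andbT leqNgt ltnS; apply/negP => kltm.
  have : (d %| 2 ^ m)%N by rewrite dE dvdn_exp2l.
  rewrite (prim_order_dvd dP) omX -subr_eq0 -opprD oppr_eq0.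
  by rewrite -[1 + 1]/(2%:R) pnatr_eq0.
have e20 : 0 < e ^+ 2 by rewrite exprn_gt0.
exists (Num.bound (4 / e ^+ 2)) => m mN.
rewrite -(@ltr_pXn2r _ 2) ?nnegrE ?cmod_ge0 ?(ltW e0)//.
rewrite (le_lt_trans (om_sq m))// ltr_pdivrMr ?exprn_gt0//.
have q0 : 0 <= 4 / e ^+ 2 by apply: divr_ge0 => //; exact: ltW.
rewrite [ltRHS]mulrC -ltr_pdivrMr// (lt_le_trans (archi_boundP q0))//.
by rewrite -natrX ler_nat (leq_trans mN)// ltnW// ltn_expl.
Qed.

Lemma prim_root_cmod N w : N.-primitive_root w -> cmod w = 1.
Proof.
move=> wN; apply/eqP; rewrite -(@eqrXn2 _ N) ?(prim_order_gt0 wN) ?cmod_ge0//.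
by rewrite expr1n -cmodX (prim_expr_order wN) cmod1.
Qed.

Lemma sum_unity_root N z : z ^+ N = 1 -> z != 1 -> \sum_(k < N) z ^+ k = 0.
Proof.
move=> zN z1; have z10 : z - 1 != 0 by rewrite subr_eq0.
by apply: (mulfI z10); rewrite mulr0 -subrX1 zN subrr.
Qed.

Lemma cderiv_horner p w : cderiv_at (horner p) w p^`().[w].
Proof.
elim/poly_ind: p => [|p c IH] e e0.
  exists 1 => // u _; rewrite deriv0 !horner0 mul0r !subr0 cmod0.
  by rewrite mulr_ge0 ?cmod_ge0 ?ltW.
have w1 : 0 < (cmod w + 1) * 2 by rewrite mulr_gt0// ltr_wpDl ?cmod_ge0.
have a1 : 0 < (cmod p^`().[w] + 1) * 2 by rewrite mulr_gt0// ltr_wpDl ?cmod_ge0.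
have [|d d0 hd] := IH (e / ((cmod w + 1) * 2)); first by rewrite divr_gt0.
(* The bound [d] serves the induction hypothesis, 1 gives [|u| <= |w| + 1], and the last one makes
   the cross term [p'(w) h ^ 2] at most [e / 2 * |h|]. *)
exists (Num.min (Num.min d 1) (e / ((cmod p^`().[w] + 1) * 2))).
  by rewrite !lt_min d0 ltr01 divr_gt0.
move=> u; rewrite !lt_min => /andP[/andP[/hd ud u1] ue].
rewrite derivD derivM derivX derivC !hornerE.
set h := u - w in ud u1 ue *.
have -> : p.[u] * u + c - (p.[w] * w + c) - (p^`().[w] * w + p.[w]) * h =
    (p.[u] - p.[w] - p^`().[w] * h) * u + p^`().[w] * h * h by rewrite /h; ring.
rewrite (le_trans (cmodD _ _))// [e in leRHS]splitr [leRHS]mulrDl lerD//.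
  rewrite cmodM; apply: le_trans (ler_wpM2r (cmod_ge0 _) ud) _.
  have uw : cmod u <= cmod w + 1.
    by rewrite -[u](subrKC w) (le_trans (cmodD _ _))// lerD2l ltW.
  apply: le_trans (ler_wpM2l _ uw) _.
    by rewrite mulr_ge0 ?cmod_ge0// divr_ge0// ltW.
  rewrite le_eqVlt; apply/orP; left; apply/eqP; field.
  by rewrite gt_eqF// ltr_wpDl ?cmod_ge0.
rewrite !cmodM ler_wpM2r ?cmod_ge0// mulrC.
have a0 : 0 < cmod p^`().[w] + 1 by rewrite ltr_wpDl ?cmod_ge0.
rewrite (@le_trans _ _ (cmod h * (cmod p^`().[w] + 1)))//.
  by rewrite ler_wpM2l ?cmod_ge0// lerDl.
by rewrite -ler_pdivlMr// -mulrA -invfM mulrC ltW// mulrC [2 * _]mulrC.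
Qed.

(** Quotient rule at a zero of the numerator. Its uses first subtract from a function the multiple
    of [u - z] that creates such a zero, which only changes the quotient by a constant. *)
Lemma cderiv_div g z w a : g w = 0 -> w != z -> cderiv_at g w a ->
  cderiv_at (fun u => g u / (u - z)) w (a / (w - z)).
Proof.
move=> gw wz ga e e0.
have D0 : 0 < cmod (w - z) by rewrite cmod_gt0 subr_eq0.
set D := cmod (w - z) in D0.
have a1 : 0 < cmod a + 1 by rewrite ltr_wpDl ?cmod_ge0.
have [|d d0 hd] := ga (e * D / 4); first by rewrite divr_gt0// mulr_gt0.
exists (Num.min (Num.min d (D / 2)) (e * D ^+ 2 / (4 * (cmod a + 1)))).
  by rewrite !lt_min d0 !divr_gt0 ?mulr_gt0 ?exprn_gt0.
move=> u; rewrite !lt_min => /andP[/andP[/hd ud uD] ue].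
rewrite gw subr0 in ud *; rewrite mul0r subr0.
have uz : D / 2 <= cmod (u - z).
  rewrite -(lerD2r (D / 2)) -splitr {1}/D -[w - z](subrKA u).
  rewrite (le_trans (cmodD _ _))// addrC lerD2l cmod_distC ltW//.
have uz0 : 0 < cmod (u - z) by apply: lt_le_trans uz; rewrite divr_gt0.
have uzn : u - z != 0 by rewrite -cmod_gt0.
have wzn : w - z != 0 by rewrite subr_eq0.
have -> : g u / (u - z) - a / (w - z) * (u - w) =
    (g u - a * (u - w)) / (u - z) - a * (u - w) * (u - w) / ((u - z) * (w - z)).
  by field; rewrite uzn wzn.
have iuz : (cmod (u - z))^-1 <= 2 / D.
  by rewrite -[2 / D]invf_div lef_pV2 ?posrE// divr_gt0.
rewrite (le_trans (cmodB _ _))// [e in leRHS]splitr [leRHS]mulrDl lerD//.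
  rewrite cmodM cmodV (le_trans (ler_wpM2l (cmod_ge0 _) iuz))//.
  rewrite (le_trans (ler_wpM2r (divr_ge0 _ (ltW D0)) ud))//.
  rewrite le_eqVlt; apply/orP; left; apply/eqP; field.
  by rewrite gt_eqF.
rewrite !cmodM cmodV cmodM invfM -/D.
apply: (@le_trans _ _ ((cmod a + 1) * cmod (u - w) *
    (e * D ^+ 2 / (4 * (cmod a + 1))) * (2 / D / D))).
  have iD : 0 <= D^-1 by rewrite invr_ge0 ltW.
  apply: ler_pM; rewrite ?mulr_ge0 ?invr_ge0 ?cmod_ge0 ?(ltW D0)//.
    apply: ler_pM; rewrite ?mulr_ge0 ?cmod_ge0 ?(ltW ue)//.
    by rewrite ler_wpM2r ?cmod_ge0// lerDl.
  by rewrite ler_wpM2r.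
rewrite le_eqVlt; apply/orP; left; apply/eqP; field.
by rewrite !gt_eqF.
Qed.

End polynomial_approximation.

(** * Difference quotients and a discrete Cauchy theorem *)

Section difference_quotient.
Variable R : realType.
Implicit Types (z u w : R[i]) (f df g : R[i] -> R[i]) (r e : R).

(** The value at [z] fills the removable singularity. The function is then continuous, hence bounded
    near [z], as [goursat_apex] requires of the apex. *)
Definition dquot f df z u := if u == z then df z else (f u - f z) / (u - z).

(** With [H] the slope at [u], the numerator [G = f - f z - H (x - z)] vanishes at [u], and off [z]
    the quotient equals [H + G / (x - z)]. *)
Lemma dquot_deriv f df z u : u != z -> cderiv_at f u (df u) ->
  exists d, cderiv_at (dquot f df z) u d.
Proof.
move=> uz fu; pose H := (f u - f z) / (u - z).
have uzn : u - z != 0 by rewrite subr_eq0.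
pose G x := f x - f z - H * (x - z).
have Gu : G u = 0 by rewrite /G /H divfK ?subrr.
have dG : cderiv_at G u (df u - H).
  move=> e /fu[d d0 hd]; exists d => // x /hd.
  by congr (cmod _ <= _); rewrite Gu subr0 /G /H; field.
exists ((df u - H) / (u - z)) => e e0.
have [d d0 hd] := cderiv_div Gu uz dG e0.
exists (Num.min d (cmod (u - z))); first by rewrite lt_min d0 cmod_gt0.
move=> x; rewrite lt_min => /andP[/hd xd xz].
have xzn : x != z by apply: contraTneq xz => ->; rewrite -leNgt cmod_distC.
move: xd; congr (cmod _ <= _); rewrite Gu mul0r subr0 /dquot (negPf xzn) (negPf uz).
rewrite -/H /G; congr (_ - _); rewrite mulrBl mulfK// subr_eq0//.
Qed.

Lemma dquot_cont f df z u : cderiv_at f z (df z) -> cderiv_at f u (df u) ->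
  ccont_at (dquot f df z) u.
Proof.
move=> fz fu; have [->|uz] := eqVneq u z; last first.
  by have [d /cderiv_cont] := dquot_deriv uz fu.
move=> e e0; have [d d0 hd] := fz e e0; exists d => // x xd.
rewrite /dquot eqxx; case: eqVneq => [_|xz].
  by rewrite subrr cmod0 ltW.
have xzn : x - z != 0 by rewrite subr_eq0.
rewrite -(ler_pM2r (_ : 0 < cmod (x - z))) ?cmod_gt0// -cmodM mulrBl divfK//.
exact: hd.
Qed.

(** The point [z] enters only through the distance [k] and the bound [M], so one regular polygon
    will serve all [z] in a smaller disc. *)
Lemma dquotB f df z u w (k M d : R) : 0 < k -> k <= cmod (u - z) ->
  k <= cmod (w - z) -> cmod (f u - f w) <= d -> cmod (f w - f z) <= M ->
  cmod (dquot f df z u - dquot f df z w) <= d / k + M * cmod (u - w) / k ^+ 2.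
Proof.
move=> k0 ku kw fuw fwz.
have uz : u - z != 0 by rewrite -cmod_gt0 (lt_le_trans k0).
have wz : w - z != 0 by rewrite -cmod_gt0 (lt_le_trans k0).
rewrite /dquot -[u == z]subr_eq0 -[w == z]subr_eq0 (negPf uz) (negPf wz).
have -> : (f u - f z) / (u - z) - (f w - f z) / (w - z) =
    (f u - f w) / (u - z) - (f w - f z) * (u - w) / ((u - z) * (w - z)).
  by field; rewrite uz wz.
have iu : (cmod (u - z))^-1 <= k^-1 by rewrite lef_pV2 ?posrE// (lt_le_trans k0).
have iw : (cmod (w - z))^-1 <= k^-1 by rewrite lef_pV2 ?posrE// (lt_le_trans k0).
rewrite (le_trans (cmodB _ _))// lerD// !cmodM cmodV.
  by rewrite ler_pM ?invr_ge0 ?cmod_ge0.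
rewrite cmodM invfM expr2 invfM.
rewrite ler_pM ?mulr_ge0 ?invr_ge0 ?cmod_ge0//.
  by rewrite ler_wpM2r ?cmod_ge0.
by rewrite ler_pM ?invr_ge0 ?cmod_ge0.
Qed.

Lemma Re_mulJ z : complex.Re (z * z^*%C) = cmod z ^+ 2.
Proof. by rewrite sqr_cmod; case: z => x y /=; ring. Qed.

Lemma cmodJ z : cmod z^*%C = cmod z.
Proof. by case: z => x y; rewrite /cmod /= sqrrN. Qed.

Lemma eventually_small_sum (F : nat -> nat -> R[i]) e N :
  (forall k, (k < N)%N -> eventually_small (F k) e) ->
  eventually_small (fun n => \sum_(k < N) F k n) (e *+ N).
Proof.
elim: N => [|N IH] FN.
  by exists 0%N => n _; rewrite big_ord0 cmod0 mulr0n.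
have [N1 h1] := IH (fun k kN => FN k (ltnW kN)).
have [N2 h2] := FN N (ltnSn N).
exists (maxn N1 N2) => n; rewrite geq_max => /andP[n1 n2].
by rewrite big_ord_recr mulrSr (le_trans (cmodD _ _))// lerD ?h1 ?h2.
Qed.

Variables (f df : R[i] -> R[i]) (r : R).
Hypothesis r0 : 0 < r.
Hypothesis f_deriv : forall u, cmod u <= r -> cderiv_at f u (df u).

(* Triangles with apex [z] over the sides of the regular polygon inscribed in
   the circle of radius [r]: the spokes cancel in pairs. *)
Lemma polygon_sum z N om e k : cmod z < r -> (1 < N)%N ->
  N.-primitive_root om -> cmod (om - 1) * r <= k ->
  k * 2 <= r - cmod z ->
  (forall u w, cmod u <= r -> cmod w <= r -> cmod (u - w) <= cmod (om - 1) * r ->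
    k <= cmod (u - z) -> k <= cmod (w - z) ->
    cmod (dquot f df z u - dquot f df z w) <= e) ->
  cmod (\sum_(j < N) dquot f df z (r%:C * om ^+ j) * (r%:C * om ^+ j)) <=
  e * r *+ N.
Proof.
move=> zr N1 omN sk small osc; move: k sk small osc => kap sk small osc.
pose g := dquot f df z; pose zt k := r%:C * om ^+ k.
have om1 := prim_root_cmod omN.
have ztr k : cmod (zt k) = r.
  by rewrite /zt cmodM cmodX om1 expr1n mulr1 cmod_real gtr0_norm.
pose s := cmod (om - 1) * r.
have om_neq : om - 1 != 0.
  rewrite subr_eq0 -[om]expr1 -(prim_order_dvd omN) dvdn1.
  by apply: contraTneq N1 => ->.
have s0 : 0 < s by rewrite mulr_gt0// cmod_gt0.
have ztS k : zt k.+1 - zt k = (om - 1) * zt k by rewrite /zt exprS; ring.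
have ztSc k : cmod (zt k.+1 - zt k) = s by rewrite ztS cmodM ztr.
have zrw := ltW zr.
have [M M0 gM] : exists2 M, 0 < M & forall u, cmod u <= r -> cmod (g u) <= M.
  by apply: ccont_bounded => u ur; apply: dquot_cont; exact: f_deriv.
have far k : kap * 2 <= cmod (zt k - z).
  rewrite (le_trans small)// -(ztr k) lerBlDr -{1}[zt k](subrK z); exact: cmodD.
(* The half-plane direction is the conjugate of [zt k - z]. The next vertex is at distance
   [s <= kap], less than [|zt k - z|], so it lies strictly on the same side of [z]. *)
have tri k (d : R) : 0 < d ->
    eventually_small (fun n => trisum g n z (zt k) (zt k.+1)) d.
  apply: (@goursat_apex _ g z (zt k - z)^*%C _ _ r M) => //; rewrite ?ztr//.
  - by move=> u ur uz; apply: dquot_deriv => //; exact: f_deriv.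
  - rewrite Re_mulJ exprn_gt0//; apply: lt_le_trans (far k).
    by rewrite mulr_gt0// (lt_le_trans s0).
  - have -> : zt k.+1 - z = (zt k - z) + (zt k.+1 - zt k) by ring.
    rewrite mulrDl raddfD/= Re_mulJ.
    have := Re_le_cmod ((zt k.+1 - zt k) * (zt k - z)^*%C).
    rewrite cmodM cmodJ ztSc ler_norml => /andP[+ _].
    have := far k; move: sk; rewrite -/s.
    move: (complex.Re _) (cmod (zt k - z)) s0 => x y; nra.
have total n : \sum_(k < N) trisum g n z (zt k) (zt k.+1) =
    \sum_(k < N) midsum g n (zt k) (zt k.+1).
  pose h k := midsum g n z (zt k).
  have triE k : trisum g n z (zt k) (zt k.+1) =
      midsum g n (zt k) (zt k.+1) - (h k.+1 - h k).
    by rewrite /trisum /h (midsumN _ _ z); ring.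
  under eq_bigr do rewrite triE.
  rewrite big_split/= sumrN -(big_mkord xpredT (fun k => h k.+1 - h k)).
  rewrite telescope_sumr// /h /zt (prim_expr_order omN) expr0 subrr.
  by rewrite oppr0 addr0.
have near_chord k n :
    cmod (midsum g n (zt k) (zt k.+1) - g (zt k) * (zt k.+1 - zt k)) <= e * s.
  pose K u := cmod u <= r /\ cmod (u - zt k) <= s.
  have mK : midpoint_closed K.
    move=> a b [ar ak] [br bk]; split; last exact: midpoint_closed_ball.
    by have := @midpoint_closed_ball R 0 r a b; rewrite !subr0; apply.
  rewrite -[in leRHS](ztSc k).
  apply: (@midsum_const R g K) => // [u [ur uk]||]; last 2 first.
  - by rewrite /K subrr cmod0 ztr; split=> //; exact: ltW.
  - by rewrite /K ztSc ztr.
  apply: osc; rewrite ?ztr// -/s; last first.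
    by rewrite (le_trans _ (far k))// ler_peMr// ?ler1n// (le_trans _ sk)// ltW.
  rewrite -(lerD2r kap) -[kap + kap]mulr2n -[kap *+ 2]mulr_natr.
  rewrite (le_trans (far k))// -[zt k - z](subrKA u) (le_trans (cmodD _ _))//.
  by rewrite addrC lerD2l cmod_distC (le_trans uk).
have om_gt0 : 0 < cmod (om - 1) by rewrite cmod_gt0.
(* As [(om - 1) * zt k] is the chord from vertex [k] to the next, this factor turns the sum into a
   Riemann sum along the polygon. *)
rewrite -(ler_pM2l om_gt0) -cmodM mulr_sumr.
have -> : cmod (om - 1) * (e * r *+ N) = e * s *+ N.
  by rewrite mulrnAr mulrCA.
apply/ler_addgt0Pr => d d0.
have N0 : (0 < N)%N by exact: ltnW.
have dN0 : 0 < d / N%:R by rewrite divr_gt0// ltr0n.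
have [n0 Hn0] := eventually_small_sum (fun k (_ : (k < N)%N) => tri k _ dN0).
have := Hn0 n0 (leqnn _).
rewrite total -[_ *+ N]mulr_natr divfK ?pnatr_eq0 -?lt0n// => Hd.
rewrite -[X in cmod X](subrK (\sum_(k < N) midsum g n0 (zt k) (zt k.+1))).
rewrite (le_trans (cmodD _ _))// lerD//.
rewrite cmod_distC -sumrB (le_trans (cmod_sum _ _ _))//.
rewrite -[X in _ *+ X](card_ord N) -sumr_const ler_sum// => k _.
rewrite (_ : (om - 1) * _ = g (zt k) * (zt k.+1 - zt k)) ?near_chord//.
by rewrite ztS mulrCA.
Qed.

End difference_quotient.

(** * Uniform approximation by interpolation on a circle *)

Section circle_interpolation.
Variable R : realType.
Implicit Types (z u w : R[i]) (f df g : R[i] -> R[i]) (p : {poly R[i]}) (r e : R).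

(** The coefficients are the discrete Fourier transform of the samples of [f]: the trapezoidal rule
    for Cauchy's coefficient formula on the circle of radius [r]. *)
Definition circle_interp f r N om : {poly R[i]} :=
  \poly_(j < N) (N%:R^-1 * \sum_(k < N) f (r%:C * om ^+ k) * (r%:C * om ^+ k) ^- j).

(** The interpolant at [z] is the average of [f (zt k) * S k] with [S k] a finite geometric sum. By
    orthogonality of the roots of unity the [S k] average to 1, so [f z] can be subtracted inside,
    and summing the geometric series produces the difference quotient. *)
Lemma circle_interpE f df z r N om : 0 < r -> cmod z < r -> (0 < N)%N ->
  N.-primitive_root om ->
  (circle_interp f r N om).[z] - f z = (1 - (z / r%:C) ^+ N) *
    (N%:R^-1 * \sum_(k < N) dquot f df z (r%:C * om ^+ k) * (r%:C * om ^+ k)).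
Proof.
move=> r0 zr N0 omN; pose zt k := r%:C * om ^+ k.
have rC : r%:C != 0 :> R[i] by rewrite fmorph_eq0 gt_eqF.
have NC : (N%:R : R[i]) != 0 by rewrite pnatr_eq0 -lt0n.
have om1 := prim_root_cmod omN.
have om0 : om != 0 by rewrite -cmod_gt0 om1.
have zt0 k : zt k != 0 by rewrite mulf_neq0// expf_neq0.
have ztz k : zt k - z != 0.
  rewrite subr_eq0; apply: contraTneq zr => <-.
  by rewrite -leNgt /zt cmodM cmodX om1 expr1n mulr1 cmod_real ler_norm.
pose S k := \sum_(j < N) (z / zt k) ^+ j.
have SE k : S k = (1 - (z / r%:C) ^+ N) * zt k / (zt k - z).
  have ztN : zt k ^+ N = r%:C ^+ N.
    by rewrite /zt exprMn -exprM mulnC exprM (prim_expr_order omN) expr1n mulr1.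
  have zk : z / zt k - 1 != 0.
    by rewrite -(mulfV (zt0 k)) -mulrBl mulf_neq0 ?invr_eq0// -opprB oppr_eq0.
  apply: (mulfI zk); rewrite /S -subrX1 !expr_div_n ztN.
  by field; rewrite expf_neq0 ?rC ?zt0 ?ztz.
have S1 : N%:R^-1 * \sum_(k < N) S k = 1.
  have Sj (j : 'I_N) : \sum_(k < N) (z / zt k) ^+ j =
      if j == Ordinal N0 then N%:R else 0.
    case: eqP => [->|/eqP j0].
      rewrite (eq_bigr (fun=> 1)) => [|k _]; last by rewrite expr0.
      by rewrite sumr_const card_ord.
    have jN : ~~ (N %| j)%N.
      by rewrite gtnNdvd// lt0n; apply: contraNneq j0 => j0; apply/eqP/val_inj.
    rewrite (eq_bigr (fun k : 'I_N => (z / r%:C) ^+ j * (om^-1 ^+ j) ^+ k)).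
      rewrite -mulr_sumr sum_unity_root ?mulr0//.
        by rewrite -exprM mulnC exprM exprVn (prim_expr_order omN) invr1 expr1n.
      by rewrite exprVn invr_eq1 -(prim_order_dvd omN).
    by move=> k _; rewrite /zt invfM mulrA exprMn -exprVn -!exprM mulnC.
  rewrite /S exchange_big/=; under eq_bigr do rewrite Sj.
  by rewrite -big_mkcond big_pred1_eq mulVf.
have -> : (circle_interp f r N om).[z] = N%:R^-1 * \sum_(k < N) f (zt k) * S k.
  rewrite horner_poly; under eq_bigr do rewrite -mulrA mulr_suml.
  rewrite -mulr_sumr; congr (_ * _); rewrite exchange_big/=.
  apply: eq_bigr => k _; rewrite /S mulr_sumr; apply: eq_bigr => j _.
  by rewrite expr_div_n mulrA mulrAC.
rewrite [X in _ - X](_ : _ = N%:R^-1 * \sum_(k < N) f z * S k); last first.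
  by rewrite -mulr_sumr mulrCA S1 mulr1.
rewrite -mulrBr [RHS]mulrCA; congr (_ * _).
rewrite !mulr_sumr -sumrB; apply: eq_bigr => k _.
rewrite SE /dquot -subr_eq0 -/(zt k) (negPf (ztz k)).
by field; rewrite ztz.
Qed.

Lemma poly_uniform_approx f df (rho r e : R) : 0 <= rho -> rho < r -> 0 < e ->
  (forall u, cmod u <= r -> cderiv_at f u (df u)) ->
  exists p, forall z, cmod z <= rho -> cmod (p.[z] - f z) <= e.
Proof.
move=> rho0 rhor e0 f_deriv; have r0 : 0 < r by exact: le_lt_trans rhor.
pose k := (r - rho) / 2; have k0 : 0 < k by rewrite divr_gt0// subr_gt0.
have f_cont u : cmod u <= r -> ccont_at f u by move=> /f_deriv/cderiv_cont.
have [M M0 fM] := ccont_bounded f_cont.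
pose e1 := e / (2 * r); have e10 : 0 < e1 by rewrite divr_gt0// mulr_gt0.
have [|d d0 fd] := ccont_uniform (_ : 0 < e1 / 2 * k) f_cont.
  by apply: mulr_gt0 => //; exact: divr_gt0.
have [om [omP om_small]] := dyadic_roots R.
(* Bound for the side of the polygon: [d] controls the oscillation of [f], [k] keeps sides away from
   [z], and the third term makes the second summand of [dquotB], with [2 * M] for its [M], at most
   [e1 / 2]. *)
pose d' := Num.min (Num.min d k) (e1 / 2 * k ^+ 2 / (2 * M)).
have d'0 : 0 < d'.
  rewrite !lt_min d0 k0/=; apply: divr_gt0; last exact: mulr_gt0.
  by apply: mulr_gt0; [exact: divr_gt0|exact: exprn_gt0].
have [|m0 om_m0] := om_small (d' / r); first by rewrite divr_gt0.
pose N := (2 ^ m0.+1)%N; pose w := om m0.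
have sd' : cmod (w - 1) * r < d' by rewrite -ltr_pdivlMr// om_m0.
have N1 : (1 < N)%N by rewrite -[1%N]/(2 ^ 0)%N ltn_exp2l.
exists (circle_interp f r N w) => z zrho.
have zr : cmod z < r by exact: le_lt_trans rhor.
rewrite (circle_interpE f df r0 zr (ltnW N1) (omP m0)) cmodM.
have h2 : cmod (1 - (z / r%:C) ^+ N) <= 2.
  rewrite (le_trans (cmodB _ _))// cmod1 -[leRHS]/(1 + 1 : R) lerD2l cmodX.
  rewrite exprn_ile1 ?cmod_ge0// cmodM cmodV cmod_real gtr0_norm//.
  by rewrite ler_pdivrMr// mul1r ltW.
have NR : 0 < N%:R :> R by rewrite ltr0n expn_gt0.
have hs : cmod (N%:R^-1 *
    \sum_(j < N) dquot f df z (r%:C * w ^+ j) * (r%:C * w ^+ j)) <= e1 * r.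
  rewrite cmodM cmodV cmod_nat mulrC ler_pdivrMr// mulr_natr.
  apply: (@polygon_sum _ f df r r0 f_deriv z N w e1 k) => //.
  - exact: omP.
  - by move: sd'; rewrite !lt_min => /andP[/andP[_ /ltW]].
  - by rewrite /k divfK// lerD2l lerN2.
  move=> u v ur vr uv uz vz.
  have uvd' := le_lt_trans uv sd'.
  have uvd : cmod (u - v) < d by move: uvd'; rewrite !lt_min => /andP[/andP[]].
  have fvz : cmod (f v - f z) <= 2 * M.
    by rewrite (le_trans (cmodB _ _))// mulr_natl mulr2n lerD ?fM// ltW.
  rewrite (le_trans (dquotB df k0 uz vz (fd u v ur vr uvd) fvz))//.
  rewrite mulfK ?gt_eqF// [leRHS]splitr lerD2l.
  rewrite ler_pdivrMr ?exprn_gt0// mulrC -ler_pdivlMr ?mulr_gt0//.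
  by move: uvd'; rewrite !lt_min => /andP[_ /ltW].
rewrite (le_trans (ler_pM _ _ h2 hs)) ?cmod_ge0//.
by rewrite /e1 le_eqVlt; apply/orP; left; apply/eqP; field; rewrite gt_eqF.
Qed.

End circle_interpolation.

(** * From uniform to C^1 approximation *)

Section polynomial_C1_approximation.
Variable R : realType.
Implicit Types (z u w : R[i]) (f df g : R[i] -> R[i]) (p q : {poly R[i]}) (r e : R).

(** Averaging over [N] equally spaced points with [N] at least the size of [p] isolates one
    coefficient exactly. *)
Lemma poly_cauchy_estimate p (rho e : R) : 0 < rho ->
  (forall z, cmod z <= rho -> cmod p.[z] <= e) ->
  forall j, cmod p`_j * rho ^+ j <= e.
Proof.
move=> rho0 pe j; have e0 : 0 <= e.
  by apply: le_trans (pe 0 _); rewrite ?cmod_ge0// cmod0 ltW.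
have [sp|jp] := leqP (size p) j.
  by rewrite nth_default// cmod0 mul0r.
have [om [omP _]] := dyadic_roots R.
pose N := (2 ^ (size p).+1)%N; pose w := om (size p).
have wN : N.-primitive_root w := omP _.
have pN : (size p <= N)%N by rewrite ltnW// ltnW// ltn_expl.
have w1 := prim_root_cmod wN.
have w0 : w != 0 by rewrite -cmod_gt0 w1.
have NC : (N%:R : R[i]) != 0 by rewrite pnatr_eq0 expn_eq0.
have NR : 0 < N%:R :> R by rewrite ltr0n expn_gt0.
have E : N%:R * (p`_j * rho%:C ^+ j) =
    \sum_(k < N) p.[rho%:C * w ^+ k] * (w ^+ j) ^- k.
  under eq_bigr => k _ do rewrite (horner_coef_wide _ pN) mulr_suml.
  rewrite exchange_big/= (bigD1 (Ordinal (leq_trans jp pN)))//=.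
  rewrite [X in _ + X]big1 => [|i ij].
    rewrite addr0 (eq_bigr (fun=> p`_j * rho%:C ^+ j)) => [|k _]; last first.
      by rewrite exprMn mulrA -exprM mulnC exprM mulfK// !expf_neq0.
    by rewrite sumr_const card_ord mulr_natl.
  rewrite (eq_bigr (fun k : 'I_N => p`_i * rho%:C ^+ i * (w ^+ i / w ^+ j) ^+ k)).
    rewrite -mulr_sumr sum_unity_root ?mulr0//.
      by rewrite expr_div_n -!exprM ![(_ * N)%N]mulnC !exprM (prim_expr_order wN)
        !expr1n divr1.
    rewrite -subr_eq0 -[1](divff (expf_neq0 j w0)) -mulrBl mulf_eq0 invr_eq0.
    rewrite expf_eq0 (negPf w0) andbF orbF subr_eq0 (eq_prim_root_expr wN).
    by rewrite !modn_small// (leq_trans jp pN).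
  move=> k _; rewrite expr_div_n exprMn -[(w ^+ k) ^+ i]exprM mulnC exprM.
  by rewrite !mulrA.
rewrite -(ler_pM2l NR) -[N%:R]cmod_nat -[rho ^+ j](gtr0_norm (exprn_gt0 _ rho0)).
rewrite -cmod_real -!cmodM rmorphXn E cmod_nat (le_trans (cmod_sum _ _ _))//.
apply: (@le_trans _ _ (\sum_(k < N) e)); last first.
  by rewrite sumr_const card_ord mulr_natl.
apply: ler_sum => k _; rewrite cmodM cmodV !cmodX w1 !expr1n invr1 mulr1 pe//.
by rewrite cmodM cmodX w1 expr1n mulr1 cmod_real gtr0_norm.
Qed.

Lemma cmodB_exp z w (r : R) n : cmod z <= r -> cmod w <= r ->
  cmod (z ^+ n.+1 - w ^+ n.+1) <= n.+1%:R * r ^+ n * cmod (z - w).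
Proof.
move=> zr wr; have r0 : 0 <= r by rewrite (le_trans _ zr) ?cmod_ge0.
rewrite subrXX cmodM mulrC ler_wpM2r ?cmod_ge0//.
rewrite (le_trans (cmod_sum _ _ _))// mulr_natl -[X in _ *+ X](card_ord n.+1).
rewrite -sumr_const ler_sum// => i _; rewrite cmodM !cmodX.
have -> : r ^+ n = r ^+ (n.+1.-1 - i) * r ^+ i by rewrite -exprD subnK// -ltnS.
by rewrite ler_pM ?exprn_ge0 ?cmod_ge0// lerXn2r// ?nnegrE ?cmod_ge0.
Qed.

Lemma sum_arith_geom_le (q : R) n : 0 <= q -> q < 1 ->
  \sum_(j < n) j.+1%:R * q ^+ j <= (1 - q) ^- 2.
Proof.
move=> q0 q1; have q10 : 0 < 1 - q by rewrite subr_gt0.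
rewrite -[leRHS]mul1r ler_pdivlMr ?exprn_gt0//.
have -> : (\sum_(j < n) j.+1%:R * q ^+ j) * (1 - q) ^+ 2 =
    1 - q ^+ n * (n.+1%:R - n%:R * q).
  elim: n => [|n IH]; first by rewrite big_ord0 expr0; ring.
  by rewrite big_ord_recr/= mulrDl IH [q ^+ n.+1]exprS -!natr1; ring.
rewrite gerBl mulr_ge0 ?exprn_ge0// subr_ge0.
by rewrite (@le_trans _ _ n%:R) ?ler_nat// ler_piMr// ltW.
Qed.

(** The Cauchy estimates bound the coefficients term by term, leaving the derivative of a geometric
    series. The constant is proportional to [e] and independent of the degree, which makes it stable
    under limits. *)
Lemma poly_lipschitz p (rho r e : R) z w : 0 <= r -> r < rho ->
  (forall z, cmod z <= rho -> cmod p.[z] <= e) -> cmod z <= r -> cmod w <= r ->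
  cmod (p.[z] - p.[w]) <= e * (rho^-1 * (1 - r / rho) ^- 2) * cmod (z - w).
Proof.
move=> r0 rrho pe zr wr; have rho0 : 0 < rho by exact: le_lt_trans rrho.
have e0 : 0 <= e by apply: le_trans (pe 0 _); rewrite ?cmod_ge0// cmod0 ltW.
have sp : (size p <= (size p).+1)%N by [].
rewrite !(horner_coef_wide _ sp) -sumrB big_ord_recl/= !expr0 subrr add0r.
rewrite (le_trans (cmod_sum _ _ _))//.
apply: (@le_trans _ _ (\sum_(j < size p)
    e * rho^-1 * cmod (z - w) * (j.+1%:R * (r / rho) ^+ j))).
  apply: ler_sum => j _; rewrite -mulrBr cmodM.
  have := poly_cauchy_estimate rho0 pe j.+1.
  rewrite -ler_pdivlMr ?exprn_gt0// => pj.
  rewrite (le_trans (ler_pM _ _ pj (cmodB_exp _ zr wr))) ?cmod_ge0//.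
  rewrite le_eqVlt; apply/orP; left; apply/eqP.
  rewrite expr_div_n exprS; field.
  by rewrite !expf_neq0 ?gt_eqF.
rewrite -mulr_sumr [leRHS](_ : _ =
  e * rho^-1 * cmod (z - w) * (1 - r / rho) ^- 2); last by ring.
rewrite ler_wpM2l ?sum_arith_geom_le ?divr_ge0 ?(ltW rho0)//.
  by rewrite !mulr_ge0 ?invr_ge0 ?cmod_ge0 ?(ltW rho0).
by rewrite ltr_pdivrMr// mul1r.
Qed.

(** A uniform approximation [p] already works. For an ever better approximation [q], the difference
    [p - q] is uniformly small, hence has a small Lipschitz constant on a smaller disc. In the limit
    so has [p - f], and this bounds its derivative. *)
Lemma poly_C1_approx f df (rho r e : R) : 0 <= rho -> rho < r -> 0 < e ->
  (forall u, cmod u <= r -> cderiv_at f u (df u)) ->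
  exists p, forall z, cmod z <= rho ->
    cmod (p.[z] - f z) <= e /\ cmod (p^`().[z] - df z) <= e.
Proof.
move=> rho0 rhor e0 f_deriv.
pose r2 := (rho + r) / 2; pose r1 := (rho + r2) / 2.
have [h1 h2 h3] : [/\ rho < r1, r1 < r2 & r2 < r] by rewrite /r1 /r2; split; lra.
pose C := r2^-1 * (1 - r1 / r2) ^- 2.
have C0 : 0 <= C.
  by rewrite mulr_ge0 ?invr_ge0 ?sqr_ge0//; lra.
have r10 : 0 <= r1 by lra.
have r20 : 0 <= r2 by lra.
(* Ensures both [eta <= e] for the values and [2 * eta * C <= e] for the derivatives. *)
pose eta := e / (2 * C + 1).
have C1 : 0 < 2 * C + 1 by rewrite ltr_wpDl// mulr_ge0.
have eta0 : 0 < eta by rewrite divr_gt0.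
have [p pf] := poly_uniform_approx r20 h3 eta0 f_deriv.
have lip z w : cmod z <= r1 -> cmod w <= r1 ->
    cmod (p.[z] - f z - (p.[w] - f w)) <= 2 * eta * C * cmod (z - w).
  move=> zr wr; apply/ler_addgt0Pr => d d0.
  pose eta' := Num.min eta (d / 2).
  have eta'0 : 0 < eta' by rewrite lt_min eta0 divr_gt0.
  have [q qf] := poly_uniform_approx r20 h3 eta'0 f_deriv.
  have pq u : cmod u <= r2 -> cmod (p - q).[u] <= 2 * eta.
    move=> ur; rewrite hornerD hornerN -[p.[u] - _](subrKA (f u)) mulr_natl mulr2n.
    rewrite (le_trans (cmodD _ _))// lerD ?pf// cmod_distC.
    by rewrite (le_trans (qf u ur))// ge_min lexx.
  have := poly_lipschitz r10 h2 pq zr wr; rewrite -/C => lpq.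
  rewrite [X in cmod X](_ : _ = ((p - q).[z] - (p - q).[w]) +
    ((q.[z] - f z) - (q.[w] - f w))); last by rewrite !(hornerD, hornerN); ring.
  rewrite (le_trans (cmodD _ _))// lerD// (le_trans (cmodB _ _))// [leRHS]splitr.
  have qd u : cmod u <= r1 -> cmod (q.[u] - f u) <= d / 2.
    move=> ur; rewrite (le_trans (qf u _))//; first by rewrite (le_trans ur)// ltW.
    by rewrite ge_min lexx orbT.
  by rewrite lerD ?qd.
exists p => w wrho.
have wr1 : cmod w <= r1 by lra.
have etae : eta <= e.
  by rewrite /eta ler_pdivrMr// ler_peMr ?(ltW e0)// lerDr mulr_ge0.
split; first by rewrite (le_trans (pf w _))//; lra.
apply: (@le_trans _ _ (2 * eta * C)); last first.
  rewrite /eta mulrAC mulrA ler_pdivrMr// mulrC ler_wpM2l ?(ltW e0)//.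
  by rewrite lerDl.
apply/ler_addgt0Pr => d d0; have d20 : 0 < d / 2 by rewrite divr_gt0.
have wr : cmod w <= r by lra.
have [d1 d10 fd1] := f_deriv w wr _ d20.
have [d2 d20' pd2] := cderiv_horner p w d20.
pose t := Num.min (Num.min d1 d2) (r1 - rho) / 2.
have t0 : 0 < t by rewrite divr_gt0// !lt_min d10 d20' subr_gt0.
have [td1 td2 tr1] : [/\ t < d1, t < d2 & t < r1 - rho].
  have m0 : 0 < Num.min (Num.min d1 d2) (r1 - rho).
    by rewrite !lt_min d10 d20' subr_gt0.
  have : t < Num.min (Num.min d1 d2) (r1 - rho).
    by rewrite /t ltr_pdivrMr// ltr_pMr// ltr1n.
  by rewrite !lt_min => /andP[/andP[]].
pose u := w + t%:C.
have uw : u - w = t%:C by rewrite /u; ring.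
have cuw : cmod (u - w) = t by rewrite uw cmod_real gtr0_norm.
have ur1 : cmod u <= r1.
  by rewrite -[u](subrKC w) (le_trans (cmodD _ _))// cuw; lra.
have t1 : cmod (u - w) < d1 by rewrite cuw.
have t2 : cmod (u - w) < d2 by rewrite cuw.
rewrite -(ler_pM2r t0) -{1}cuw -cmodM.
have -> : (p^`().[w] - df w) * (u - w) =
    (p.[u] - f u - (p.[w] - f w)) + (f u - f w - df w * (u - w)) -
    (p.[u] - p.[w] - p^`().[w] * (u - w)) by ring.
have := lip u w ur1 wr1; have := fd1 u t1; have := pd2 u t2; rewrite cuw => a1 a2 a3.
rewrite (le_trans (cmodB _ _))// (le_trans (lerD (cmodD _ _) (lexx _)))//.
by move: a1 a2 a3; move: (cmod _) (cmod _) (cmod _) => x1 x2 x3; nra.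
Qed.

End polynomial_C1_approximation.

(** * Planar measure *)

Section planar_scaling.
Variable R : realType.
Local Open Scope ereal_scope.
Local Notation leb := (@lebesgue_measure R).
Local Notation leb2 := (lebesgue_measure \x lebesgue_measure)%E.

(** Lebesgue measure is determined by its values on half-open intervals, so it equals [s] times its
    image under multiplication by [s]. *)
Lemma ge0_integral_scale (s : R) (h : R -> \bar R) : (0 < s)%R ->
  measurable_fun setT h -> (forall x, 0 <= h x) ->
  \int[leb]_x h (s * x)%R = (s^-1)%:E * \int[leb]_x h x.
Proof.
move=> s0 mh h0.
pose sc (x : measurableTypeR R) : measurableTypeR R := (s * x)%R.
have msc : measurable_fun setT sc by exact: measurable_funM.
pose sn : {nonneg R} := NngNum (ltW s0).
have lebE A : measurable A -> leb A = mscale sn (pushforward leb sc) A.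
  move=> mA.
  apply: (lebesgue_measure_unique (mu := mscale sn (pushforward leb sc))) => //.
  move=> _ [[a b]] _ <-.
  rewrite /mscale/= /pushforward.
  rewrite [X in _ = _ * leb X](_ : _ = `](a / s)%R, (b / s)%R]%classic); last first.
    apply/seteqP; split=> x; rewrite /sc/= !in_itv/=;
      by rewrite ltr_pdivrMr// ler_pdivlMr// ![(x * s)%R]mulrC.
  rewrite !lebesgue_measure_itv/= !lte_fin ltr_pM2r ?invr_gt0//.
  case: ifPn => _; last by rewrite mule0.
  by rewrite -!EFinB -EFinM -mulrBl mulrCA divff ?mulr1// gt_eqF.
have -> : \int[leb]_x h x = s%:E * \int[leb]_x h (s * x)%R.
  rewrite (eq_measure_integral (mscale sn (pushforward leb sc))) => [|A mA _].
    rewrite ge0_integral_mscale//= ge0_integral_pushforward//.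
  exact: lebE.
by rewrite muleA -EFinM mulVf ?gt_eqF// mul1e.
Qed.

Lemma ge0_integral_scale2 (s : R) (h : R * R -> \bar R) : (0 < s)%R ->
  measurable_fun setT h -> (forall x, 0 <= h x) ->
  \int[leb2]_p h (s * p.1, s * p.2)%R = (s ^- 2)%:E * \int[leb2]_p h p.
Proof.
move=> s0 mh h0.
have ms : measurable_fun setT (fun p : R * R => (s * p.1, s * p.2)%R).
  by apply/measurable_fun_pair => //=; exact: measurable_funM.
have mhs : measurable_fun setT (fun p : R * R => h (s * p.1, s * p.2)%R).
  exact: measurableT_comp ms.
rewrite [LHS](fubini_tonelli1 (m1 := leb) (m2 := leb) _ mhs)// /fubini_F/=.
have mx x : measurable_fun setT (fun y => h (x, y)).
  by apply: measurableT_comp => //; exact: measurable_pair1.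
have iV : 0 <= (s^-1)%:E by rewrite lee_fin invr_ge0 ltW.
have E1 x : \int[leb]_y h (s * x, s * y)%R = (s^-1)%:E * \int[leb]_y h (s * x, y)%R.
  by rewrite (ge0_integral_scale s0 (mx _)).
under eq_integral do rewrite E1.
have mF : measurable_fun setT (fun x => \int[leb]_y h (x, y)).
  exact: (measurable_fun_fubini_tonelli_F (m2 := leb) _ mh).
have F0 x : 0 <= \int[leb]_y h (x, y) by exact: integral_ge0.
rewrite ge0_integralZl//; last first.
  by apply: (measurableT_comp mF); exact: measurable_funM.
rewrite (ge0_integral_scale s0 mF)// muleA -EFinM.
by rewrite [in RHS](fubini_tonelli1 (m1 := leb) (m2 := leb) _ mh)// expr2 invfM.
Qed.

Let measurable_disc := open_prod_measurable (@open_plane_disc R).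

(** Dilating a function does not increase its Dirichlet energy: extended by zero, [G] has the same
    integral over the plane after rescaling, and the part outside the disc is dropped. *)
Lemma disc_integral_contract (s : R) (G : R * R -> R) : (0 < s)%R -> (s <= 1)%R ->
  measurable_fun (@plane_disc R) G -> (forall p, 0 <= G p)%R ->
  \int[leb2]_(p in @plane_disc R) (s ^+ 2 * G (s * p.1, s * p.2)%R)%:E <=
  \int[leb2]_(p in @plane_disc R) (G p)%:E.
Proof.
move=> s0 s1 mG G0.
pose h (p : R * R) : \bar R := (EFin \o G \_ (@plane_disc R)) p.
have mh : measurable_fun setT h.
  apply/measurable_EFinP; apply/(measurable_restrictT _ measurable_disc).
  exact: mG.
have h0 p : 0 <= h p.
  by rewrite /h/= patchE; case: ifP => _; rewrite lee_fin.
have -> : \int[leb2]_(p in @plane_disc R) (G p)%:E = \int[leb2]_p h p.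
  rewrite integral_mkcond; apply: eq_integral => p _.
  by rewrite /h restrict_EFin.
have -> : \int[leb2]_p h p = (s ^+ 2)%:E * \int[leb2]_p h (s * p.1, s * p.2)%R.
  by rewrite ge0_integral_scale2// muleA -EFinM divff ?mul1e// gt_eqF ?exprn_gt0.
have mhs : measurable_fun setT (fun p : R * R => h (s * p.1, s * p.2)%R).
  apply: (measurableT_comp mh); apply/measurable_fun_pair => //=;
    exact: measurable_funM.
rewrite -ge0_integralZl//; last by rewrite lee_fin sqr_ge0.
apply: (@le_trans _ _ (\int[leb2]_(p in @plane_disc R)
    ((s ^+ 2)%:E * h (s * p.1, s * p.2)%R))); last first.
  apply: (@ge0_subset_integral _ (measurableTypeR R * measurableTypeR R)%type R
    leb2 (@plane_disc R) setT measurable_disc measurableT) => //.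
    exact: measurable_funeM.
  by move=> p _; apply: mule_ge0; [rewrite lee_fin sqr_ge0|exact: h0].
rewrite le_eqVlt; apply/orP; left; apply/eqP; apply: eq_integral.
move=> p; rewrite inE => Dp; rewrite EFinM /h/= patchE ifT// inE /plane_disc/=.
move: Dp; rewrite /plane_disc/= !normc_lt1; apply: le_lt_trans.
have -> : point_of (s * p.1, s * p.2)%R = (s%:C * point_of p)%R.
  by apply/eqP; rewrite eq_complex/= !mul0r subr0 addr0 !eqxx.
by rewrite cmodM cmod_real ger0_norm ?(ltW s0)// ler_piMl ?cmod_ge0.
Qed.

End planar_scaling.

(** * A convergence criterion from Fatou's lemma *)

Section fatou_consequence.
Context d (T : measurableType d) (R : realType).
Variable mu : {measure set T -> \bar R}.
Local Open Scope ereal_scope.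

Lemma limn_einf_le (u : (\bar R)^nat) c : (forall n, u n <= c) -> limn_einf u <= c.
Proof.
move=> uc; rewrite limn_einf_lim; apply: lime_le; first exact: is_cvg_einfs.
by apply: nearW => n; apply: le_trans (uc n); apply: ereal_inf_lbound; exists n => /=.
Qed.

(* Fatou's lemma applied to [2 A + 2 B_n - C_n]. *)
Lemma fatou_vanishing (D : set T) (A : T -> R) (B C : nat -> T -> R) :
  measurable D -> measurable_fun D A -> (forall n, measurable_fun D (B n)) ->
  (forall n, measurable_fun D (C n)) ->
  (forall x, 0 <= A x)%R -> (forall n x, 0 <= B n x)%R -> (forall n x, 0 <= C n x)%R ->
  (forall n x, D x -> C n x <= 2 * A x + 2 * B n x)%R ->
  (forall x, D x -> B n x @[n --> \oo] --> A x) ->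
  (forall x, D x -> C n x @[n --> \oo] --> (0 : R)%R) ->
  \int[mu]_(x in D) (A x)%:E < +oo ->
  (forall n, \int[mu]_(x in D) (B n x)%:E <= \int[mu]_(x in D) (A x)%:E) ->
  forall (e : R) N, (0 < e)%R ->
    exists2 n, (N <= n)%N & \int[mu]_(x in D) (C n x)%:E < e%:E.
Proof.
move=> mD mA mB mC A0 B0 C0 CAB BA C_0 Aoo BleA e N e0; apply: contrapT => nex.
have Ce n : e%:E <= \int[mu]_(x in D) (C (n + N)%N x)%:E.
  rewrite leNgt; apply/negP => Cn; apply: nex; exists (n + N)%N => //.
  exact: leq_addl.
pose h n x := (2 * A x + 2 * B (n + N)%N x - C (n + N)%N x)%R.
have mh n : measurable_fun D (h n).
  by apply: measurable_funB => //; apply: measurable_funD; exact: measurable_funM.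
have h0 n x : D x -> (0 <= h n x)%R by move=> Dx; rewrite subr_ge0 CAB.
have I0 (F : T -> R) : (forall x, 0 <= F x)%R -> 0 <= \int[mu]_(x in D) (F x)%:E.
  by move=> F0; apply: integral_ge0 => x _; rewrite lee_fin.
have [a aE] : exists a : R, \int[mu]_(x in D) (A x)%:E = a%:E.
  by exists (fine (\int[mu]_(x in D) (A x)%:E)); rewrite fineK// ge0_fin_numE// I0.
have int2 n : \int[mu]_(x in D) (2 * A x + 2 * B n x)%:E <= (4 * a)%:E.
  under eq_integral do rewrite EFinD !EFinM.
  rewrite ge0_integralD//; last 4 first.
  - by move=> x _; rewrite mule_ge0 ?lee_fin.
  - by apply: measurable_funeM; exact/measurable_EFinP.
  - by move=> x _; rewrite mule_ge0 ?lee_fin.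
  - by apply: measurable_funeM; exact/measurable_EFinP.
  rewrite !ge0_integralZl//; last 4 first.
  - exact/measurable_EFinP.
  - by move=> x _; rewrite lee_fin.
  - exact/measurable_EFinP.
  - by move=> x _; rewrite lee_fin.
  have := BleA n; rewrite aE => Bn.
  apply: (@le_trans _ _ (2%:E * a%:E + 2%:E * a%:E)).
    by rewrite leeD2l// lee_pmul2l.
  by rewrite -!EFinM -EFinD lee_fin; lra.
have inth n : \int[mu]_(x in D) (h n x)%:E <= (4 * a - e)%:E.
  have : \int[mu]_(x in D) (h n x)%:E + \int[mu]_(x in D) (C (n + N)%N x)%:E <=
      (4 * a)%:E.
    rewrite -ge0_integralD//; last 4 first.
    - by move=> x Dx; rewrite lee_fin h0.
    - exact/measurable_EFinP.
    - by move=> x _; rewrite lee_fin.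
    - exact/measurable_EFinP.
    under eq_integral do rewrite -EFinD subrK.
    exact: int2.
  rewrite EFinB leeBrDr//; apply: le_trans; rewrite leeD2l//.
have mh' n : measurable_fun D (EFin \o h n) by exact/measurable_EFinP.
have h0' n x : D x -> 0 <= (EFin \o h n) x by move=> Dx; rewrite lee_fin h0.
(* The limit function is [4 A], so Fatou gives [4 a <= 4 a - e]. *)
have := le_trans (fatou mu mD mh' h0') (limn_einf_le inth).
rewrite (eq_integral (fun x => 4%:E * (A x)%:E)); last first.
  move=> x; rewrite inE => Dx; suff hA : h n x @[n --> \oo] --> (4 * A x)%R.
    rewrite -EFinM; apply: (cvg_limn_einf_sup _).1.
    by apply: cvg_EFin hA; exact: nearW.
  rewrite (_ : 4 * A x = 2 * A x + 2 * A x - 0)%R; last by lra.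
  apply: cvgB; last by have := C_0 x Dx; rewrite -(cvg_shiftn N).
  apply: cvgD; first exact: cvg_cst.
  by apply: cvgMr; have := BA x Dx; rewrite -(cvg_shiftn N).
rewrite ge0_integralZl//; last 2 first.
- exact/measurable_EFinP.
- by move=> x _; rewrite lee_fin.
by rewrite aE -EFinM lee_fin lerBrDr gerDl leNgt e0.
Qed.

End fatou_consequence.

(** * Area of an image without change of variables *)

Section area_bound.
Variable R : realType.
Local Open Scope ereal_scope.
Local Notation leb := (@lebesgue_measure R).
Local Notation leb2 := (@lebesgue_measure R \x @lebesgue_measure R)%E.
Local Notation plane := (measurableTypeR R * measurableTypeR R)%type.

Definition box (p : R * R) (r : R) : set (R * R) :=
  [set q | `|q.1 - p.1| < r /\ `|q.2 - p.2| < r]%R.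

Lemma boxE p r : box p r =
  `](p.1 - r)%R, (p.1 + r)%R[%classic `*` `](p.2 - r)%R, (p.2 + r)%R[%classic.
Proof.
apply/seteqP; split=> q; rewrite /box/= !in_itv/= -!ltr_distl; by case.
Qed.

Lemma measurable_box p r : measurable (box p r).
Proof. by rewrite boxE; apply: measurableX; exact: measurable_itv. Qed.

Lemma leb2_box p r : (0 < r)%R -> leb2 (box p r) = (4 * r ^+ 2)%:E.
Proof.
move=> r0; rewrite boxE product_measure1E; try exact: measurable_itv.
rewrite /= !lebesgue_measure_itv/= !lte_fin !ltrBlDr -!addrA !ltrDl addr_gt0//.
by rewrite -!EFinD -EFinM; congr (_%:E); ring.
Qed.

Lemma leb2_sigma_finite : sigma_finite setT leb2.
Proof.
exists (fun n => box (0, 0)%R n.+1%:R) => [|n].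
  apply/seteqP; split=> // p _.
  exists (Num.bound (`|p.1| + `|p.2|)%R) => //; rewrite /box/= !subr0.
  have /archi_boundP pb : (0 <= `|p.1| + `|p.2|)%R by rewrite addr_ge0.
  have h (x : R) : (x <= `|p.1| + `|p.2|)%R ->
      (x < (Num.bound (`|p.1| + `|p.2|)%R).+1%:R)%R.
    by move=> /le_lt_trans/(_ pb)/lt_le_trans; apply; rewrite ler_nat.
  by split; apply: h; rewrite ?lerDl ?lerDr.
split; first exact: measurable_box.
by rewrite [X in X < _]leb2_box// ltry.
Qed.

(* The canonical structure that the library infers for a product of
   sigma-finite measures is not the sigma-finite one, hence this copy. *)
Definition planar_measure : set plane -> \bar R := leb2.

HB.instance Definition _ := Measure.copy planar_measure leb2.

HB.instance Definition _ :=
  Measure_isSigmaFinite.Build _ plane R planar_measure leb2_sigma_finite.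

Lemma limn_einf_ge (u : (\bar R)^nat) c N :
  (forall n, (N <= n)%N -> c <= u n) -> c <= limn_einf u.
Proof.
move=> uc; rewrite limn_einf_lim; apply: lime_ge; first exact: is_cvg_einfs.
exists N => // n /= Nn; apply: le_ereal_inf_tmp => _ [m /= nm <-].
by apply: uc; exact: leq_trans nm.
Qed.

Variables (E T : set (R * R)) (phi1 phi2 v : R * R -> R).
Hypotheses (mE : measurable E) (mT : measurable T).
Hypotheses (mphi1 : measurable_fun E phi1) (mphi2 : measurable_fun E phi2).
Hypothesis mv : measurable_fun E v.
Hypothesis v0 : forall p, E p -> (0 < v p)%R.
Hypothesis local_bound : forall p, E p -> exists2 d : R, (0 < d)%R &
  forall r q, (r < d)%R -> box p r q -> [/\ E q, (v p <= 2 * v q)%R,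
    (`|phi1 q - phi1 p| < 4 * v p * r)%R & (`|phi2 q - phi2 p| < 4 * v p * r)%R].
Hypothesis onto : forall t, T t -> exists2 p, E p & (phi1 p, phi2 p) = t.

Let ext (f : R * R -> R) : R * R -> R := f \_ E.

Let mext f : measurable_fun E f -> measurable_fun setT (ext f).
Proof. by move=> mf; apply/(measurable_restrictT _ mE). Qed.

(** The graph of [(phi1, phi2)] thickened by [1 / (n + 1)] in the target. *)
Let S n : set (plane * plane) := [set x | [/\ E x.1, T x.2,
  (`|ext phi1 x.1 - x.2.1| < n.+1%:R^-1)%R & (`|ext phi2 x.1 - x.2.2| < n.+1%:R^-1)%R]].

Let measurable_S n : measurable (S n).
Proof.
have lt_meas (f g : R * R -> R) : measurable_fun setT f -> measurable_fun setT g ->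
    measurable [set x : plane * plane | (`|f x.1 - g x.2| < n.+1%:R^-1)%R].
  move=> mf mg.
  have mh : measurable_fun setT (fun x : plane * plane => `|f x.1 - g x.2|%R).
    apply: measurableT_comp => //; apply: measurable_funB.
      exact: (measurableT_comp mf).
    exact: (measurableT_comp mg).
  rewrite (_ : [set x | _] = (fun x : plane * plane => `|f x.1 - g x.2|%R) @^-1`
      `]-oo, (n.+1%:R^-1 : R)%R[%classic); last first.
    by apply/seteqP; split=> x /=; rewrite in_itv.
  by rewrite -(setTI (_ @^-1` _)); apply: mh.
rewrite (_ : S n = (E `*` T) `&`
   [set x : plane * plane | (`|ext phi1 x.1 - x.2.1| < n.+1%:R^-1)%R]
   `&` [set x : plane * plane | (`|ext phi2 x.1 - x.2.2| < n.+1%:R^-1)%R]); last first.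
  by apply/seteqP; split=> x /= => [[? ? ? ?]|[[[? ?] ?] ?]].
apply: measurableI; first apply: measurableI.
- exact: measurableX.
- by apply: (lt_meas _ fst) => //; exact: mext.
- by apply: (lt_meas _ snd) => //; exact: mext.
Qed.

Let W n (x : plane * plane) : \bar R :=
  (n.+1%:R ^+ 2 * ext v x.1 ^+ 2 * \1_(S n) x)%:E.

Let W_ge0 n x : 0 <= W n x.
Proof.
by rewrite lee_fin mulr_ge0// mulr_ge0 ?sqr_ge0.
Qed.

Let mW n : measurable_fun setT (W n).
Proof.
apply/measurable_EFinP; apply: measurable_funM.
  apply: measurable_funM => //; apply: measurable_funX.
  exact: (measurableT_comp (mext mv)).
exact: measurable_indic.
Qed.

(** The fibre over [p] lies in a square of area [4 / (n + 1) ^ 2], which the weight [(n + 1) ^ 2]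
    cancels. *)
Let W_p n p : \int[leb2]_t W n (p, t) <= (4 * ext v p ^+ 2)%:E.
Proof.
have [Ep|nEp] := pselect (E p); last first.
  rewrite integral0_eq => [|t _].
    by rewrite lee_fin; apply: mulr_ge0 => //; exact: sqr_ge0.
  by rewrite /W /ext patchE memNset// expr0n mulr0 mul0r.
have n0 : (0 < n.+1%:R^-1 :> R)%R by rewrite invr_gt0.
pose c := (n.+1%:R ^+ 2 * ext v p ^+ 2)%R.
have c0 : (0 <= c)%R by apply: mulr_ge0; exact: sqr_ge0.
pose b := box (phi1 p, phi2 p) n.+1%:R^-1.
apply: (@le_trans _ _ (\int[leb2]_(t in b) c%:E)).
  rewrite [leRHS]integral_mkcond.
  apply: (@ge0_le_integral _ plane R leb2 setT measurableT) => //.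
  - by apply: measurableT_comp (mW n) _; exact: measurable_pair1.
  - apply/(measurable_restrictT _ (measurable_box _ _)); exact: measurable_cst.
  move=> t _; rewrite /W patchE indicE -/c; case: ifPn => tb.
    by rewrite lee_fin ler_piMr// lern1 leq_b1.
  rewrite memNset ?mulr0// => -[/= _ _]; rewrite /ext !patchE !mem_set// => h1 h2.
  by move/negP: tb; apply; rewrite inE /b /box/= 2!(distrC t.1, distrC t.2).
rewrite integral_cst; last exact: measurable_box.
  rewrite [X in _ * X]leb2_box//.
rewrite -EFinM lee_fin /c le_eqVlt; apply/orP; left; apply/eqP.
by have := pnatr_eq0 R n.+1; move: (n.+1%:R : R)%R => x /negbT x0; field.
Qed.

Let W_t t : T t -> exists N, forall n, (N <= n)%N ->
  (16^-1)%:E <= \int[leb2]_p W n (p, t).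
Proof.
move=> Tt; have [p Ep phip] := onto Tt; have [d d0 dP] := local_bound Ep.
have vp := v0 Ep.
exists (Num.bound (4 * v p * d)^-1) => n Nn.
have n0 : (0 < n.+1%:R :> R)%R by [].
(* Chosen so that the square of half-side [r] around a preimage of [t] is mapped within
   [1 / (n + 1)] of [t]. Its area [4 r ^ 2] times the weight, at least
   [(n + 1) ^ 2 * (v p / 2) ^ 2], is [1 / 16]. *)
pose r := (4 * v p * n.+1%:R)^-1%R.
have r0 : (0 < r)%R by rewrite invr_gt0 !mulr_gt0.
have rd : (r < d)%R.
  have k0 : (0 < 4 * v p * d)%R by rewrite !mulr_gt0.
  have kn : ((4 * v p * d)^-1 < n.+1%:R)%R.
    apply: lt_le_trans (archi_boundP _) _; first by rewrite invr_ge0 ltW.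
    by rewrite ler_nat ltnW.
  rewrite /r -div1r ltr_pdivrMr ?mulr_gt0//.
  by move: kn; rewrite -div1r ltr_pdivrMr//; move: (n.+1%:R)%R => x; lra.
pose c := (n.+1%:R ^+ 2 * (v p / 2) ^+ 2)%R.
have c0 : (0 <= c)%R by apply: mulr_ge0; exact: sqr_ge0.
apply: (@le_trans _ _ (\int[leb2]_(q in box p r) c%:E)).
  rewrite integral_cst; last exact: measurable_box.
  rewrite [X in _ * X]leb2_box//.
  rewrite -EFinM lee_fin /c /r le_eqVlt; apply/orP; left; apply/eqP.
  move: (lt0r_neq0 n0) (lt0r_neq0 vp).
  by move: (n.+1%:R : R)%R (v p) => x y x0 y0; field; rewrite x0.
rewrite [leLHS]integral_mkcond.
apply: (@ge0_le_integral _ plane R leb2 setT measurableT) => //.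
- by move=> q _; rewrite patchE; case: ifP => _ //; rewrite lee_fin.
- apply/(measurable_restrictT _ (measurable_box _ _)); exact: measurable_cst.
- by apply: measurableT_comp (mW n) _; exact: measurable_pair2.
move=> q _; rewrite patchE; case: ifPn => qb //.
have [Eq vq h1 h2] := dP r q rd (set_mem qb).
have vr : (4 * v p * r = n.+1%:R^-1)%R.
  rewrite /r; move: (lt0r_neq0 n0) (lt0r_neq0 vp).
  by move: (n.+1%:R : R)%R (v p) => x y x0 y0; field; rewrite x0.
rewrite /W indicE mem_set ?mulr1; last first.
  split => //=; rewrite /ext patchE mem_set// -phip/= -vr; [exact: h1|exact: h2].
rewrite lee_fin /c ler_wpM2l ?sqr_ge0// /ext patchE mem_set//.
have vq0 := v0 Eq; rewrite lerXn2r ?nnegrE ?divr_ge0 ?(ltW vp) ?(ltW vq0)//.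
by rewrite ler_pdivrMr// mulrC.
Qed.

(** Integrate [W n] in both orders: over [t] first it is at most 4 times the integral of [v ^ 2];
    over [p] first it is eventually at least [1 / 16] at each point of [T]. Since the rank depends
    on the point, Fatou's lemma links the two, and [64 = 16 * 4]. *)
Lemma area_bound :
  leb2 T <= 64%:E * \int[leb2]_(p in E) (v p ^+ 2)%:E.
Proof.
pose g n (t : plane) := \int[leb2]_p W n (p, t).
have mg n : measurable_fun setT (g n).
  exact: (measurable_fun_fubini_tonelli_G (m1 := planar_measure) _ (mW n) (W_ge0 n)).
have g0 n t : 0 <= g n t by exact: integral_ge0.
have ve0 p : 0 <= (ext v p ^+ 2)%:E by rewrite lee_fin sqr_ge0.
have intg n : \int[leb2]_t g n t <= 4%:E * \int[leb2]_(p in E) (v p ^+ 2)%:E.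
  rewrite /g.
  rewrite -(fubini_tonelli2 (m1 := planar_measure) (m2 := planar_measure) _ (mW n))//.
  rewrite (fubini_tonelli1 (m1 := planar_measure) (m2 := planar_measure) _ (mW n))//.
  have -> : \int[leb2]_(p in E) (v p ^+ 2)%:E = \int[leb2]_p (ext v p ^+ 2)%:E.
    rewrite integral_mkcond; apply: eq_integral => p _; rewrite /ext !patchE.
    by case: ifP => //; rewrite expr0n.
  have mext2 : measurable_fun setT (fun p => (ext v p ^+ 2)%:E).
    apply/measurable_EFinP; apply: measurable_funX; exact: mext.
  rewrite -ge0_integralZl//.
  apply: (@ge0_le_integral _ plane R leb2 setT measurableT) => //.
  - by move=> p _; exact: integral_ge0.
  - exact: (measurable_fun_fubini_tonelli_F (m2 := planar_measure) _ (mW n) (W_ge0 n)).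
  - exact: measurable_funeM.
  - by move=> p _; rewrite -EFinM; exact: W_p.
have := fatou leb2 measurableT mg (fun n t _ => g0 n t).
move=> /le_trans/(_ (limn_einf_le intg)) fat.
have cT : \int[leb2]_(t in T) (16^-1)%:E <= \int[leb2]_t limn_einf (g ^~ t).
  rewrite [leLHS]integral_mkcond.
  apply: (@ge0_le_integral _ plane R leb2 setT measurableT) => //.
  - by move=> q _; rewrite patchE; case: ifP => _ //; rewrite lee_fin.
  - apply/(measurable_restrictT _ mT); exact: measurable_cst.
  - under eq_fun do rewrite limn_einf_lim.
    apply: (emeasurable_fun_cvg (fun n t => einfs (g ^~ t) n)) => [n|t _].
      exact: measurable_fun_einfs.
    exact: is_cvg_einfs.
  move=> t _; rewrite patchE; case: ifPn => Tt.
    by have [N HN] := W_t (set_mem Tt); exact: limn_einf_ge HN.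
  by apply: (@limn_einf_ge _ _ 0%N) => n _; exact: g0.
have := le_trans cT fat; rewrite integral_cst//.
rewrite -(@lee_pmul2l _ 16%:E)// muleA -EFinM divff// mul1e muleA -EFinM.
by rewrite -natrM.
Qed.

End area_bound.

(** * Omitted values *)

Section disc_continuity.
Variable R : realType.
Implicit Types (z u w : R[i]) (F dF : R[i] -> R[i]) (p q : R * R).

Lemma cmod_dist z w : `|cmod z - cmod w| <= cmod (z - w).
Proof.
have := cmodD (z - w) w; rewrite subrK => h1.
have := cmodD (w - z) z; rewrite subrK cmod_distC => h2.
by rewrite ler_norml; lra.
Qed.

Lemma point_ofB p q : cmod (point_of q - point_of p) <= `|q.1 - p.1| + `|q.2 - p.2|.
Proof. exact: cmod_leReIm. Qed.

Lemma point_of_scale (s : R) p :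
  point_of (s * p.1, s * p.2) = s%:C * point_of p.
Proof. by apply/eqP; rewrite eq_complex/= !mul0r subr0 addr0 !eqxx. Qed.

Lemma ccont_continuous (g : R[i] -> R) F p :
  (forall z w, `|g z - g w| <= cmod (z - w)) -> ccont_at F (point_of p) ->
  {for p, continuous (fun q => g (F (point_of q)))}.
Proof.
move=> gle cF; apply/(@cvgrPdist_le _ R^o) => e e0.
have [d d0 dF] := cF e e0; have d20 : 0 < d / 2 by rewrite divr_gt0.
exists (ball p.1 (d / 2), ball p.2 (d / 2)).
  by split; exact: nbhsx_ballx.
move=> q [/= q1 q2].
rewrite distrC (le_trans (gle _ _))// dF// (le_lt_trans (point_ofB p q))//.
by rewrite [ltRHS]splitr ltrD// distrC.
Qed.

Lemma Re_dist z w : `|complex.Re z - complex.Re w| <= cmod (z - w).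
Proof. by rewrite -raddfB; exact: Re_le_cmod. Qed.

Lemma Im_dist z w : `|complex.Im z - complex.Im w| <= cmod (z - w).
Proof. by rewrite -(raddfB (@complex.Im R)); exact: Im_le_cmod. Qed.

Lemma ccontB F dF z : ccont_at F z -> ccont_at dF z ->
  ccont_at (fun u => F u - dF u) z.
Proof.
move=> cF cG e e0; have e20 : 0 < e / 2 by rewrite divr_gt0.
have [d d0 hd] := cF _ e20; have [d' d'0 hd'] := cG _ e20.
exists (Num.min d d'); first by rewrite lt_min d0.
move=> u; rewrite lt_min => /andP[/hd h /hd' h'].
rewrite [X in cmod X](_ : _ = (F u - F z) - (dF u - dF z)); last by ring.
by rewrite (le_trans (cmodB _ _))// [leRHS]splitr lerD.
Qed.

Lemma ccontZ (a : R[i]) F z : ccont_at F z -> ccont_at (fun u => a * F u) z.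
Proof.
move=> cF e e0; have a0 : 0 < cmod a + 1 by rewrite ltr_wpDl ?cmod_ge0.
have [|d d0 hd] := cF (e / (cmod a + 1)); first by rewrite divr_gt0.
exists d => // u /hd h; rewrite ler_pdivlMr// in h.
rewrite -mulrBr cmodM mulrC; apply: le_trans h.
by rewrite ler_wpM2l ?cmod_ge0// lerDl.
Qed.

Lemma ccont_dilate (s : R) F z : 0 < s -> ccont_at F (s%:C * z) ->
  ccont_at (fun u => F (s%:C * u)) z.
Proof.
move=> s0 cF e /cF[d d0 hd]; exists (d / s); first by rewrite divr_gt0.
move=> u; rewrite ltr_pdivlMr// => us; apply: hd.
by rewrite -mulrBr cmodM cmod_real gtr0_norm// mulrC.
Qed.

Lemma cderiv_dilate (s : R) F z (a : R[i]) : 0 < s ->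
  cderiv_at F (s%:C * z) a ->
  cderiv_at (fun u => F (s%:C * u)) z (s%:C * a).
Proof.
move=> s0 cF e e0; have [|d d0 hd] := cF (e / s); first by rewrite divr_gt0.
exists (d / s); first by rewrite divr_gt0.
move=> u; rewrite ltr_pdivlMr// => us.
have su : cmod (s%:C * u - s%:C * z) = cmod (u - z) * s.
  by rewrite -mulrBr cmodM cmod_real gtr0_norm// mulrC.
have := hd (s%:C * u); rewrite su => /(_ us).
rewrite (_ : a * _ = s%:C * a * (u - z)); last by ring.
move/le_trans; apply; rewrite le_eqVlt; apply/orP; left; apply/eqP; field.
by rewrite gt_eqF.
Qed.

Lemma cderivB F G z (a b : R[i]) : cderiv_at F z a -> cderiv_at G z b ->
  cderiv_at (fun u => F u - G u) z (a - b).
Proof.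
move=> cF cG e e0; have e20 : 0 < e / 2 by rewrite divr_gt0.
have [d d0 hd] := cF _ e20; have [d' d'0 hd'] := cG _ e20.
exists (Num.min d d'); first by rewrite lt_min d0.
move=> u; rewrite lt_min => /andP[/hd h /hd' h'].
rewrite [X in cmod X](_ : _ = (F u - F z - a * (u - z)) -
  (G u - G z - b * (u - z))); last by ring.
by rewrite (le_trans (cmodB _ _))// [e in leRHS]splitr mulrDl lerD.
Qed.

Section derivative_continuous.
Variables (F dF : R[i] -> R[i]).
Hypothesis F_deriv : forall z, cmod z < 1 -> cderiv_at F z (dF z).

(** On a disc around [z] the derivative is a uniform limit of derivatives of polynomials. *)
Lemma derivative_cont z : cmod z < 1 -> ccont_at dF z.
Proof.
move=> z1 e e0; have e30 : 0 < e / 3 by rewrite divr_gt0.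
pose r := (1 + (1 + cmod z) / 2) / 2; pose rho := (1 + cmod z) / 2.
have [z_rho rho_r r1] : [/\ cmod z < rho, rho < r & r < 1].
  by rewrite /r /rho; split; lra.
have rho0 : 0 <= rho by rewrite (le_trans (cmod_ge0 z))// ltW.
have [p pF] : exists p : {poly R[i]}, forall u, cmod u <= rho ->
    cmod (p.[u] - F u) <= e / 3 /\ cmod (p^`().[u] - dF u) <= e / 3.
  apply: poly_C1_approx rho0 rho_r e30 _ => u ur; apply: F_deriv.
  exact: le_lt_trans r1.
have [d d0 hd] := cderiv_cont (cderiv_horner p^`() z) e30.
exists (Num.min d (rho - cmod z)); first by rewrite lt_min d0 subr_gt0.
move=> u; rewrite lt_min => /andP[/hd pu uz].
have ur : cmod u <= rho.
  by rewrite -[u](subrK z) (le_trans (cmodD _ _))// -lerBrDr ltW.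
have [_ du] := pF u ur; have [_ dz] := pF z (ltW z_rho).
rewrite [X in cmod X](_ : _ = (p^`().[u] - p^`().[z]) - (p^`().[u] - dF u) +
  (p^`().[z] - dF z)); last by ring.
rewrite (le_trans (cmodD _ _))// (le_trans (lerD (cmodB _ _) (lexx _)))//.
by rewrite (le_trans (lerD (lerD pu du) dz))//; lra.
Qed.

End derivative_continuous.

End disc_continuity.

Lemma ge0_integral_add1 d (T : measurableType d) (R : realType)
    (mu : {measure set T -> \bar R}) (D : set T) (f : T -> R) :
  measurable D -> measurable_fun D f -> (forall x, 0 <= f x) ->
  (\int[mu]_(x in D) (f x + 1)%:E = \int[mu]_(x in D) (f x)%:E + mu D)%E.
Proof.
move=> mD mf f0; under eq_integral do rewrite EFinD.
rewrite ge0_integralD//; last 2 first.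
- by move=> x _; rewrite lee_fin.
- exact/measurable_EFinP.
by rewrite integral_cst// mul1e.
Qed.

(** * Dilates converge in energy *)

Section dilation_convergence.
Variable R : realType.
Implicit Types (z u w : R[i]) (p q : R * R).
Local Notation leb2 := (@lebesgue_measure R \x @lebesgue_measure R)%E.
Local Notation plane := (measurableTypeR R * measurableTypeR R)%type.
Local Notation D := (@plane_disc R).

Lemma measurable_plane_disc : measurable D.
Proof. exact: (open_prod_measurable (@open_plane_disc R)). Qed.

Lemma plane_discE p : D p = (cmod (point_of p) < 1).
Proof. by rewrite /plane_disc/= normc_lt1. Qed.

Lemma leb2_plane_disc : (leb2 D <= 4%:E)%E.
Proof.
apply: (@le_trans _ _ (leb2 (box (0, 0) 1))); last first.
  by rewrite [X in (X <= _)%E]leb2_box// expr1n mulr1.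
apply: (le_measure (@planar_measure R)); rewrite ?inE.
- exact: measurable_plane_disc.
- exact: measurable_box.
move=> p; rewrite plane_discE => p1; rewrite /box/= !subr0; split.
  exact: le_lt_trans (Re_le_cmod (point_of p)) p1.
exact: le_lt_trans (Im_le_cmod (point_of p)) p1.
Qed.

Lemma measurable_cmod_disc (G : R[i] -> R[i]) :
  (forall z, cmod z < 1 -> ccont_at G z) ->
  measurable_fun D (fun p => cmod (G (point_of p))).
Proof.
move=> cG; apply: open_continuous_prod_measurable (@open_plane_disc R) _ => p.
by rewrite plane_discE => /cG; apply: ccont_continuous => *; exact: cmod_dist.
Qed.

Variables (F dF : R[i] -> R[i]).
Hypothesis F_deriv : forall z, cmod z < 1 -> cderiv_at F z (dF z).

Let cF z (z1 : cmod z < 1) : ccont_at F z := cderiv_cont (F_deriv z1).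
Let cdF z (z1 : cmod z < 1) : ccont_at dF z := derivative_cont F_deriv z1.

Lemma complex_onem (s : R) : (1 - s)%:C = 1 - s%:C.
Proof. by apply/eqP; rewrite eq_complex/= subr0 !eqxx. Qed.

(** The shift by 2 puts the factor strictly between 0 and 1 already for [n = 0]. *)
Definition dilation (n : nat) : R := 1 - n.+2%:R^-1.

Lemma dilation_gt0 n : 0 < dilation n.
Proof. by rewrite subr_gt0 invf_lt1 ?ltr1n. Qed.

Lemma dilation_lt1 n : dilation n < 1.
Proof. by rewrite gtrBl invr_gt0. Qed.

Lemma dilation_disc n z : cmod z <= 1 -> cmod ((dilation n)%:C * z) < 1.
Proof.
move=> z1; rewrite cmodM cmod_real gtr0_norm ?dilation_gt0//.
rewrite (le_lt_trans _ (dilation_lt1 n))// ler_piMr// ltW//; exact: dilation_gt0.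
Qed.

Lemma dilation_near (d : R) : 0 < d -> exists N, forall n z, (N <= n)%N ->
  cmod z <= 1 -> cmod ((dilation n)%:C * z - z) < d.
Proof.
move=> d0; exists (Num.bound d^-1) => n z Nn z1.
rewrite (_ : _ - z = - ((n.+2%:R^-1 : R)%:C * z)); last first.
  by rewrite /dilation rmorphB/= rmorph1; ring.
rewrite cmodN cmodM cmod_real gtr0_norm ?invr_gt0//.
apply: (@le_lt_trans _ _ n.+2%:R^-1).
  by rewrite ler_piMr// invr_ge0.
rewrite -[ltRHS]invrK ltf_pV2 ?posrE ?invr_gt0//.
have d0' : 0 <= d^-1 by rewrite invr_ge0 ltW.
by rewrite (lt_le_trans (archi_boundP d0'))// ler_nat (leq_trans Nn)// ltnW.
Qed.

Variable kap : R.
Hypothesis kap0 : 0 < kap.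

Let far n : set (R * R) := [set p | D p /\
  kap <= cmod (F (point_of p) - F ((dilation n)%:C * point_of p))].

(** Energy density of [F - F(s .)] plus the indicator of the set where the two differ by at least
    [kap]. Adding them makes both integrals small for the same [n]. *)
Definition defect n p : R :=
  cmod (dF (point_of p) - (dilation n)%:C * dF ((dilation n)%:C * point_of p)) ^+ 2
  + \1_(far n) p.

Let cdF_dil n z : cmod z < 1 ->
  ccont_at (fun u => (dilation n)%:C * dF ((dilation n)%:C * u)) z.
Proof.
move=> z1; apply: ccontZ; apply: ccont_dilate; first exact: dilation_gt0.
by apply: cdF; rewrite dilation_disc// ltW.
Qed.

Let cF_dil n z : cmod z < 1 -> ccont_at (fun u => F ((dilation n)%:C * u)) z.
Proof.
move=> z1; apply: ccont_dilate; first exact: dilation_gt0.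
by apply: cF; rewrite dilation_disc// ltW.
Qed.

Lemma measurable_defect n : measurable_fun D (defect n).
Proof.
apply: measurable_funD.
  apply: measurable_funX.
  apply: (@measurable_cmod_disc
    (fun u => dF u - (dilation n)%:C * dF ((dilation n)%:C * u))) => z z1.
  by apply: ccontB; [exact: cdF|exact: cdF_dil].
apply: measurable_indic.
have mh : measurable_fun D (fun p =>
    cmod (F (point_of p) - F ((dilation n)%:C * point_of p))).
  apply: (@measurable_cmod_disc (fun u => F u - F ((dilation n)%:C * u))) => z z1.
  by apply: ccontB; [exact: cF|exact: cF_dil].
have := mh measurable_plane_disc `[kap, +oo[%classic (measurable_itv _).
congr measurable; apply/seteqP; split=> p /=; rewrite in_itv/= andbT.
  by case.
by case.
Qed.

Hypothesis energy_fin : (\int[leb2]_(p in D) (cmod (dF (point_of p)) ^+ 2)%:E < +oo)%E.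

(** The summand 1, integrable on the disc, dominates the indicator in [defect]. *)
Let A p : R := cmod (dF (point_of p)) ^+ 2 + 1.
Let B n p : R :=
  dilation n ^+ 2 * cmod (dF (point_of (dilation n * p.1, dilation n * p.2))) ^+ 2 + 1.

Let dilation_cvg : dilation n @[n --> \oo] --> (1 : R).
Proof.
apply/cvgrPdist_lt => e e0; have [N HN] := dilation_near e0.
exists N => // n /= Nn; have := HN n 1 Nn; rewrite cmod1 => /(_ (lexx _)).
rewrite mulr1 (_ : _ - 1 = (dilation n - 1)%:C); last first.
  by apply/eqP; rewrite eq_complex/= subr0 !eqxx.
by rewrite cmod_real distrC.
Qed.

Let dF_cvg p : D p ->
  cmod (dF (point_of p) - dF ((dilation n)%:C * point_of p)) @[n --> \oo] --> (0 : R).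
Proof.
rewrite plane_discE => p1; apply/cvgr0Pnorm_le => e e0.
have [d d0 hd] := cdF p1 e0; have [N HN] := dilation_near d0.
exists N => // n /= Nn; rewrite ger0_norm ?cmod_ge0// cmod_distC hd//.
by apply: HN => //; exact: ltW.
Qed.

Let norm_dF_cvg p : D p ->
  cmod (dF ((dilation n)%:C * point_of p)) @[n --> \oo] --> cmod (dF (point_of p)).
Proof.
move=> /dF_cvg/cvgr0Pnorm_le h; apply/(@cvgrPdist_le _ R^o) => e /h.
apply: filterS => n.
by rewrite ger0_norm ?cmod_ge0//; apply: le_trans; exact: cmod_dist.
Qed.

Let far_eventually p : D p -> \forall n \near \oo, \1_(far n) p = 0 :> R.
Proof.
rewrite plane_discE => p1; have k20 : 0 < kap / 2 by rewrite divr_gt0.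
have [d d0 hd] := cF p1 k20; have [N HN] := dilation_near d0.
exists N => // n /= Nn; rewrite indicE memNset// => -[_]; apply/negP; rewrite -ltNge.
rewrite cmod_distC (@le_lt_trans _ _ (kap / 2)) ?hd ?ltr_pdivrMr ?ltr_pMr ?ltr1n//.
by apply: HN => //; exact: ltW.
Qed.

Lemma defect_small (e : R) N : 0 < e -> exists2 n, (N <= n)%N &
  (\int[leb2]_(p in D) (defect n p)%:E < e%:E)%E.
Proof.
move: e N.
have mdF : measurable_fun D (fun p => cmod (dF (point_of p)) ^+ 2).
  by apply: measurable_funX; exact: measurable_cmod_disc.
have mdFs n : measurable_fun D (fun p =>
    dilation n ^+ 2 * cmod (dF (point_of (dilation n * p.1, dilation n * p.2))) ^+ 2).
  apply: measurable_funM => //; apply: measurable_funX.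
  under eq_fun do rewrite point_of_scale.
  apply: (@measurable_cmod_disc (fun u => dF ((dilation n)%:C * u))) => z z1.
  apply: ccont_dilate; first exact: dilation_gt0.
  by apply: cdF; rewrite dilation_disc// ltW.
have sq0 (x : R) : 0 <= x ^+ 2 by exact: sqr_ge0.
apply: (@fatou_vanishing _ plane R leb2 D A B defect).
- exact: measurable_plane_disc.
- exact: measurable_funD.
- by move=> n; apply: measurable_funD; [exact: mdFs|exact: measurable_cst].
- exact: measurable_defect.
- by move=> p; apply: addr_ge0.
- by move=> n p; apply: addr_ge0 => //; apply: mulr_ge0.
- by move=> n p; apply: addr_ge0.
- move=> n p Dp; rewrite /defect /A /B point_of_scale.
  have i1 : \1_(far n) p <= 1 :> R by rewrite indicE lern1 leq_b1.
  have := cmodB (dF (point_of p)) ((dilation n)%:C * dF ((dilation n)%:C * point_of p)).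
  rewrite cmodM cmod_real gtr0_norm ?dilation_gt0// -exprMn.
  have := cmod_ge0 (dF (point_of p) -
    (dilation n)%:C * dF ((dilation n)%:C * point_of p)).
  move: (cmod _) (cmod _) (_ * cmod _) i1 => y x z i1 x0 xyz.
  have : x ^+ 2 <= (y + z) ^+ 2 by rewrite lerXn2r ?nnegrE ?(le_trans x0).
  have := sqr_ge0 (y - z); move: i1; rewrite !expr2; lra.
- move=> p Dp; rewrite /A /B -[X in _ --> X + _]mul1r -[X in X * _](expr1n _ 2).
  apply: cvgD; last exact: cvg_cst.
  under eq_fun do rewrite point_of_scale.
  apply: cvgM; first by apply: cvgM; exact: dilation_cvg.
  by apply: cvgM; exact: norm_dF_cvg.
- move=> p Dp; rewrite -[X in _ --> X](addr0 (0 : R)); apply: cvgD; last first.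
    by apply: cvg_near_cst; exact: far_eventually.
  rewrite -[X in _ --> X](mulr0 (0 : R)) /=.
  under eq_fun do rewrite expr2.
  have h : cmod (dF (point_of p) -
      (dilation n)%:C * dF ((dilation n)%:C * point_of p)) @[n --> \oo] --> (0 : R).
    apply: (@squeeze_cvgr _ _ _ _ (fun=> 0) (fun n =>
      cmod (dF (point_of p) - dF ((dilation n)%:C * point_of p)) +
      (1 - dilation n) * cmod (dF ((dilation n)%:C * point_of p)))).
    - apply: nearW => n; rewrite cmod_ge0/=.
      rewrite [X in cmod X](_ : _ =
        dF (point_of p) - dF ((dilation n)%:C * point_of p) +
        ((1 - dilation n)%:C * dF ((dilation n)%:C * point_of p))); last first.
        by rewrite complex_onem; ring.
      rewrite (le_trans (cmodD _ _))// lerD2l cmodM cmod_real ger0_norm//.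
      by rewrite subr_ge0 ltW// dilation_lt1.
    - exact: cvg_cst.
    - rewrite -[X in _ --> X](addr0 (0 : R)); apply: cvgD; first exact: dF_cvg.
      rewrite -[X in _ --> X](mul0r (cmod (dF (point_of p)))).
      apply: cvgM; last exact: norm_dF_cvg.
      by rewrite -[X in _ --> X](subrr (1 : R)); apply: cvgB; first exact: cvg_cst.
  exact: cvgM.
- rewrite (@ge0_integral_add1 _ plane R leb2 D) //.
    by rewrite lte_add_pinfty// (le_lt_trans leb2_plane_disc)// ltry.
  exact: measurable_plane_disc.
- move=> n; rewrite !(@ge0_integral_add1 _ plane R leb2 D)//;
    try exact: measurable_plane_disc.
  + rewrite leeD2r//; apply: disc_integral_contract => //.
      exact: dilation_gt0.
    by apply/ltW; exact: dilation_lt1.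
  + exact: mdFs.
  + by move=> p; apply: mulr_ge0.
Qed.

End dilation_convergence.

Lemma le_integral_subset_scale d (T : measurableType d) (R : realType)
    (mu : {measure set T -> \bar R}) (E D : set T) (f g : T -> R) (k : R) :
  measurable E -> measurable D -> E `<=` D -> measurable_fun E f ->
  measurable_fun D g -> (forall x, 0 <= f x) -> (forall x, 0 <= g x) -> 0 <= k ->
  (forall x, E x -> f x <= k * g x) ->
  (\int[mu]_(x in E) (f x)%:E <= k%:E * \int[mu]_(x in D) (g x)%:E)%E.
Proof.
move=> mE mD ED mf mg f0 g0 k0 fg.
have mkg : measurable_fun D (fun x => (k * g x)%:E).
  by apply/measurable_EFinP; exact: measurable_funM.
apply: (@le_trans _ _ (\int[mu]_(x in E) (k * g x)%:E)%E).
  apply: ge0_le_integral => //.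
  - by move=> x _; rewrite lee_fin.
  - exact/measurable_EFinP.
  - exact: measurable_funS mkg.
rewrite -ge0_integralZl//; last 2 first.
- exact/measurable_EFinP.
- by move=> x _; rewrite lee_fin.
under [leRHS]eq_integral do rewrite -EFinM.
by apply: ge0_subset_integral => // x _; rewrite lee_fin mulr_ge0.
Qed.

(** * The small set and its image *)

Section omitted_value.
Variable R : realType.
Implicit Types (z u w : R[i]) (p q : R * R).
Local Notation leb2 := (@lebesgue_measure R \x @lebesgue_measure R)%E.
Local Notation plane := (measurableTypeR R * measurableTypeR R)%type.
Local Notation D := (@plane_disc R).

Lemma open_sublevel (G : R[i] -> R[i]) (k : R) :
  (forall z, cmod z < 1 -> ccont_at G z) ->
  open [set p | D p /\ cmod (G (point_of p)) < k].
Proof.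
move=> cG; rewrite openE => p [Dp pk]; rewrite /interior/=.
have /(@cvgrPdist_lt _ R^o) cp : {for p, continuous (fun q => cmod (G (point_of q)))}.
  apply: ccont_continuous; first by move=> *; exact: cmod_dist.
  by apply: cG; rewrite -plane_discE.
have k0 : 0 < k - cmod (G (point_of p)) by rewrite subr_gt0.
have Dn : nbhs p D by apply: open_nbhs_nbhs; split=> //; exact: open_plane_disc.
apply: filterS2 Dn (cp _ k0) => q Dq; rewrite distrC => h; split=> //.
by rewrite -[ltLHS](subrK (cmod (G (point_of p)))) -ltrBrDr (le_lt_trans (ler_norm _)).
Qed.

(** The derivative of [H / (u - w)] at [z] has modulus at most [|H'| / rho + k / rho ^ 2]. The
    factor 2 absorbs the remainder on a neighbourhood, which is possible because [k > 0] makes this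
    bound positive. *)
Lemma cderiv_quotient_bound (H dH : R[i] -> R[i]) z w (k rho : R) : 0 < rho ->
  cderiv_at H z (dH z) -> rho <= cmod (z - w) -> cmod (H z) <= k -> 0 < k ->
  exists2 d : R, 0 < d & forall u, cmod (u - z) < d ->
    cmod (H u / (u - w) - H z / (z - w)) <=
    2 * (cmod (dH z) / rho + k / rho ^+ 2) * cmod (u - z).
Proof.
move=> rho0 dHz zw Hz k0.
pose v := cmod (dH z) / rho + k / rho ^+ 2; rewrite -/v.
have z_w : z - w != 0 by rewrite -cmod_gt0 (lt_le_trans rho0).
pose a := H z / (z - w).
pose G x := H x - a * (x - w).
have Gz : G z = 0 by rewrite /G /a divfK ?subrr.
have dG : cderiv_at G z (dH z - a).
  move=> e /dHz[d d0 hd]; exists d => // u /hd.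
  by congr (cmod _ <= _); rewrite Gz subr0 /G /a; field.
have v0 : 0 < v.
  apply: ltr_wpDl; first by rewrite divr_ge0 ?cmod_ge0// ltW.
  by rewrite divr_gt0 ?exprn_gt0.
have zwn : z != w by rewrite -subr_eq0.
have [d d0 hd] := cderiv_div Gz zwn dG v0.
exists (Num.min d rho); first by rewrite lt_min d0.
move=> u; rewrite lt_min => /andP[/hd ud urho].
have u_w : u - w != 0.
  rewrite subr_eq0; apply: contraTneq urho => ->.
  by rewrite -leNgt cmod_distC.
have -> : H u / (u - w) - H z / (z - w) = G u / (u - w).
  by rewrite /G /a; field; rewrite u_w.
rewrite Gz mul0r subr0 in ud.
rewrite -[G u / (u - w)](subrK ((dH z - a) / (z - w) * (u - z))).
rewrite (le_trans (cmodD _ _))// -[leRHS]mulrA [leRHS]mulr_natl [leRHS]mulr2n lerD//.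
rewrite cmodM ler_wpM2r ?cmod_ge0//.
have irho : (cmod (z - w))^-1 <= rho^-1.
  by rewrite lef_pV2 ?posrE// (lt_le_trans rho0).
have arho : cmod a <= k / rho.
  by rewrite /a cmodM cmodV ler_pM ?cmod_ge0 ?invr_ge0 ?cmod_ge0.
rewrite cmodM cmodV (le_trans (ler_wpM2l (cmod_ge0 _) irho))//.
rewrite (le_trans (ler_wpM2r _ (cmodB _ _))) ?invr_ge0 ?(ltW rho0)//.
rewrite mulrDl lerD2l expr2 invfM mulrA ler_wpM2r ?invr_ge0 ?(ltW rho0)//.
Qed.

Variables (F dF : R[i] -> R[i]).
Hypothesis F_deriv : forall z, cmod z < 1 -> cderiv_at F z (dF z).
Hypothesis energy_fin : (\int[leb2]_(p in D) (cmod (dF (point_of p)) ^+ 2)%:E < +oo)%E.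

(* If every value were attained, [H = F - P + P(w) - lam] would satisfy
   [H = t (z - w)] somewhere for each small [t]; the image of the small set
   [|H| < kap / 2] under [H / (z - w)] would then have too large an area. *)
Lemma omitted_value w lam : cmod w < 1 -> lam != F w ->
  exists (P : {poly R[i]}) (t : R[i]), forall z, cmod z < 1 ->
    F z - P.[z] + P.[w] - lam != t * (z - w).
Proof.
move=> w1 lamF; apply: contrapT => nex.
have hit (P : {poly R[i]}) (t : R[i]) : exists2 z, cmod z < 1 &
    F z - P.[z] + P.[w] - lam = t * (z - w).
  apply: contrapT => nz; apply: nex; exists P, t => z z1.
  by apply/eqP => E; apply: nz; exists z.
pose kap := cmod (F w - lam).
have kap0 : 0 < kap by rewrite cmod_gt0 subr_eq0 eq_sym.
have cF z : cmod z < 1 -> ccont_at F z by move=> /F_deriv/cderiv_cont.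
have [|d1 d10 Fw] := cF w w1 (kap / 16); first by rewrite divr_gt0.
(* Half of [d1]: if [z] is within [rho] of [w], then [z] and [s z] are both within [d1] of [w]. *)
pose rho := d1 / 2; have rho0 : 0 < rho by rewrite divr_gt0.
(* For [t] in the square of half-side [del] one has [|t| < kap / 4]. Since [|z - w| <= 2], any
   solution of [H z = t (z - w)] then lies in [E]. *)
pose del := kap / 8; have del0 : 0 < del by rewrite divr_gt0.
pose Kc := 4 / rho ^+ 2 + 2 * kap ^+ 2 / rho ^+ 4.
have Kc0 : 0 < Kc.
  by rewrite addr_gt0// divr_gt0 ?mulr_gt0 ?exprn_gt0.
have [N HN] := dilation_near rho0.
have kap40 : 0 < kap / 4 by rewrite divr_gt0.
(* [64 * Kc * (del ^ 2 / (16 * Kc)) = 4 * del ^ 2], the area of the target square. *)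
have [|n Nn small] := @defect_small R F dF F_deriv _ kap40 energy_fin
  (del ^+ 2 / (16 * Kc)) N.
  by rewrite divr_gt0 ?mulr_gt0 ?exprn_gt0.
set s := dilation R n in small; have s0 : 0 < s by exact: dilation_gt0.
have s1 : s < 1 by exact: dilation_lt1.
(* A radius between 1 and [1 / s]: the dilate is differentiable on a disc larger than the unit
   disc. *)
pose r := (1 + s^-1) / 2.
have sV : 1 < s^-1 by rewrite invf_gt1.
have r1 : 1 < r by rewrite /r; lra.
have sr : s * r < 1.
  by rewrite /r mulrA mulrDr mulr1 divff ?gt_eqF//; lra.
(* The values must be matched to within [kap / 16]. For derivatives an error of 1 is enough, since
   on [E] the indicator in [defect] pays for it. *)
pose eps := Num.min (kap / 16) 1.
have eps0 : 0 < eps by rewrite lt_min ltr01 divr_gt0.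
have [|P PF] := poly_C1_approx (f := fun z => F (s%:C * z))
    (df := fun z => s%:C * dF (s%:C * z)) ler01 r1 eps0.
  move=> u ur; apply: cderiv_dilate => //; apply: F_deriv.
  rewrite cmodM cmod_real gtr0_norm// (le_lt_trans _ sr)//.
  by rewrite ler_pM2l.
have eps1 : eps <= 1 by rewrite ge_min lexx orbT.
have epsk : eps <= kap / 16 by rewrite ge_min lexx.
pose H z := F z - P.[z] + P.[w] - lam.
pose dH z := dF z - P^`().[z].
have H_deriv z : cmod z < 1 -> cderiv_at H z (dH z).
  move=> z1; have h := cderivB (F_deriv z1) (cderiv_horner P z).
  move=> e /h[d d0 hd]; exists d => // u /hd; congr (cmod _ <= _).
  by rewrite /H /dH; ring.
have cH z : cmod z < 1 -> ccont_at H z by move=> /H_deriv/cderiv_cont.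
have cdH z : cmod z < 1 -> ccont_at dH z by exact: derivative_cont H_deriv z.
pose E := [set p | D p /\ cmod (H (point_of p)) < kap / 2].
have oE : open E by exact: open_sublevel.
(* Of [|H w| = kap], less than [kap / 2] is due to [|H z|] and at most [3 * kap / 16] to the three
   approximation errors, leaving more than [kap / 4]. *)
have E_far p : E p -> kap / 4 <= cmod (F (point_of p) - F (s%:C * point_of p)).
  case; rewrite plane_discE; move: (point_of p) => z z1 Hz.
  have h1 : cmod (P.[z] - F (s%:C * z)) <= kap / 16.
    by rewrite (le_trans _ epsk)//; case: (PF z (ltW z1)).
  have h2 : cmod (P.[w] - F (s%:C * w)) <= kap / 16.
    by rewrite (le_trans _ epsk)//; case: (PF w (ltW w1)).
  have h3 : cmod (F (s%:C * w) - F w) <= kap / 16.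
    apply: Fw; rewrite (lt_le_trans (HN n w Nn (ltW w1)))//.
    by rewrite /rho ler_pdivrMr// ler_peMr ?ler1n// ltW.
  have : kap <= cmod (H z) + cmod (F z - F (s%:C * z)) + cmod (P.[z] - F (s%:C * z)) +
      cmod (P.[w] - F (s%:C * w)) + cmod (F (s%:C * w) - F w).
    rewrite /kap (_ : F w - lam = H z - (F z - F (s%:C * z)) +
      (P.[z] - F (s%:C * z)) - (P.[w] - F (s%:C * w)) - (F (s%:C * w) - F w)).
      do 2 (rewrite (le_trans (cmodB _ _))// lerD2r).
      by rewrite (le_trans (cmodD _ _))// lerD2r cmodB.
    by rewrite /H; ring.
  by move: Hz h1 h2 h3; lra.
have E_rho p : E p -> rho <= cmod (point_of p - w).
  move=> Ep; have := E_far p Ep; case: Ep; rewrite plane_discE.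
  move: (point_of p) => z z1 _; rewrite leNgt => far; rewrite leNgt.
  apply: contra far => zw; have hz : cmod (F z - F w) <= kap / 16.
    by apply: Fw; rewrite (lt_trans zw)// /rho ltr_pdivrMr// ltr_pMr// ltr1n.
  have hs : cmod (F (s%:C * z) - F w) <= kap / 16.
    apply: Fw; rewrite -[_ - w](subrKA z) (le_lt_trans (cmodD _ _))//.
    by rewrite [ltRHS]splitr ltrD// HN// ltW.
  rewrite -[F z - _](subrKA (F w)) (le_lt_trans (cmodD _ _))//.
  by rewrite [X in _ + X]cmod_distC; move: kap0 hz hs; lra.
pose v p := cmod (dH (point_of p)) / rho + kap / rho ^+ 2.
have v0 p : 0 < v p.
  apply: ltr_wpDl; first by rewrite divr_ge0 ?cmod_ge0// ltW.
  by rewrite divr_gt0 ?exprn_gt0.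
pose phi z := H z / (z - w).
have v_defect p : E p -> v p ^+ 2 <= Kc * defect F dF (kap / 4) n p.
  (* With [x = |dH|] and [y] the modulus in [defect]: [v ^ 2 <= 2 x ^ 2 / rho ^ 2 + 2 kap ^ 2 / rho
     ^ 4] and [x ^ 2 <= 2 (y ^ 2 + 1)], whence [Kc]. *)
  move=> Ep; have Dp : D p by case: Ep.
  have z1 : cmod (point_of p) <= 1 by rewrite ltW// -plane_discE.
  rewrite /defect indicE mem_set; last by split=> //; exact: E_far.
  have : cmod (dH (point_of p)) <=
      cmod (dF (point_of p) - s%:C * dF (s%:C * point_of p)) + 1.
    rewrite /dH -[_ - _](subrKA (s%:C * dF (s%:C * point_of p))).
    rewrite (le_trans (cmodD _ _))// lerD2l cmod_distC (le_trans _ eps1)//.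
    by case: (PF _ z1).
  rewrite /v /Kc -/s; move: (cmod_ge0 (dH (point_of p))).
  move: (cmod _) (cmod _) => y x x0 xy.
  have i0 : 0 < rho^-1 by rewrite invr_gt0.
  rewrite -!exprVn; move: rho^-1 i0 => i i0.
  rewrite -[i ^+ 4]/(i ^+ (2 + 2)) exprD.
  have x2 : x ^+ 2 <= 2 * (y ^+ 2 + 1).
    have : x ^+ 2 <= (y + 1) ^+ 2 by rewrite lerXn2r ?nnegrE// (le_trans x0).
    have := sqr_ge0 (y - 1); rewrite !expr2; lra.
  have := sqr_ge0 (x * i - kap * i ^+ 2) => h.
  have hx : x ^+ 2 * i ^+ 2 <= 2 * (y ^+ 2 + 1) * i ^+ 2.
    by rewrite ler_wpM2r ?sqr_ge0.
  have hk : 0 <= 2 * kap ^+ 2 * (i ^+ 2 * i ^+ 2) * y ^+ 2.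
    apply: mulr_ge0; last exact: sqr_ge0.
    by do 2 (apply: mulr_ge0 => //; try exact: sqr_ge0).
  apply: (@le_trans _ _ (2 * (x ^+ 2 * i ^+ 2) + 2 * kap ^+ 2 * (i ^+ 2 * i ^+ 2))).
    by rewrite -subr_ge0 [X in 0 <= X](_ : _ = (x * i - kap * i ^+ 2) ^+ 2)//; ring.
  by move: hx hk; rewrite !mulrDl !mulrDr !mulr1; lra.
have mE : measurable E by exact: open_prod_measurable.
have phi_local p : E p -> exists2 d : R, 0 < d & forall u, cmod (u - point_of p) < d ->
    cmod (phi u - phi (point_of p)) <= 2 * v p * cmod (u - point_of p).
  move=> Ep; apply: cderiv_quotient_bound => //.
  - by apply: H_deriv; rewrite -plane_discE; case: Ep.
  - exact: E_rho.
  - by case: Ep => _ /ltW/le_trans; apply; rewrite ler_pdivrMr// ler_pMr// ler1n.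
have phi_cont p : E p -> ccont_at phi (point_of p).
  move=> Ep e e0; have [d d0 hd] := phi_local p Ep.
  have v20 : 0 < 2 * v p by rewrite mulr_gt0.
  exists (Num.min d (e / (2 * v p))); first by rewrite lt_min d0 divr_gt0.
  move=> u; rewrite lt_min => /andP[/hd h]; rewrite ltr_pdivlMr// => ue.
  by rewrite (le_trans h)// mulrC ltW.
have mv : measurable_fun E v.
  apply: measurable_funD => //; apply: measurable_funM => //.
  apply: open_continuous_prod_measurable => // p [Dp _].
  apply: ccont_continuous; first by move=> *; exact: cmod_dist.
  by apply: cdH; rewrite -plane_discE.
pose T := box (0, 0) del.
have bound : (leb2 T <= 64%:E * \int[leb2]_(p in E) (v p ^+ 2)%:E)%E.
  apply: (@area_bound R E T (fun p => complex.Re (phi (point_of p)))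
    (fun p => complex.Im (phi (point_of p))) v) => //.
  - exact: measurable_box.
  - apply: open_continuous_prod_measurable => // p Ep.
    by apply: ccont_continuous; [exact: Re_dist|exact: phi_cont].
  - apply: open_continuous_prod_measurable => // p Ep.
    by apply: ccont_continuous; [exact: Im_dist|exact: phi_cont].
  - move=> p Ep; have [Dp Hp] := Ep; have p1 := Dp; rewrite plane_discE in p1.
    have [a1 a10 ha1] := phi_local p Ep.
    have [|a2 a20 ha2] := cH _ p1 ((kap / 2 - cmod (H (point_of p))) / 2).
      by rewrite divr_gt0// subr_gt0.
    (* This tolerance changes [|dH| / rho] by at most [v p / 2], hence [v p <= 2 * v q] nearby. *)
    have [|a3 a30 ha3] := cdH _ p1 (rho * (v p / 2)).
      by rewrite mulr_gt0// divr_gt0.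
    pose a := Num.min (Num.min a1 a2) (Num.min a3 (1 - cmod (point_of p))).
    exists (a / 2).
      by rewrite divr_gt0// !lt_min a10 a20 a30 subr_gt0.
    move=> d q da [q1 q2].
    have qd : cmod (point_of q - point_of p) < d + d.
      by rewrite (le_lt_trans (point_ofB p q))// ltrD.
    have qa : cmod (point_of q - point_of p) < a.
      by rewrite (lt_trans qd)// [ltRHS]splitr ltrD.
    move: qa; rewrite !lt_min => /andP[/andP[/ha1 h1 /ha2 h2] /andP[/ha3 h3 h4]].
    have vd : 2 * v p * cmod (point_of q - point_of p) < 4 * v p * d.
      rewrite (_ : 4 * v p * d = 2 * v p * (d + d)); last by ring.
      by rewrite ltr_pM2l// mulr_gt0.
    split.
    + split.
        rewrite plane_discE -[point_of q](subrK (point_of p)).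
        by rewrite (le_lt_trans (cmodD _ _))// -ltrBrDr.
      rewrite -[H _](subrK (H (point_of p))) (le_lt_trans (cmodD _ _))//.
      by move: h2 Hp; lra.
    + have : cmod (dH (point_of p)) / rho <= cmod (dH (point_of q)) / rho + v p / 2.
        rewrite ler_pdivrMr// mulrDl divfK ?gt_eqF// [v p / 2 * rho]mulrC.
        rewrite -lerBlDl (le_trans (ler_norm _))//.
        by rewrite (le_trans (cmod_dist _ _))// cmod_distC.
      have vE x : v x = cmod (dH (point_of x)) / rho + kap / rho ^+ 2 by [].
      by move: (vE p) (vE q); lra.
    + by rewrite (le_lt_trans (Re_dist _ _))// (le_lt_trans h1).
    + by rewrite (le_lt_trans (Im_dist _ _))// (le_lt_trans h1).
  - move=> t [/= t1 t2]; rewrite !subr0 in t1 t2.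
    have [z z1 Hz] := hit P (point_of t).
    have tdel : cmod (point_of t) < del + del.
      by rewrite (le_lt_trans (cmod_leReIm _))//; exact: ltrD.
    have zw2 : cmod (z - w) <= 2.
      by rewrite (le_trans (cmodB _ _))// -[leRHS]/(1 + 1 : R) lerD// ltW.
    have zE : point_of (complex.Re z, complex.Im z) = z by case: (z).
    have Ez : E (complex.Re z, complex.Im z).
      split; rewrite ?plane_discE zE// -[H z]/(F z - P.[z] + P.[w] - lam) Hz cmodM.
      apply: (@le_lt_trans _ _ (cmod (point_of t) * 2)).
        by rewrite ler_wpM2l ?cmod_ge0.
      by move: tdel; rewrite /del; lra.
    exists (complex.Re z, complex.Im z) => //; rewrite zE.
    have zw : z - w != 0.
      by rewrite -cmod_gt0 (lt_le_trans rho0)// -[z in z - w]zE; exact: E_rho.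
    rewrite /phi -[H z]/(F z - P.[z] + P.[w] - lam) Hz mulfK//.
    by case: (t).
have int_v : (\int[leb2]_(p in E) (v p ^+ 2)%:E <= Kc%:E *
    \int[leb2]_(p in D) (defect F dF (kap / 4) n p)%:E)%E.
  apply: (@le_integral_subset_scale _ plane R leb2) => //.
  - exact: measurable_plane_disc.
  - by move=> p [].
  - exact: measurable_funX.
  - exact: measurable_defect.
  - by move=> p; exact: sqr_ge0.
  - by move=> p; rewrite addr_ge0// sqr_ge0.
  - exact: ltW.
have : (leb2 T < (4 * del ^+ 2)%:E)%E.
  apply: (le_lt_trans bound); apply: (le_lt_trans (lee_wpmul2l _ int_v)) => //.
  rewrite muleA -EFinM.
  have -> : (4 * del ^+ 2)%:E = ((64 * Kc)%:E * (del ^+ 2 / (16 * Kc))%:E)%E.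
    by rewrite -EFinM; congr (_%:E); field; rewrite gt_eqF.
  by rewrite lte_pmul2l// lte_fin mulr_gt0.
by rewrite [X in (X < _)%E -> _]leb2_box// ltxx.
Qed.

End omitted_value.

(** * The Dirichlet space *)

Section dirichlet_polynomials.
Variable R : realType.
Implicit Types (z u w : R[i]) (p q : {poly R[i]}).
Local Notation leb2 := (@lebesgue_measure R \x @lebesgue_measure R)%E.
Local Notation D := (@plane_disc R).

(** Balls in [R[i]^o] have complex radii. Positivity forces such a radius to be real, which connects
    the library's filters with the estimates in [cmod]. *)
Lemma nbhs_cmod z (P : set R[i]^o) :
  (\forall u \near (z : R[i]^o), P u) <->
  exists2 d : R, 0 < d & forall u, cmod (u - z) < d -> P u.
Proof.
split=> [/nbhs_ballP[[d i]] /= /[!ltcE]/= /andP[/eqP -> d0] dP|[d d0 dP]].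
  exists d => // u uz; apply: dP; rewrite /ball/= -[d +i* 0]/(d%:C).
  by rewrite ltc_normc -/(cmod _) cmod_distC.
apply/nbhs_ballP; exists d%:C => /=; first by rewrite ltcR.
by move=> u; rewrite /ball/= ltc_normc -/(cmod _) cmod_distC; exact: dP.
Qed.

Let quot (f : R[i]^o -> R[i]^o) (z : R[i]^o) (h : R[i]^o) : R[i]^o :=
  h^-1 *: ((f \o shift z) (h *: (1 : R[i]^o)) - f z).

Let quotE f z (h a : R[i]) : h != 0 ->
  cmod (a - quot f z h) * cmod h = cmod (f (z + h) - f z - a * h).
Proof.
move=> h0; rewrite -cmodM -cmodN; congr cmod.
have -> : quot f z h = h^-1 * (f (z + h) - f z) :> R[i].
  rewrite /quot /= [h%:A](mulr1 h) (_ : h + z = z + h)//; exact: addrC.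
by move: (f (z + h)) (f z) => x y; field.
Qed.

Lemma cderiv_cvg (f : R[i]^o -> R[i]^o) z (a : R[i]) :
  cderiv_at f z a <-> quot f z h @[h --> 0^'] --> (a : R[i]^o).
Proof.
split=> [fz|/cvgrPdist_lt qa e e0].
  apply/cvgrPdist_lt => -[e i] /[!ltcE]/= /andP[/eqP -> e0].
  have e20 : 0 < e / 2 by rewrite divr_gt0.
  have [d d0 hd] := fz _ e20; apply/nbhs_cmod; exists d => // h.
  rewrite subr0 => hd' h0.
  rewrite -[e +i* 0]/(e%:C) ltc_normc -/(cmod _).
  have c0 : 0 < cmod h by rewrite cmod_gt0.
  rewrite -(ltr_pM2r c0) quotE// (@le_lt_trans _ _ (e / 2 * cmod h))//.
    by have := hd (z + h); rewrite [z + h]addrC addrK; apply.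
  by rewrite ltr_pM2r// ltr_pdivrMr// ltr_pMr// ltr1n.
have e0' : 0 < e%:C :> R[i] by rewrite ltcR.
have /nbhs_cmod[d d0 hd] := qa _ e0'; exists d => // u uz.
have [->|uzn] := eqVneq u z.
  by rewrite !subrr mulr0 subrr cmod0 mulr0.
have h0 : u - z != 0 by rewrite subr_eq0.
have := hd (u - z); rewrite subr0 => /(_ uz h0).
rewrite ltc_normc -/(cmod _) => /ltW h; rewrite -[u in f u](subrKC z) -quotE//.
by rewrite ler_wpM2r ?cmod_ge0.
Qed.

Lemma derivable_cderiv (f : R[i]^o -> R[i]^o) (z : R[i]^o) :
  derivable f z 1 -> cderiv_at f z ('D_1 f z).
Proof.
by move=> /cvg_ex[l lP]; apply/cderiv_cvg; rewrite /derive (cvg_lim _ lP).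
Qed.

Lemma cderiv_derivable (f : R[i]^o -> R[i]^o) (z : R[i]^o) (a : R[i]) :
  cderiv_at f z a -> derivable f z 1 /\ 'D_1 f z = a.
Proof.
move=> /cderiv_cvg fa; split; first by apply/cvg_ex; exists a.
exact: (cvg_lim _ fa).
Qed.

Lemma zero_extE (f : disc R -> R[i]^o) (z : disc R) : zero_ext f (val z) = f z.
Proof. by rewrite /zero_ext valK. Qed.

Lemma cderiv_near_disc (f g : R[i] -> R[i]) z a : cmod z < 1 ->
  (forall u, cmod u < 1 -> f u = g u) -> cderiv_at f z a -> cderiv_at g z a.
Proof.
move=> z1 fg fz e /fz[d d0 hd].
exists (Num.min d (1 - cmod z)); first by rewrite lt_min d0 subr_gt0.
move=> u; rewrite lt_min => /andP[/hd + uz]; rewrite !fg//.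
by rewrite -[u](subrK z) (le_lt_trans (cmodD _ _))// -ltrBrDr.
Qed.

Lemma holomorphic_cderiv (f : disc R -> R[i]^o) z : holomorphic f ->
  cmod z < 1 -> cderiv_at (zero_ext f) z ('D_1 (zero_ext f) (z : R[i]^o)).
Proof.
move=> hf z1; apply: derivable_cderiv; apply: holomorphic_derivable => //.
by rewrite normc_lt1.
Qed.

Definition poly_fun p (z : disc R) : R[i]^o := p.[val z].

Lemma cderiv_poly_fun p z : cmod z < 1 ->
  cderiv_at (zero_ext (poly_fun p)) z p^`().[z].
Proof.
move=> z1; have := cderiv_horner p z; apply: cderiv_near_disc => // u.
rewrite -normc_lt1 => u1.
by rewrite -[u]/(val (exist _ u u1 : disc R)) zero_extE.
Qed.

Lemma holomorphic_poly p : poly_fun p \in @holomorphic_pred R.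
Proof.
apply/asboolP => z; have z1 : cmod (val z) < 1 by rewrite -normc_lt1; exact: (valP z).
by have [] := cderiv_derivable (cderiv_poly_fun p z1).
Qed.

Definition hol_poly p : hol R := Hol (holomorphic_poly p).

Lemma dirichlet_poly_proof p : hol_poly p \in @dirichlet_pred R.
Proof.
rewrite dirichlet_predE; have [B B0 pB] := poly_disc_bounded p^`().
apply: (@le_lt_trans _ _ (\int[leb2]_(q in D) (B ^+ 2)%:E)%E).
  apply: (@ge0_le_integral _ (measurableTypeR R * measurableTypeR R)%type R leb2 D
    (@measurable_plane_disc R)).
  - by move=> q _; rewrite lee_fin sqr_ge0.
  - exact: (measurable_dirichlet_integrand (asboolW (holomorphic_poly p))).
  - exact: measurable_cst.
  move=> q; rewrite plane_discE => q1.
  rewrite lee_fin (cderiv_derivable (cderiv_poly_fun p q1)).2.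
  by rewrite lerXn2r ?nnegrE ?(ltW B0) ?pB// cmod_ge0.
rewrite integral_cst; last exact: measurable_plane_disc.
rewrite lte_mul_pinfty ?lee_fin ?sqr_ge0//.
by rewrite (le_lt_trans (@leb2_plane_disc R))// ltry.
Qed.

Definition dirichlet_poly p : dirichlet R := Dirichlet (dirichlet_poly_proof p).

Lemma dirichlet_polyE p (z : disc R) : dirichlet_poly p z = p.[val z].
Proof. by []. Qed.

Lemma dirichlet_poly_linear : linear dirichlet_poly.
Proof.
move=> a p q; apply/val_inj; rewrite linearP/=.
apply/val_inj; rewrite linearP/=; apply/funext => z.
rewrite /poly_fun hornerD hornerZ//.
Qed.


Lemma dirichlet_energy (f : dirichlet R) :
  (\int[leb2]_(q in D)
     (cmod ('D_1 (zero_ext f) (point_of q)) ^+ 2)%:E < +oo)%E.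
Proof. by have := dirichlet_holP f; rewrite dirichlet_predE. Qed.

Lemma dirichlet_cderiv (f : dirichlet R) z : cmod z < 1 ->
  cderiv_at (zero_ext f) z ('D_1 (zero_ext f) (z : R[i]^o)).
Proof. by apply: holomorphic_cderiv; exact: asboolW (hol_funP f). Qed.

Lemma dirichlet_point_eval (L : {linear dirichlet R -> R[i]^o}) :
  (forall f : dirichlet R, nowhere_vanishing f -> L f != 0) ->
  exists w : disc R, forall f : dirichlet R, L f = L (dirichlet_poly 1) * f w.
Proof.
move=> L0; pose Lam p := L (dirichlet_poly p).
have linLam : linear Lam.
  by move=> a p q; rewrite /Lam dirichlet_poly_linear linearP.
have [LL LLE] : exists LL : {linear {poly R[i]} -> R[i]^o}, LL =1 Lam.
  pose LL : {linear {poly R[i]} -> R[i]^o} :=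
    HB.pack Lam (GRing.isLinear.Build _ _ _ _ Lam linLam).
  by exists LL.
have LL0 p : (forall z, cmod z < 1 -> p.[z] != 0) -> LL p != 0.
  move=> p0; rewrite LLE; apply: L0 => z; rewrite dirichlet_polyE p0//.
  by rewrite -normc_lt1; exact: (valP z).
have [w w1 LLw] := functional_poly_eval LL0.
have w1' : `|w| < 1 by rewrite normc_lt1.
pose wd : disc R := exist _ w w1'.
exists wd => f; set c := L (dirichlet_poly 1).
have c0 : c != 0 by apply: L0 => z; rewrite dirichlet_polyE hornerE oner_neq0.
apply: contrapT => Lf.
have lamF : L f / c != zero_ext f w.
  apply/eqP => E; apply: Lf.
  rewrite -[w in zero_ext f w]/(val wd) zero_extE in E.
  by rewrite -E mulrCA divff// mulr1.
have [P [t Pt]] := omitted_value (dirichlet_cderiv f) (dirichlet_energy f) w1 lamF.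
(* Here [f - q] is [H - t (X - w)], which has no zero, while [q(w) = L f / c] forces
   [L (f - q) = 0]. *)
pose q : {poly R[i]} := P - (P.[w])%:P + (L f / c)%:P + t *: ('X - w%:P).
have : L (f - dirichlet_poly q) != 0.
  apply: L0 => z; have z1 : cmod (val z) < 1 by rewrite -normc_lt1; exact: (valP z).
  have -> : (f - dirichlet_poly q) z = f z - q.[val z] :> R[i] by [].
  rewrite -zero_extE; apply: contra_neq (Pt _ z1) => /eqP; rewrite subr_eq0 => /eqP ->.
  by rewrite /q !(hornerD, hornerN, hornerC, hornerZ, hornerX); ring.
rewrite raddfB/= -[L (dirichlet_poly q)]/(Lam q) -LLE LLw LLE -[Lam 1]/c.
have -> : q.[w] = L f / c.
  rewrite /q !(hornerD, hornerN, hornerC, hornerZ, hornerX).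
  by rewrite subrr add0r subrr mulr0 addr0.
by rewrite mulrCA divff// mulr1 subrr eqxx.
Qed.

End dirichlet_polynomials.

Theorem theorem1p2 (R : realType) (T : {linear dirichlet R -> hol R}) :
  (forall f : dirichlet R, nowhere_vanishing f -> nowhere_vanishing (T f)) ->
  exists (phi : disc R -> disc R) (psi : disc R -> R[i]),
    [/\ holomorphic (fun z : disc R => val (phi z)),
        holomorphic psi,
        nowhere_vanishing psi &
        forall (f : dirichlet R) (z : disc R), T f z = psi z * f (phi z)].
Proof.
move=> T0; pose psi (z : disc R) : R[i] := T (dirichlet_poly 1) z.
have poly1_nv : nowhere_vanishing (dirichlet_poly 1 : dirichlet R).
  by move=> z; rewrite dirichlet_polyE hornerE oner_neq0.
have psi0 z : psi z != 0 by exact: T0.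
have ev (z : disc R) : exists w : disc R,
    forall f : dirichlet R, T f z = psi z * f w.
  pose Lz (f : dirichlet R) : R[i]^o := T f z.
  have linL : linear Lz by move=> a f g; rewrite /Lz linearP.
  have [L LE] : exists L : {linear dirichlet R -> R[i]^o}, L =1 Lz.
    pose L : {linear dirichlet R -> R[i]^o} :=
      HB.pack Lz (GRing.isLinear.Build _ _ _ _ Lz linL).
    by exists L.
  have [|w Lw] := @dirichlet_point_eval R L.
    by move=> f /T0; rewrite LE; apply.
  by exists w => f; have := Lw f; rewrite !LE.
have [phi phiE] := choice ev.
exists phi, psi; split => //; last exact: asboolW (hol_funP (T (dirichlet_poly 1))).
move=> z; have hX := asboolW (hol_funP (T (dirichlet_poly 'X))).
have h1 := asboolW (hol_funP (T (dirichlet_poly 1))).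
(* The points [phi z] were merely chosen one by one. Testing on ['X] and 1 shows [phi = T X / T 1],
   whence holomorphy. Off the disc both sides are 0, thanks to the factor coming from [T X]. *)
have -> : zero_ext (fun z => val (phi z)) =
    (zero_ext (T (dirichlet_poly 'X)) * (fun u => (zero_ext psi u)^-1))
    :> (R[i]^o -> R[i]^o).
  apply/funext => u; rewrite /zero_ext/= fctE; case: insubP => [v _ _|_].
    by rewrite phiE dirichlet_polyE hornerX mulrAC divff ?mul1r.
  by rewrite mul0r.
apply: derivableM; first exact: hX.
by apply: derivableV; [rewrite zero_extE psi0|exact: h1].
Qed.
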